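(* Let $\alpha\in(0,1)$, $\gamma\ge2$, $T>0$, let $h\in C^{1+\alpha/2}([0,T];L^\gamma_\omega)$ satisfy $h(0)=0$ and $h'(0)=0$, and let $v$ be the solution of the half-line problem $$\partial_tv(t,y)=\partial_y^2v(t,y),\qquad v(0,y)=0,\qquad v(t,0)=h(t)\qquad (t\in[0,T],\ y\ge 0).$$ Then $$|\partial_tv|^{L^\gamma_\omega}_{(\alpha,\alpha/2);[0,T]\times\mathbb R_+}+|\partial_y^2v|^{L^\gamma_\omega}_{(\alpha,\alpha/2);[0,T]\times\mathbb R_+}\le C\,[h']^{L^\gamma_\omega}_{\alpha/2;[0,T]},$$ where $C=C(\alpha,\gamma,T)$. Moreover, if $v_1$ and $v_2$ are the solutions corresponding to boundary data $h_1$ and $h_2$, respectively (of the same class, with $h_1(0)=h_2(0)=0$), and if $h_1'(0)=h_2'(0)=0$, then $$\sup_{(t,y)\in[0,T]\times\mathbb R_+}\mathbb E\bigl|\partial_y^2v_1(t,y)-\partial_y^2v_2(t,y)\bigr|^\gamma\le C\sup_{t\in[0,T]}\mathbb E\bigl|h_1'(t)-h_2'(t)\bigr|^\gamma.$$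
   Context: $L^\gamma_\omega:=L^\gamma(\Omega;\mathbb R)$ for a probability space $(\Omega,\mathcal F,\mathbb P)$, and $\mathbb E$ is expectation. $C^{1+\alpha/2}([0,T];L^\gamma_\omega)$ is the space of continuously differentiable $L^\gamma_\omega$-valued functions on $[0,T]$ whose derivative is $\alpha/2$-Hölder continuous, and $[h']^{L^\gamma_\omega}_{\alpha/2;[0,T]}:=\sup_{t\ne s}\|h'(t)-h'(s)\|_{L^\gamma_\omega}/|t-s|^{\alpha/2}$. For $L^\gamma_\omega$-valued $\phi$ on $[0,T]\times\mathbb R_+$, $$|\phi|^{L^\gamma_\omega}_{(\alpha,\alpha/2);[0,T]\times\mathbb R_+}:=\sup_{(t,y)}\|\phi(t,y)\|_{L^\gamma_\omega}+\sup_{(t,y)\ne(s,z)}\frac{\|\phi(t,y)-\phi(s,z)\|_{L^\gamma_\omega}}{|y-z|^\alpha+|t-s|^{\alpha/2}}.$$ ''The solution'' of the half-line problem with boundary datum $h$ is the one given for $y>0$ by the Poisson formula $v(t,y)=\int_0^tP(s,y)h(t-s)\,ds$, $P(s,y)=\frac{y}{2\sqrt\pi\,s^{3/2}}e^{-y^2/(4s)}$, with $v(t,0)=h(t)$. *)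

(* Defs.v *)
From HB Require Import structures.
From mathcomp Require Import all_boot all_order all_algebra.
From mathcomp Require Import all_classical all_reals all_analysis.

Set Implicit Arguments.
Unset Strict Implicit.
Unset Printing Implicit Defensive.

Import Order.TTheory GRing.Theory Num.Theory.
Import numFieldTopology.Exports numFieldNormedType.Exports.

Local Open Scope classical_set_scope.
Local Open Scope ring_scope.

(* Elements of L^gamma are represented by functions [f \in Lfun P gamma%:E];
   they are only ever compared through [Lgnorm] or almost everywhere. *)

Section Lgamma_valued.
Context {d : measure_display} {Omega : measurableType d} {R : realType}.
Variables (P : probability Omega R) (gamma : R).

Implicit Types (D : set R) (phi : R -> R -> Omega -> R).

Definition Lgnorm (f : Omega -> R) : \bar R := 'N[P]_(gamma%:E)[EFin \o f]%E.
Arguments Lgnorm f%_ring_scope : clear implicits.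

(* L^gamma-valued simple functions on the line: [sf_label] is a measurable map
   into a finite type, and the value at s is [sf_val (sf_label s)]. *)
Record simple_fun := SimpleFun {
  sf_index : finType;
  sf_label : R -> sf_index;
  sf_val : sf_index -> Omega -> R;
  sf_measurable : forall i, measurable (sf_label @^-1` [set i]);
  sf_Lfun : forall i, sf_val i \in Lfun P gamma%:E }.

Definition sf_eval (S : simple_fun) (s : R) : Omega -> R :=
  @sf_val S (@sf_label S s).

(* [fine] is harmless: this is only used on sets D of finite measure. *)
Definition sf_integral D (S : simple_fun) : Omega -> R :=
  \sum_(i : sf_index S)
    fine (lebesgue_measure (D `&` (@sf_label S @^-1` [set i]))) *: @sf_val S i.

Definition is_bochner_integral D (f : R -> Omega -> R) (I : Omega -> R) :=
  I \in Lfun P gamma%:E /\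
  exists S : nat -> simple_fun,
    [/\ {ae @lebesgue_measure R, forall s, D s ->
          Lgnorm (f s \- sf_eval (S n) s) @[n --> \oo] --> 0%E},
        (\int[@lebesgue_measure R]_(s in D) Lgnorm (f s \- sf_eval (S n) s))%E
          @[n --> \oo] --> 0%E &
        Lgnorm (I \- sf_integral D (S n)) @[n --> \oo] --> 0%E].

(* A representative of the Bochner integral (arbitrary if there is none). *)
Definition bochner_integral D (f : R -> Omega -> R) : Omega -> R :=
  get (is_bochner_integral D f).

(* f' is the derivative on D of f in L^gamma, one-sided at the end points
   of D when D is an interval. *)
Definition is_derivative_on D (f f' : R -> Omega -> R) :=
  forall x, D x ->
    f' x \in Lfun P gamma%:E /\
    Lgnorm ((s - x)^-1 *: (f s \- f x) \- f' x) @[s --> within D x^'] --> 0%E.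

Definition holder_seminorm (beta T : R) (g : R -> Omega -> R) : \bar R :=
  ereal_sup [set (Lgnorm (g p.1 \- g p.2) * ((`|p.1 - p.2| `^ beta)^-1)%:E)%E
            | p in [set p : R * R |
                     [/\ 0 <= p.1 <= T, 0 <= p.2 <= T & p.1 != p.2]]].

(* h belongs to C^(1+beta)([0,T]; L^gamma) and h' is its derivative; the
   finite seminorm makes h' continuous. *)
Definition C1_holder (beta T : R) (h h' : R -> Omega -> R) :=
  [/\ forall t, 0 <= t <= T -> h t \in Lfun P gamma%:E,
      is_derivative_on `[0, T] h h' &
      (holder_seminorm beta T h' < +oo)%E].

Definition strip (T : R) : set (R * R) := `[0, T] `*` `[0, +oo[.

Definition parabolic_holder_norm (alpha T : R) phi : \bar R :=
  (ereal_sup [set Lgnorm (phi p.1 p.2) | p in strip T] +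
   ereal_sup [set Lgnorm (phi q.1.1 q.1.2 \- phi q.2.1 q.2.2) *
                  ((`|q.1.2 - q.2.2| `^ alpha +
                    `|q.1.1 - q.2.1| `^ (alpha / 2))^-1)%:E
             | q in [set q : (R * R) * (R * R) |
                      [/\ strip T q.1, strip T q.2 & q.1 != q.2]]])%E.

(* At s = 0 the value is 0, because x / 0 = 0; this is the limit as s -> 0+
   when y > 0. *)
Definition poisson_kernel (s y : R) : R :=
  y / (2 * Num.sqrt pi * s `^ (3 / 2)) * expR (- (y ^+ 2 / (4 * s))).

(* Only meant for t >= 0 and y >= 0. *)
Definition half_line_solution (h : R -> Omega -> R) (t y : R) : Omega -> R :=
  if y == 0 then h t
  else bochner_integral `[0, t] (fun s => poisson_kernel s y *: h (t - s)).

Definition is_dt (T : R) (v w : R -> R -> Omega -> R) :=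
  forall y, 0 <= y -> is_derivative_on `[0, T] (v ^~ y) (w ^~ y).

Definition is_dy (T : R) (v w : R -> R -> Omega -> R) :=
  forall t, 0 <= t <= T -> is_derivative_on `[0, +oo[ (v t) (w t).

Definition is_dyy (T : R) (v w : R -> R -> Omega -> R) :=
  exists2 u, is_dy T v u & is_dy T u w.

End Lgamma_valued.

(* Main.v *)
Require Import Defs.
From HB Require Import structures.
From mathcomp Require Import all_boot all_order all_algebra.
From mathcomp Require Import all_classical all_reals all_analysis.
From mathcomp Require Import measurable_realfun.
From mathcomp Require Import ring lra.

(** The proof tests everything against the unit ball of the dual exponent
    q = gamma / (gamma - 1).  For Z in that ball and X in L^gamma write
    [pairing P X Z] for the expectation of X Z.  The converse of Hölder's
    inequality ([Lgnorm_le_dual]) bounds the norm of X by the supremum of its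
    pairings, with constant 1, so that an estimate valid for every scalar
    problem, with a constant independent of the datum, is an estimate in
    L^gamma.  Completeness of L^gamma takes the form [exists_weak_limit]: a
    functional on the ball that is a uniform limit of pairings is itself a
    pairing.  It provides the Bochner integral of the Poisson formula
    ([bochner_integralP]), and later the derivatives of the solution, as limits
    of difference quotients.

    For fixed Z the datum becomes a scalar function phi with derivative psi, and
    since h(0) and h'(0) vanish both extend by zero to negative times, phi
    keeping its Taylor estimate and psi its Hölder estimate of exponent
    b = alpha / 2, with the constant N = [h'].  The solution is then
    V(t, y) = int_0^T P(s, y) phi(t - s) ds, over an interval that does not depend
    on t.  The Poisson kernel P is the s-derivative of Q(s, y) = erfc(y / (2 sqrt s)),
    and integrating by parts V = int Q(s, y) psi(t - s) ds.  With G = - dQ/dy one has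
    dG/dy = - P, whence
    dV/dy = U = - int G(s, y) psi(t - s) ds  and
    d^2V/dy^2 = dV/dt = W = int P(s, y) psi(t - s) ds.

    The kernel P is nonnegative with mass at most 1, so W inherits the size of
    psi and its Hölder modulus in time, and W depends on psi contractively in the
    supremum norm, which is the second assertion.  In space one subtracts psi(t):
    the increments of P over a distance delta are at most
    min(1 / s, delta s^(-3/2)), and against |psi(t - s) - psi(t)| <= N s^b the integral
    splits at s = delta^2 into two powers, each contributing a multiple of
    delta^(2b) = delta^alpha ([increment_bound]).  The same computation bounds the
    Taylor remainder of U, and a cruder one that of V, so the L^gamma-valued
    derivatives exist, and the time derivative and the second space derivative
    are one and the same process W. *)

Set Implicit Arguments.
Unset Strict Implicit.
Unset Printing Implicit Defensive.

Import Order.TTheory GRing.Theory Num.Theory.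
Import numFieldTopology.Exports numFieldNormedType.Exports.

Local Open Scope classical_set_scope.
Local Open Scope ring_scope.

(** * The space L^gamma and its dual ball *)

Section Lgamma_duality.
Context {d : measure_display} {Omega : measurableType d} {R : realType}.
Variables (P : probability Omega R) (gamma : R).
Hypothesis gamma2 : 2 <= gamma.

Local Notation N := (Lgnorm P gamma).
Local Notation Lg := (Lfun P gamma%:E).
Local Notation q := (gamma / (gamma - 1)).

Let gamma0 : 0 < gamma. Proof. by apply: lt_le_trans gamma2. Qed.
Let gamma_ge1 : 1 <= gamma. Proof. by apply: le_trans gamma2; rewrite ler1n. Qed.
Let gamma1 : 0 < gamma - 1.
Proof. by rewrite subr_gt0; apply: lt_le_trans gamma2; rewrite ltr1n. Qed.

Lemma Lfun_measurable (f : Omega -> R) : f \in Lg -> measurable_fun setT f.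
Proof. by rewrite inE => /andP[]; rewrite inE. Qed.

Lemma Lfun_Lgnorm_lty (f : Omega -> R) : f \in Lg -> (N f < +oo)%E.
Proof. by rewrite inE => /andP[_]; rewrite inE. Qed.

Lemma mem_Lfun (f : Omega -> R) :
  measurable_fun setT f -> (N f < +oo)%E -> f \in Lg.
Proof. by move=> mf Nf; rewrite inE; apply/andP; split; rewrite inE. Qed.

Lemma LfunD (f g : Omega -> R) : f \in Lg -> g \in Lg -> f \+ g \in Lg.
Proof.
move=> fL gL; have [_ /(_ 1 f g fL gL)] := @Lfun_submod_closed _ _ _ P gamma%:E gamma_ge1.
by rewrite scale1r.
Qed.

Lemma LfunZ (a : R) (f : Omega -> R) : f \in Lg -> a *: f \in Lg.
Proof.
move=> fL; have [L0 /(_ a f 0 fL L0)] := @Lfun_submod_closed _ _ _ P gamma%:E gamma_ge1.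
by rewrite addr0.
Qed.

Lemma LfunB (f g : Omega -> R) : f \in Lg -> g \in Lg -> f \- g \in Lg.
Proof.
move=> fL gL; have [_ /(_ (-1) g f gL fL)] := @Lfun_submod_closed _ _ _ P gamma%:E gamma_ge1.
by rewrite scaleN1r addrC.
Qed.

Lemma Lfun_sum (I : finType) (f : I -> Omega -> R) :
  (forall i, f i \in Lg) -> \sum_i f i \in Lg.
Proof.
move=> fL; apply: (big_ind (fun x => x \in Lg)) => //; last by move=> x y; exact: LfunD.
by have [] := @Lfun_submod_closed _ _ _ P gamma%:E gamma_ge1.
Qed.

Lemma Lgnorm_ge0 (f : Omega -> R) : (0 <= N f)%E.
Proof. by rewrite /Lgnorm; exact: Lnorm_ge0. Qed.

Definition dual_ball (Z : Omega -> R) :=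
  measurable_fun setT Z /\ ('N[P]_(q%:E)[EFin \o Z] <= 1)%E.

Definition pairing (X Z : Omega -> R) : R := \int[P]_w (X w * Z w).

Let q0 : 0 < q. Proof. by rewrite divr_gt0. Qed.
Let conj : gamma^-1 + q^-1 = 1.
Proof. by rewrite invf_div; field; rewrite !gt_eqF. Qed.

Lemma hoelder_ball X Z : X \in Lg -> dual_ball Z ->
  (\int[P]_w (`|X w * Z w|)%:E <= N X)%E.
Proof.
move=> XL [mZ Z1].
have mX := Lfun_measurable XL.
have := @hoelder _ _ _ P X Z gamma q mX mZ gamma0 q0 conj.
rewrite Lnorm1/= => H; apply: (le_trans H).
by rewrite -[leRHS]mule1; apply: lee_wpmul2l => //; exact: Lgnorm_ge0.
Qed.

Lemma pairing_integrable X Z : X \in Lg -> dual_ball Z ->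
  P.-integrable setT (EFin \o (fun w => X w * Z w)).
Proof.
move=> XL ZB; have [mZ _] := ZB; apply/integrableP; split.
  by apply/measurable_EFinP; apply: measurable_funM => //; exact: Lfun_measurable.
by apply: le_lt_trans (hoelder_ball XL ZB) _; exact: Lfun_Lgnorm_lty.
Qed.

Lemma pairing_le X Z (M : R) : X \in Lg -> dual_ball Z -> (N X <= M%:E)%E ->
  `|pairing X Z| <= M.
Proof.
move=> XL ZB XM; rewrite -lee_fin; apply: le_trans XM.
apply: le_trans (hoelder_ball XL ZB).
have XZ := pairing_integrable XL ZB.
rewrite /pairing EFin_normr_Rintegral//; apply: le_trans (le_abse_integral _ _ _) _ => //.
by case/integrableP : XZ.
Qed.

Lemma pairingB X Y Z : X \in Lg -> Y \in Lg -> dual_ball Z ->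
  pairing (X \- Y) Z = pairing X Z - pairing Y Z.
Proof.
move=> XL YL ZB; rewrite /pairing -RintegralB//; last 2 first.
- exact: pairing_integrable.
- exact: pairing_integrable.
by congr fine; apply: eq_integral => w _; rewrite mulrBl.
Qed.

Lemma pairingD X Y Z : X \in Lg -> Y \in Lg -> dual_ball Z ->
  pairing (X \+ Y) Z = pairing X Z + pairing Y Z.
Proof.
move=> XL YL ZB; rewrite /pairing -RintegralD//; last 2 first.
- exact: pairing_integrable.
- exact: pairing_integrable.
by congr fine; apply: eq_integral => w _; rewrite mulrDl.
Qed.

Lemma pairingZ a X Z : X \in Lg -> dual_ball Z ->
  pairing (a *: X) Z = a * pairing X Z.
Proof.
move=> XL ZB; rewrite /pairing -RintegralZl//; last exact: pairing_integrable.
by congr fine; apply: eq_integral => w _; rewrite mulrA.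
Qed.

Lemma pairing_sum (I : finType) (X : I -> Omega -> R) Z :
  (forall i, X i \in Lg) -> dual_ball Z ->
  pairing (\sum_i X i) Z = \sum_i pairing (X i) Z.
Proof.
move=> XL ZB.
suff [] : \sum_i X i \in Lg /\ pairing (\sum_i X i) Z = \sum_i pairing (X i) Z by [].
apply: (big_ind2 (fun x y => x \in Lg /\ pairing x Z = y)).
- have [L0 _] := @Lfun_submod_closed _ _ _ P gamma%:E gamma_ge1; split => //.
  rewrite /pairing (_ : 0 = \int[P]_(w in setT) 0); last first.
    by rewrite Rintegral_cst// mul0r.
  by congr fine; apply: eq_integral => w _ /=; rewrite mul0r.
- move=> x _ y _ [xL <-] [yL <-]; split; first exact: LfunD.
  exact: pairingD.
- by move=> i _.
Qed.

(** The norm of X is attained at Z proportional to X |X|^(gamma - 2): then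
    |Z|^q is proportional to |X|^gamma. *)
Lemma Lgnorm_le_dual X (M : R) : X \in Lg ->
  (forall Z, dual_ball Z -> `|pairing X Z| <= M) -> (N X <= M%:E)%E.
Proof.
move=> XL XM.
have mX := Lfun_measurable XL.
pose a w := `|X w| `^ gamma.
have ia : P.-integrable setT (EFin \o a) by exact: Lfun_integrable XL.
pose A := \int[P]_w a w.
have AE : (\int[P]_w (a w)%:E)%E = A%:E.
  by rewrite /A /Rintegral fineK//; exact: integrable_fin_num.
have A_ge0 : 0 <= A by apply: Rintegral_ge0 => w _; exact: powR_ge0.
have NX : N X = (A `^ gamma^-1)%:E.
  rewrite /Lgnorm unlock /= -poweR_EFin -AE; congr (_ `^ _)%E.
have [A0|A0] := eqVneq A 0.
  have zb : dual_ball (cst 0).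
    split => //; rewrite (_ : 'N[P]__[_] = 0)%E// ?lee01//.
    by rewrite -[RHS](@Lnorm0 _ _ _ P q%:E)// eqe gt_eqF.
  rewrite NX A0 powR0 ?invr_eq0 ?gt_eqF// lee_fin.
  exact: le_trans (XM _ zb).
have Agt0 : 0 < A by rewrite lt_def A0.
(* This factor gives Z norm 1 in L^q. *)
pose c := A `^ (- q^-1).
pose Z w := c * (X w * `|X w| `^ (gamma - 2)).
have cgt0 : 0 < c by rewrite powR_gt0.
have mabs : measurable_fun setT (fun w => `|X w|) by exact: measurableT_comp.
have mZ : measurable_fun setT Z.
  apply: measurable_funM => //; apply: measurable_funM => //.
  exact: (measurableT_comp (measurable_powR _)).
have XX w : `|X w| * `|X w| `^ (gamma - 2) = `|X w| `^ (gamma - 1).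
  have [->|X0] := eqVneq (X w) 0.
    by rewrite normr0 mul0r powR0// gt_eqF.
  rewrite -{1}(powRr1 (normr_ge0 (X w))) -powRD; last by rewrite normr_eq0 X0 implybT.
  by congr (_ `^ _); ring.
have ZE w : `|Z w| `^ q = A^-1 * a w.
  rewrite /Z normrM (gtr0_norm cgt0) normrM (ger0_norm (powR_ge0 _ _)) XX.
  rewrite powRM ?powR_ge0// -powRrM mulrCA divff ?gt_eqF// mulr1; congr (_ * _).
  by rewrite /c -powRrM mulNr mulVf ?gt_eqF// powR_inv1.
have ZB : dual_ball Z.
  split=> //; rewrite unlock /=.
  have -> : (\int[P]_x `|(Z x)%:E| `^ q = \int[P]_x (A^-1%:E * (a x)%:E))%E.
    by apply: eq_integral => w _; rewrite abse_EFin poweR_EFin ZE EFinM.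
  rewrite integralZl// AE -EFinM mulVf ?gt_eqF//.
  by rewrite poweR_EFin powR1.
rewrite NX lee_fin; apply: le_trans (XM _ ZB).
have -> : pairing X Z = A `^ gamma^-1; last by rewrite ger0_norm ?powR_ge0.
have -> : pairing X Z = c * A.
  rewrite /A -RintegralZl//; congr fine; apply: eq_integral => w _; congr EFin.
  rewrite /Z mulrCA; congr (_ * _).
  rewrite mulrA -expr2 -real_normK ?num_real// expr2 -mulrA XX /a.
  have [->|X0] := eqVneq (X w) 0; first by rewrite normr0 mul0r powR0// gt_eqF.
  rewrite -{1}(powRr1 (normr_ge0 (X w))) -powRD; last by rewrite normr_eq0 X0 implybT.
  by congr (_ `^ _); ring.
rewrite /c -{2}(powRr1 A_ge0) -powRD; last by rewrite A0 implybT.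
by congr (_ `^ _); rewrite addrC; apply/eqP; rewrite subr_eq conj.
Qed.

End Lgamma_duality.

(** * Weak limits in L^gamma *)

Section completeness.
Context {d : measure_display} {Omega : measurableType d} {R : realType}.
Variables (P : probability Omega R).

Lemma cvg_powR (u : nat -> R) (l p : R) : 1 <= p -> (forall n, 0 <= u n) ->
  u @ \oo --> l -> (fun n => u n `^ p) @ \oo --> l `^ p.
Proof.
move=> p1 u0 ul.
have p0 : 0 < p by apply: lt_le_trans p1.
have l0 : 0 <= l.
  by rewrite -(cvg_lim _ ul)//; apply: limr_ge; [exact: cvgP ul|exact: nearW].
have [lE0|lN0] := eqVneq l 0; last first.
  have lgt0 : 0 < l by rewrite lt_def lN0.
  apply: (@continuous_cvg _ _ _ _ _ _ (fun r => r `^ p)) => //.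
  apply/differentiable_continuous/derivable1_diffP.
  by have [] := is_derive1_powR p lgt0.
rewrite lE0 powR0 ?gt_eqF//.
rewrite lE0 in ul.
apply: (@squeeze_cvgr _ _ _ _ (cst 0) u) => //; last exact: cvg_cst.
have u1 : \forall n \near \oo, u n <= 1 by apply: (cvgr_le 0).
apply: filterS u1 => n un1; rewrite powR_ge0/=.
have [->|un0] := eqVneq (u n) 0; first by rewrite powR0 ?gt_eqF.
by apply: ge1r_powR => //; rewrite un1 andbT lt_def un0 u0.
Qed.

(** The sum of the increments has finite expectation, so it is finite
    almost everywhere. *)
Lemma fast_cauchy_ae_cvg (X : nat -> Omega -> R) (C : R) :
  (forall n, measurable_fun setT (X n)) ->
  (forall n, (\int[P]_w (`|X n.+1 w - X n w|)%:E <= (C * 2^-1 ^+ n)%:E)%E) ->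
  {ae P, forall w, cvgn (X ^~ w)}.
Proof.
move=> mX XC.
have mY n : measurable_fun setT (fun w => (`|X n.+1 w - X n w|)%:E).
  by apply/measurable_EFinP; apply: measurableT_comp => //; exact: measurable_funB.
pose S w := (\sum_(0 <= n <oo) (`|X n.+1 w - X n w|)%:E)%E.
have S0 w : (0 <= S w)%E by apply: nneseries_ge0 => n _ _; rewrite lee_fin.
have iS : P.-integrable setT S.
  apply/integrableP; split; first by apply: ge0_emeasurable_sum => // n w _ _; rewrite lee_fin.
  under eq_integral do rewrite gee0_abs//.
  rewrite integral_nneseries//.
  apply: (@le_lt_trans _ _ (C * 2)%:E); last exact: ltry.
  apply: lime_le; first by apply: is_cvg_nneseries => n _ _; exact: integral_ge0.
  apply: nearW => n; apply: (@le_trans _ _ (\sum_(0 <= i < n) (C * 2^-1 ^+ i)%:E)%E).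
    exact: lee_sum.
  have C0 : 0 <= C.
    by have := XC 0%N; rewrite expr0 mulr1 -lee_fin; apply: le_trans; exact: integral_ge0.
  rewrite sumEFin lee_fin -mulr_sumr ler_wpM2l//.
  suff -> : \sum_(0 <= i < n) 2^-1 ^+ i = 2 - 2 * 2^-1 ^+ n :> R.
    by rewrite lerBlDr lerDl mulr_ge0// exprn_ge0// invr_ge0.
  elim: n => [|n IH]; first by rewrite big_geq// expr0; ring.
  by rewrite big_nat_recr//= IH exprS; field.
have := integrable_ae measurableT iS; apply: filterS => w /(_ I) Sfin.
have : cvgn [normed series (telescope (X ^~ w))].
  apply: nondecreasing_is_cvgn.
    by apply: nondecreasing_series => n _ _; exact: normr_ge0.
  exists (fine (S w)) => _ [n _ <-].
  rewrite -lee_fin fineK// /series/= -sumEFin.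
  exact: (@nneseries_lim_ge _ (fun n => (`|X n.+1 w - X n w|)%:E) xpredT).
move/normed_cvg; rewrite telescopeK => cX.
have -> : X ^~ w = (fun n => (X n w - X 0%N w) + X 0%N w).
  by apply/funext => n; rewrite subrK.
by apply: is_cvgD => //; exact: is_cvg_cst.
Qed.

Variables (gamma : R).
Hypothesis gamma2 : 2 <= gamma.
Local Notation N := (Lgnorm P gamma).
Local Notation Lg := (Lfun P gamma%:E).
Local Notation ball := (dual_ball P gamma).

Let gamma0 : 0 < gamma. Proof. by apply: lt_le_trans gamma2. Qed.
Let gamma_ge1 : 1 <= gamma. Proof. by apply: le_trans gamma2; rewrite ler1n. Qed.
Lemma Lgnorm_powR (f : Omega -> R) : (N f `^ gamma = \int[P]_w (`|f w| `^ gamma)%:E)%E.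
Proof. by rewrite /Lgnorm poweR_Lnorm ?gt_eqF. Qed.

Lemma Lgnorm_leP (f : Omega -> R) (c : R) : 0 <= c ->
  (N f <= c%:E)%E <-> (\int[P]_w (`|f w| `^ gamma)%:E <= (c `^ gamma)%:E)%E.
Proof.
move=> c0; rewrite -Lgnorm_powR -poweR_EFin; split => H.
  apply: gt0_ler_poweR => //; rewrite ?(ltW gamma0)// in_itv/= leey andbT ?lee_fin//.
  exact: Lgnorm_ge0.
have K (x : \bar R) : (0 <= x)%E -> ((x `^ gamma) `^ gamma^-1 = x)%E.
  by move=> x0; rewrite -poweRrM divff ?gt_eqF// poweRe1.
rewrite -(K _ (Lgnorm_ge0 _ _ _)) -(K c%:E)//.
apply: gt0_ler_poweR => //; rewrite ?invr_ge0 ?(ltW gamma0)// in_itv/= leey andbT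
  ?lee_fin ?powR_ge0 ?poweR_ge0//.
Qed.

Lemma ball_cst1 : ball (cst 1).
Proof.
split => //; rewrite (_ : EFin \o cst 1 = cst 1%E)// Lnorm_cst1.
by rewrite [X in (X `^ _)%E](_ : _ = 1%E) ?poweR1r//; exact: probability_setT.
Qed.

Lemma expectation_le_Lgnorm (f : Omega -> R) (c : R) : f \in Lg -> (N f <= c%:E)%E ->
  (\int[P]_w (`|f w|)%:E <= c%:E)%E.
Proof.
move=> fL; apply: le_trans; apply: le_trans (hoelder_ball gamma2 fL ball_cst1).
by under [leRHS]eq_integral do rewrite mulr1.
Qed.

Lemma limn_einf_le (u : nat -> \bar R) (c : \bar R) :
  (forall n, (u n <= c)%E) -> (limn_einf u <= c)%E.
Proof.
move=> uc; rewrite limn_einf_lim; apply: lime_le; first exact: is_cvg_einfs.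
apply: nearW => n; apply: le_trans (uc n).
by apply: ereal_inf_lbound; exists n => //=.
Qed.

Lemma measurable_limn_einf (f : nat -> Omega -> \bar R) :
  (forall n, measurable_fun setT (f n)) ->
  measurable_fun setT (fun w => limn_einf (f ^~ w)).
Proof.
move=> mf; apply: (@emeasurable_fun_cvg _ _ _ _ (fun n w => einfs (f ^~ w) n)).
  by move=> n; exact: measurable_fun_einfs.
by move=> w _; rewrite limn_einf_lim; exact: is_cvg_einfs.
Qed.

(** Approximations of l at the rate 2^-n form a Cauchy sequence in norm, by
    the converse of Hölder's inequality; being fast, it converges almost
    everywhere, and Fatou's lemma turns its limit into a limit in L^gamma.  The
    approximations need not come as a sequence, which suits difference
    quotients. *)
Lemma exists_weak_limit (l : (Omega -> R) -> R) :
  (forall e : R, 0 < e -> exists2 X, X \in Lg &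
    forall Z, ball Z -> `|pairing P X Z - l Z| <= e) ->
  exists2 X, X \in Lg & forall Z, ball Z -> pairing P X Z = l Z.
Proof.
move=> H; pose e n : R := 2^-1 ^+ n.
have e0 n : 0 < e n by rewrite exprn_gt0// invr_gt0.
have eD n m : e (m + n)%N <= e n.
  by rewrite /e exprD ler_piMl ?exprn_ge0 ?invr_ge0// exprn_ile1 ?invr_ge0// invf_le1// ler1n.
have /choice[X XP] : forall n, exists X, X \in Lg /\
    forall Z, ball Z -> `|pairing P X Z - l Z| <= e n.
  by move=> n; have [X ? ?] := H _ (e0 n); exists X.
have XL n : X n \in Lg := (XP n).1.
have mX n : measurable_fun setT (X n) by exact: Lfun_measurable (XL n).
have XX n m : (N (X (m + n)%N \- X n)%R <= (2 * e n)%:E)%E.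
  apply: Lgnorm_le_dual => //; first exact: LfunB.
  move=> Z ZB; rewrite (pairingB gamma2)//.
  rewrite (_ : _ - _ = (pairing P (X (m + n)%N) Z - l Z) - (pairing P (X n) Z - l Z)); last by ring.
  apply: le_trans (ler_normB _ _) _; rewrite mulr_natl mulr2n lerD//.
    by apply: le_trans (eD n m); exact: (XP _).2.
  exact: (XP _).2.
have aeX : {ae P, forall w, cvgn (X ^~ w)}.
  apply: (@fast_cauchy_ae_cvg X 2) => // n.
  by apply: expectation_le_Lgnorm; [exact: LfunB|exact: (XX n 1%N)].
(* The upper limit is measurable, and is the limit wherever it exists. *)
pose Y w := fine (limn_esup (fun n => (X n w)%:E)).
have YE w : cvgn (X ^~ w) -> X ^~ w @ \oo --> Y w.
  move=> /cvg_ex[x xX].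
  rewrite /Y (_ : limn_esup _ = x%:E)//.
  have : (EFin \o X ^~ w) @ \oo --> x%:E by apply: cvg_EFin => //; exact: nearW.
  by move/cvg_limn_einf_sup => [_].
have mY : measurable_fun setT Y.
  apply: measurableT_comp; first exact: fine_measurable.
  by apply: measurable_fun_limn_esup => n; apply/measurable_EFinP.
have NY n : (N (Y \- X n)%R <= (2 * e n)%:E)%E.
  have e2 : 0 <= 2 * e n by rewrite mulr_ge0// ltW.
  apply/Lgnorm_leP => //.
  pose f m w := (`|X (m + n)%N w - X n w| `^ gamma)%:E.
  have mf m : measurable_fun setT (f m).
    apply/measurable_EFinP; apply: (measurableT_comp (measurable_powR _)).
    by apply: measurableT_comp => //; exact: measurable_funB.
  rewrite (@ae_eq_integral _ _ _ _ _ (fun w => limn_einf (f ^~ w)))//; first last.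
  - apply: filterS aeX => w /YE XY _.
    suff : f ^~ w @ \oo --> (`|Y w - X n w| `^ gamma)%:E by move/cvg_limn_einf_sup => [].
    apply: cvg_EFin; first exact: nearW.
    apply: cvg_powR => //; apply: cvg_norm; apply: cvgB; last exact: cvg_cst.
    by move: XY; rewrite -(cvg_shiftn n).
  - exact: measurable_limn_einf.
  - apply/measurable_EFinP; apply: (measurableT_comp (measurable_powR _)).
    by apply: measurableT_comp => //; exact: measurable_funB.
  apply: le_trans (fatou _ _ _ _) _ => //.
    by move=> m w _; rewrite lee_fin powR_ge0.
  apply: limn_einf_le => m.
  by have /(Lgnorm_leP _ e2) := XX n m.
have YXL n : Y \- X n \in Lg.
  apply: mem_Lfun; first exact: measurable_funB.
  by apply: le_lt_trans (NY n) _; exact: ltry.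
have YL : Y \in Lg.
  rewrite (_ : Y = (Y \- X 0%N) \+ X 0%N); first exact: LfunD.
  by apply/funext => w /=; rewrite subrK.
exists Y => // Z ZB; apply/eqP; rewrite -subr_eq0 -normr_le0.
apply/ler_addgt0Pl => r r0; rewrite addr0.
have [n en] : exists n, 3 * e n <= r.
  have [n _ /(_ n (leqnn n))] := near_infty_natSinv_expn_lt (PosNum (divr_gt0 r0 (@ltr0n R 3))).
  rewrite /= div1r -exprVn => /ltW nr; exists n; rewrite mulrC -ler_pdivlMr//.
apply: le_trans en.
rewrite (_ : _ - _ = pairing P (Y \- X n) Z + (pairing P (X n) Z - l Z)); last first.
  by rewrite (pairingB gamma2)//; ring.
apply: le_trans (ler_normD _ _) _.
rewrite (_ : 3 * e n = 2 * e n + e n); last by ring.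
by apply: lerD; [exact: (pairing_le gamma2)|exact: (XP n).2].
Qed.

Lemma pairing_ae0 (X Z : Omega -> R) : measurable_fun setT X -> measurable_fun setT Z ->
  X = cst 0 %[ae P] -> pairing P X Z = 0.
Proof.
move=> mX mZ X0; rewrite /pairing /Rintegral (@ae_eq_integral _ _ _ _ _ (cst 0%E))//.
- by rewrite integral_cst// mul0e.
- by apply/measurable_EFinP; exact: measurable_funM.
- by apply: filterS X0 => w /(_ I) /= -> _; rewrite mul0r.
Qed.

End completeness.

(** * Bochner integrals through their pairings *)

Section real_lemmas.
Context {R : realType}.

Lemma cvge0_le {I : Type} (F : set_system I) {FF : Filter F} (u : I -> \bar R) (e : R) :
  u @ F --> 0%E -> 0 < e -> \forall x \near F, (u x <= e%:E)%E.
Proof.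
move=> /fine_cvgP[fu cu] e0.
have ue : \forall x \near F, fine (u x) <= e by apply: (cvgr_le 0).
by apply: filterS2 fu ue => x ux uxe; rewrite -(fineK ux) lee_fin.
Qed.

Lemma cvge0_squeeze {I : Type} (F : set_system I) {FF : Filter F} (u : I -> \bar R)
    (v : I -> R) :
  (forall x, (0 <= u x)%E) -> (\forall x \near F, (u x <= (v x)%:E)%E) ->
  v @ F --> (0 : R) -> u @ F --> 0%E.
Proof.
move=> u0 uv v0.
apply: (@squeeze_cvge _ _ _ _ (cst 0%E) _ (EFin \o v)).
- by apply: filterS uv => x uvx; rewrite u0.
- exact: cvg_cst.
- by apply: cvg_EFin => //; exact: nearW.
Qed.

(** The integral of a nonnegative function is the supremum of the integrals
    of the simple functions below it, hence monotone on arbitrary functions.  It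
    is applied to the distance in L^gamma of two functions of s, which is not
    known to be measurable. *)
Lemma ge0_le_lower_integral {d} {T : measurableType d} (mu : {measure set T -> \bar R})
    (D : set T) (f g : T -> \bar R) :
  (forall x, D x -> (0 <= f x)%E) -> (forall x, D x -> (f x <= g x)%E) ->
  (\int[mu]_(x in D) f x <= \int[mu]_(x in D) g x)%E.
Proof.
move=> f0 fg; rewrite integral_mkcond [leRHS]integral_mkcond.
have fg' x : ((f \_ D) x <= (g \_ D) x)%E by rewrite /patch; case: ifPn => // /set_mem /fg.
have f0' x : (0 <= (f \_ D) x)%E by rewrite /patch; case: ifPn => // /set_mem /f0.
rewrite !ge0_integralTE//; last by move=> x; exact: le_trans (fg' x).
by apply: ereal_sup_le => _ [h /= hf <-]; exists h => //= x; exact: le_trans (fg' x).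
Qed.

Lemma within_continuousP (A : set R) (g : R -> R) :
  (forall x, A x -> forall e : R, 0 < e -> exists2 delta : R, 0 < delta &
     forall r, A r -> `|x - r| < delta -> `|g x - g r| <= e) ->
  {within A, continuous g}.
Proof.
move=> H; apply/subspace_continuousP => x Ax; apply/cvgrPdist_le => e e0.
have [delta delta0 Hd] := H x Ax e e0.
suff : \forall r \near x, A r -> `|g x - g r| <= e by [].
by apply: filterS (nbhsx_ballx x delta delta0) => r xr Ar; exact: Hd.
Qed.

End real_lemmas.

Section bochner.
Context {d : measure_display} {Omega : measurableType d} {R : realType}.
Variables (P : probability Omega R) (gamma : R).
Hypothesis gamma2 : 2 <= gamma.
Local Notation N := (Lgnorm P gamma).
Local Notation Lg := (Lfun P gamma%:E).
Local Notation ball := (dual_ball P gamma).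
Local Notation mu := (@lebesgue_measure R).

Lemma simple_Rintegral (D : set R) (S : simple_fun P gamma) (g : sf_index S -> R) :
  measurable D -> (mu D < +oo)%E ->
  mu.-integrable D (EFin \o (fun s => g (sf_label S s))) /\
  \int[mu]_(s in D) g (sf_label S s) =
  \sum_i fine (mu (D `&` sf_label S @^-1` [set i])) * g i.
Proof.
move=> mD Doo; pose A i := sf_label S @^-1` [set i].
have mA i : measurable (A i) by exact: sf_measurable.
have gE : (EFin \o (fun s => g (sf_label S s))) =
    (fun s => (\sum_i (g i)%:E * (\1_(A i) s)%:E)%E).
  apply/funext => s /=; rewrite (bigD1 (sf_label S s))//= big1 ?adde0.
    by rewrite indicE mem_set//= mule1.
  by move=> i si; rewrite indicE memNset ?mule0//= => /esym/eqP; exact/negP.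
have iA i : mu.-integrable D (fun s => (\1_(A i) s)%:E).
  apply/integrableP; split.
    by apply/measurable_EFinP; apply: measurable_indic; exact: mA.
  under eq_integral do rewrite gee0_abs ?lee_fin//.
  rewrite integral_indic; [|exact: mD|exact: mA]; apply: le_lt_trans Doo.
  apply: le_measure; [|rewrite inE//|exact: subIsetr].
  by rewrite inE; exact: (measurableI _ _ (mA i) mD).
have iS : mu.-integrable D (fun s => (\sum_i (g i)%:E * (\1_(A i) s)%:E)%E).
  by apply: integrable_sum => // i _; exact: integrableZl.
split; first by rewrite gE.
rewrite /Rintegral (_ : (fun s => _) = (EFin \o (fun s => g (sf_label S s))))//.
rewrite gE integral_sum//; last by move=> i; exact: integrableZl.
rewrite (eq_bigr (fun i => (fine (mu (D `&` A i)) * g i)%:E)) ?sumEFin//.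
move=> i _.
have fA : mu (D `&` A i) \is a fin_num.
  rewrite ge0_fin_numE//; apply: le_lt_trans Doo.
  apply: le_measure; [|rewrite inE//|exact: subIsetl].
  by rewrite inE; exact: (measurableI _ _ mD (mA i)).
rewrite integralZl// integral_indic; [|exact: mD|exact: mA].
by rewrite EFinM fineK// muleC [in LHS]setIC.
Qed.

Lemma sf_integral_Lfun (D : set R) (S : simple_fun P gamma) : sf_integral D S \in Lg.
Proof.
rewrite /sf_integral; apply: (Lfun_sum gamma2) => i.
by apply: LfunZ => //; exact: sf_Lfun.
Qed.

Lemma pairing_sf_integral (D : set R) (S : simple_fun P gamma) Z : ball Z ->
  measurable D -> (mu D < +oo)%E ->
  pairing P (sf_integral D S) Z = \int[mu]_(s in D) pairing P (sf_eval S s) Z.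
Proof.
move=> ZB mD Doo.
have [_ ->] := @simple_Rintegral D S (fun i => pairing P (sf_val i) Z) mD Doo.
have XL i : fine (mu (D `&` sf_label S @^-1` [set i])) *: sf_val i \in Lg.
  by apply: LfunZ => //; exact: sf_Lfun.
apply: etrans (pairing_sum gamma2 XL ZB) _.
by apply: eq_bigr => i _; rewrite (pairingZ gamma2)//; exact: sf_Lfun.
Qed.

(** Hölder's inequality under the integral sign. *)
Lemma pairing_sf_integral_diff (D : set R) (S : simple_fun P gamma) (f : R -> Omega -> R) Z :
  ball Z -> measurable D -> (mu D < +oo)%E -> (forall s, D s -> f s \in Lg) ->
  mu.-integrable D (EFin \o (fun s => pairing P (f s) Z)) ->
  (`|pairing P (sf_integral D S) Z - \int[mu]_(s in D) pairing P (f s) Z|%:E <=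
  \int[mu]_(s in D) N (f s \- sf_eval S s)%R)%E.
Proof.
move=> ZB mD Doo fL fi.
have [iS _] := @simple_Rintegral D S (fun i => pairing P (sf_val i) Z) mD Doo.
rewrite pairing_sf_integral// -RintegralB//.
have iB : mu.-integrable D (EFin \o (fun s => pairing P (sf_eval S s) Z - pairing P (f s) Z)).
  rewrite (_ : EFin \o _ = (fun s => (pairing P (sf_eval S s) Z)%:E - (pairing P (f s) Z)%:E)%E)//.
  exact: integrableB.
rewrite EFin_normr_Rintegral//; apply: le_trans (le_abse_integral _ _ _) _ => //.
  by case/integrableP : iB.
apply: ge0_le_lower_integral => // s Ds.
have SL : sf_eval S s \in Lg by exact: sf_Lfun.
have fSL : f s \- sf_eval S s \in Lg by apply: LfunB => //; exact: fL.
rewrite -(pairingB gamma2)// ?fL//.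
have Nfin : N (f s \- sf_eval S s)%R \is a fin_num.
  by rewrite ge0_fin_numE ?Lgnorm_ge0// Lfun_Lgnorm_lty.
rewrite -(fineK Nfin) abse_EFin lee_fin (pairingB gamma2) ?fL// distrC -(pairingB gamma2) ?fL//.
by apply: (pairing_le gamma2) => //; rewrite fineK.
Qed.

(** Pairings are continuous, so the identity passes to the limit from simple
    functions.  It determines every Bochner integral of f up to null sets,
    and so makes the choice of a representative harmless. *)
Lemma bochner_pairing (D : set R) (f : R -> Omega -> R) I Z :
  ball Z -> measurable D -> (mu D < +oo)%E -> (forall s, D s -> f s \in Lg) ->
  mu.-integrable D (EFin \o (fun s => pairing P (f s) Z)) ->
  is_bochner_integral P gamma D f I ->
  pairing P I Z = \int[mu]_(s in D) pairing P (f s) Z.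
Proof.
move=> ZB mD Doo fL fi [IL [S [_ S1 S2]]].
apply/eqP; rewrite -subr_eq0 -normr_le0; apply/ler_addgt0Pl => e e0; rewrite addr0.
have e2 : 0 < e / 2 by rewrite divr_gt0.
have [n [n1 n2]] : exists n, (\int[mu]_(s in D) N (f s \- sf_eval (S n) s)%R <= (e / 2)%:E)%E /\
    (N (I \- sf_integral D (S n))%R <= (e / 2)%:E)%E.
  have h1 := cvge0_le S1 e2; have h2 := cvge0_le S2 e2.
  by have [n _ /(_ n (leqnn n))] := filterI (h1 _) (h2 _); exists n.
rewrite (_ : _ - _ = pairing P (I \- sf_integral D (S n)) Z +
  (pairing P (sf_integral D (S n)) Z - \int[mu]_(s in D) pairing P (f s) Z)); last first.
  by rewrite (pairingB gamma2)//; [ring|exact: sf_integral_Lfun].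
apply: le_trans (ler_normD _ _) _; rewrite [leRHS]splitr lerD//.
  by apply: (pairing_le gamma2) => //; apply: LfunB => //; exact: sf_integral_Lfun.
by rewrite -lee_fin; apply: le_trans n1; exact: pairing_sf_integral_diff.
Qed.

Section grid.
Variables (K n : nat).

(* The label of s records which points k / (n + 1) lie below s, for k < K;
   it separates points of [0, (K - 1) / (n + 1)[ at distance more than 1 / (n + 1). *)
Let label (s : R) : {ffun 'I_K -> bool} := [ffun k : 'I_K => (k%:R / n.+1%:R <= s)].

Lemma grid_label_measurable i : measurable (label @^-1` [set i]).
Proof.
rewrite (_ : _ @^-1` _ = \bigcap_(k in [set: 'I_K]) [set s : R | (k%:R / n.+1%:R <= s) = i k]).
  apply: fin_bigcap_measurable => // k _; case: (i k).
    rewrite (_ : mkset _ = [set` `[k%:R / n.+1%:R, +oo[])//.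
    by apply/seteqP; split => s /=; rewrite in_itv/= andbT.
  rewrite (_ : mkset _ = [set` `]-oo, k%:R / n.+1%:R[])//.
  by apply/seteqP; split => s /=; rewrite in_itv/= ltNge; [move=> ->|move/negbTE].
apply/seteqP; split => s /=.
  by move=> <- k _; rewrite ffunE.
by move=> H; apply/ffunP => k; rewrite ffunE; exact: H.
Qed.

Lemma grid_label_close s r : 0 <= s -> s < r -> r * n.+1%:R + 1 < K%:R ->
  label s = label r -> r - s <= n.+1%:R^-1.
Proof.
move=> s0 sr rK E; rewrite leNgt; apply/negP => rs.
have n0 : 0 < n.+1%:R :> R by rewrite ltr0n.
(* The first grid point above s, which lies below r if r - s > 1 / (n + 1). *)
pose k := (Num.truncn (s * n.+1%:R)).+1.
have /andP[k1 k2] : (k.-1%:R <= s * n.+1%:R < k%:R).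
  by rewrite /k; apply: truncn_itv; rewrite mulr_ge0// ltW.
have kr : k%:R / n.+1%:R <= r.
  rewrite ler_pdivrMr//.
  have : k%:R <= s * n.+1%:R + 1 by rewrite -[k]/(k.-1.+1) -natr1 lerD2r.
  move/le_trans; apply.
  have : 1 <= (r - s) * n.+1%:R by rewrite -ler_pdivrMr// div1r ltW.
  by rewrite mulrBl lerBrDl.
have kK : (k < K)%N.
  rewrite -(ltr_nat R); apply: le_lt_trans rK.
  by rewrite ler_pdivrMr// in kr; apply: le_trans kr _; rewrite lerDl.
move/ffunP : E => /(_ (Ordinal kK)); rewrite !ffunE/= kr.
by rewrite ler_pdivrMr// leNgt k2.
Qed.

End grid.

(** The approximation takes on each cell of the grid a value of f in that
    cell. *)
Lemma simple_approximation (t : R) (f : R -> Omega -> R) :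
  (forall s, 0 <= s <= t -> f s \in Lg) ->
  (forall e : R, 0 < e -> exists2 delta : R, 0 < delta &
    forall s r, 0 <= s <= t -> 0 <= r <= t -> `|s - r| < delta -> (N (f s \- f r)%R <= e%:E)%E) ->
  forall e : R, 0 < e -> exists S : simple_fun P gamma,
    forall s, 0 <= s <= t -> (N (f s \- sf_eval S s)%R <= e%:E)%E.
Proof.
move=> fL fu e e0; have [delta delta0 fd] := fu e e0.
have [n nd] : exists n : nat, n.+1%:R^-1 < delta.
  by have [n _ /(_ n (leqnn n))] := near_infty_natSinv_lt (PosNum delta0); exists n.
have [K tK] : exists K : nat, t * n.+1%:R + 1 < K%:R.
  by exists (Num.truncn (t * n.+1%:R + 1)).+1; exact: truncnS_gt.
pose label (s : R) : {ffun 'I_K -> bool} := [ffun k : 'I_K => (k%:R / n.+1%:R <= s)].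
pose Q i s := 0 <= s <= t /\ label s = i.
(* A cell that does not meet [0, t] gets the value 0. *)
pose val i := if pselect (exists s, Q i s) then f (xget 0 (Q i)) else 0.
have valL i : val i \in Lg.
  rewrite /val; case: pselect => [ex|nex].
    by apply: fL; exact: (xgetPex 0 ex).1.
  have gamma_ge1 : 1 <= gamma by apply: le_trans gamma2; rewrite ler1n.
  by have [] := @Lfun_submod_closed _ _ _ P gamma%:E gamma_ge1.
exists (SimpleFun (@grid_label_measurable K n) valL) => s st.
rewrite /sf_eval/= /val; case: pselect => [|]; last by case; exists s.
move=> ex; have [rt rl] := xgetPex 0 ex; apply: fd => //.
have [sr|rs|E] := ltgtP s (xget 0 (Q (label s))); last by rewrite -E subrr normr0.
- rewrite distrC gtr0_norm ?subr_gt0//; apply: le_lt_trans nd.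
  apply: (@grid_label_close K n) => //; first by case/andP : st.
  by apply: le_lt_trans tK; rewrite lerD2r ler_pM2r ?ltr0n//; case/andP : rt.
- rewrite gtr0_norm ?subr_gt0//; apply: le_lt_trans nd.
  apply: (@grid_label_close K n) => //; first by case/andP : rt.
  by apply: le_lt_trans tK; rewrite lerD2r ler_pM2r ?ltr0n//; case/andP : st.
Qed.

(** The integrals of uniform simple approximations converge uniformly on the
    dual ball to the integral of the pairings, so that [exists_weak_limit]
    provides a candidate, and the converse of Hölder's inequality shows that it
    is a Bochner integral. *)
Lemma bochner_integralP (t : R) (f : R -> Omega -> R) : 0 <= t ->
  (forall s, 0 <= s <= t -> f s \in Lg) ->
  (forall e : R, 0 < e -> exists2 delta : R, 0 < delta &
    forall s r, 0 <= s <= t -> 0 <= r <= t -> `|s - r| < delta -> (N (f s \- f r)%R <= e%:E)%E) ->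
  bochner_integral P gamma `[0, t] f \in Lg /\
  forall Z, ball Z -> pairing P (bochner_integral P gamma `[0, t] f) Z =
    \int[mu]_(s in `[0, t]) pairing P (f s) Z.
Proof.
move=> t0 fL fu; pose D : set R := `[0, t]%classic.
have DP s : D s <-> 0 <= s <= t by rewrite /D/= in_itv.
have mD : measurable D by exact: measurable_itv.
have muD : mu D = t%:E.
  by rewrite /D lebesgue_measure_itv/= lte_fin; case: ltgtP t0 => // [t0 _|<-];
    rewrite ?oppr0 ?adde0 ?subr0.
have Doo : (mu D < +oo)%E by rewrite muD ltry.
have fLD s : D s -> f s \in Lg by move/DP; exact: fL.
have fi Z : ball Z -> mu.-integrable D (EFin \o (fun s => pairing P (f s) Z)).
  move=> ZB; apply: continuous_compact_integrable; first exact: segment_compact.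
  apply: within_continuousP => s Ds e e0.
  have [delta delta0 fd] := fu e e0; exists delta => // r Dr sr.
  rewrite -(pairingB gamma2) ?fLD//; apply: (pairing_le gamma2) => //.
    by apply: LfunB => //; exact: fLD.
  by apply: fd => //; apply/DP.
have /choice[S SP] : forall n, exists S : simple_fun P gamma, forall s, 0 <= s <= t ->
    (N (f s \- sf_eval S s)%R <= (2^-1 ^+ n)%:E)%E.
  move=> n; apply: (simple_approximation fL fu).
  by rewrite exprn_gt0// invr_gt0.
have e0 n : 0 <= 2^-1 ^+ n :> R by rewrite exprn_ge0// invr_ge0.
have ecv : (fun n => 2^-1 ^+ n : R) @ \oo --> (0 : R).
  by apply: cvg_expr; rewrite ger0_norm ?invr_ge0// invf_lt1// ltr1n.
have ecvt : (fun n => 2^-1 ^+ n * t : R) @ \oo --> (0 : R).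
  by rewrite -(mul0r t); apply: cvgMl.
have intle n : (\int[mu]_(s in D) N (f s \- sf_eval (S n) s)%R <= (2^-1 ^+ n * t)%:E)%E.
  have -> : ((2^-1 ^+ n * t)%:E = \int[mu]_(s in D) cst (2^-1 ^+ n)%:E s)%E.
    by rewrite integral_cst// [X in (_ * X)%E](_ : _ = t%:E).
  apply: ge0_le_lower_integral => s Ds; first exact: Lgnorm_ge0.
  by apply: SP; exact/DP.
have pairle n Z : ball Z ->
    `|pairing P (sf_integral D (S n)) Z - \int[mu]_(s in D) pairing P (f s) Z| <= 2^-1 ^+ n * t.
  move=> ZB; rewrite -lee_fin; apply: le_trans (intle n).
  by apply: pairing_sf_integral_diff => //; exact: fi.
have [I IL IP] : exists2 X, X \in Lg &
    forall Z, ball Z -> pairing P X Z = \int[mu]_(s in D) pairing P (f s) Z.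
  apply: exists_weak_limit => // e epos.
  have [n ne] : exists n, 2^-1 ^+ n * t <= e.
    have : \forall n \near \oo, 2^-1 ^+ n * t <= e by apply: (cvgr_le 0).
    by move=> [n _ /(_ n (leqnn n))]; exists n.
  exists (sf_integral D (S n)); first exact: sf_integral_Lfun.
  by move=> Z ZB; apply: le_trans ne; exact: pairle.
have bI : exists I, is_bochner_integral P gamma D f I.
  exists I; split => //; exists S; split.
  - apply: aeW => s /DP st; apply: cvge0_squeeze ecv.
      by move=> n; exact: Lgnorm_ge0.
    by apply: nearW => n; exact: SP.
  - apply: cvge0_squeeze ecvt.
      by move=> n; apply: integral_ge0 => s _; exact: Lgnorm_ge0.
    by apply: nearW => n; exact: intle.
  - apply: cvge0_squeeze ecvt.
      by move=> n; exact: Lgnorm_ge0.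
    apply: nearW => n; apply: (Lgnorm_le_dual gamma2).
      by apply: LfunB => //; exact: sf_integral_Lfun.
    move=> Z ZB; rewrite (pairingB gamma2)//; last exact: sf_integral_Lfun.
    by rewrite IP// distrC; exact: pairle.
have bP := getPex bI.
split; first by case: bP.
by move=> Z ZB; apply: bochner_pairing => //; exact: fi.
Qed.

End bochner.

(** * Derivatives, and the complementary error function *)

Section derivation_rules.
Context {R : realType}.
Implicit Types (f g : R -> R) (x a b : R).

Lemma dcst (c x : R) : is_derive x 1 (fun _ => c) 0.
Proof. exact: is_derive_cst. Qed.

Lemma did (x : R) : is_derive x 1 (fun z => z) 1.
Proof. exact: is_derive_id. Qed.

Lemma dD f g x a b : is_derive x 1 f a -> is_derive x 1 g b ->
  is_derive x 1 (fun z => f z + g z) (a + b).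
Proof. by move=> fa gb; exact: is_deriveD. Qed.

Lemma dB f g x a b : is_derive x 1 f a -> is_derive x 1 g b ->
  is_derive x 1 (fun z => f z - g z) (a - b).
Proof. by move=> fa gb; exact: is_deriveB. Qed.

Lemma dM f g x a b : is_derive x 1 f a -> is_derive x 1 g b ->
  is_derive x 1 (fun z => f z * g z) (a * g x + f x * b).
Proof.
move=> fa gb; apply: (is_derive_eq (is_deriveM fa gb)).
by rewrite /GRing.scale/=; ring.
Qed.

Lemma dZ f c x a : is_derive x 1 f a -> is_derive x 1 (fun z => c * f z) (c * a).
Proof. by move=> fa; have := is_deriveZ c fa. Qed.

Lemma dV f x a : f x != 0 -> is_derive x 1 f a ->
  is_derive x 1 (fun z => (f z)^-1) (- a / f x ^+ 2).
Proof.
move=> fx0 fa; apply: (is_derive_eq (is_deriveV fx0 fa)).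
by rewrite /GRing.scale/=; ring.
Qed.

Lemma dcomp f g x a b : is_derive (g x) 1 f a -> is_derive x 1 g b ->
  is_derive x 1 (fun z => f (g z)) (a * b).
Proof. by move=> fa gb; exact: is_derive1_comp. Qed.

Lemma dexp f x a : is_derive x 1 f a ->
  is_derive x 1 (fun z => expR (f z)) (expR (f x) * a).
Proof. by move=> fa; apply: dcomp => //; exact: is_derive_expR. Qed.

Lemma is_derive_continuous f x a : is_derive x 1 f a -> {for x, continuous f}.
Proof. by move=> [fa _]; exact/differentiable_continuous/derivable1_diffP. Qed.

Lemma mean_value (f df : R -> R) (x y : R) :
  (forall z : R, is_derive z 1 f (df z)) ->
  exists2 c, Num.min x y <= c <= Num.max x y & f y - f x = df c * (y - x).
Proof.
move=> fd.
have cf a b : {within `[a, b], continuous f}.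
  by apply: continuous_subspaceT => z; exact: is_derive_continuous (fd z).
have [xy|/ltW yx] := leP x y.
  have [c cxy E] := @MVT_segment R f df x y xy (fun z _ => fd z) (cf x y).
  by exists c => //; move: cxy; rewrite in_itv.
have [c cxy E] := @MVT_segment R f df y x yx (fun z _ => fd z) (cf y x).
exists c; first by move: cxy; rewrite in_itv.
by rewrite -opprB E -mulrN opprB.
Qed.

Lemma between_dist (x y c : R) : Num.min x y <= c <= Num.max x y -> `|c - x| <= `|y - x|.
Proof.
have [xy /andP[xc cy]|yx /andP[yc cx]] := leP x y.
  by rewrite !ger0_norm ?subr_ge0// lerD2r.
by rewrite distrC [leRHS]distrC !ger0_norm ?subr_ge0// ?lerB// ltW.
Qed.

Lemma between_ge0 (x y c : R) : 0 <= x -> 0 <= y ->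
  Num.min x y <= c <= Num.max x y -> 0 <= c.
Proof. by move=> x0 y0 /andP[+ _]; apply: le_trans; rewrite le_min x0. Qed.

End derivation_rules.

Section erfc.
Import gauss_integral_proof.
Context {R : realType}.
Local Notation mu := (@lebesgue_measure R).

Let Phi (x : R) : R := \int[mu]_(t in `]-oo, x]) gauss_fun t.

(** The primitive of the Gaussian is taken from -oo and recentred, rather than
    from 0, so as to be differentiable at every real number. *)
Definition erfc (x : R) : R := 1 - 2 / Num.sqrt pi * (Phi x - Phi 0).

Let gauss_int (A : set R) : measurable A -> mu.-integrable A (EFin \o @gauss_fun R).
Proof. by move=> mA; apply: integrableS (@integrableT_gauss R). Qed.

Lemma erfc0 : erfc 0 = 1. Proof. by rewrite /erfc subrr mulr0 subr0. Qed.

Lemma is_derive_erfc (x : R) : is_derive x 1 erfc (- (2 / Num.sqrt pi * expR (- x ^+ 2))).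
Proof.
have x1 : x < x + 1 by rewrite ltrDl.
have [dPhi Phi'] := @continuous_FTC1 R (@gauss_fun R) -oo%O x (x + 1) x1
  (gauss_int (measurable_itv _)) (ltNyr _) (@continuous_gauss_fun R x).
have {}dPhi : is_derive x 1 Phi (expR (- x ^+ 2)) by rewrite derive1E in Phi'; exact: DeriveDef.
apply: (is_derive_eq (dB (dcst 1 x) (dZ (2 / Num.sqrt pi) (dB dPhi (dcst (Phi 0) x))))).
by ring.
Qed.

Let erfcE x : 0 <= x -> erfc x = 1 - 2 / Num.sqrt pi * integral0_gauss x.
Proof.
move=> x0; rewrite /erfc /Phi Rintegral_itvB//; last exact: gauss_int.
by rewrite Rintegral_itv_obnd_cbnd//; exact: gauss_int.
Qed.

Let sqrtpi_gt0 : 0 < Num.sqrt pi :> R. Proof. by rewrite sqrtr_gt0 pi_gt0. Qed.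

Lemma erfc_le1 x : 0 <= x -> erfc x <= 1.
Proof.
move=> x0; rewrite erfcE// lerBlDr lerDl; apply: mulr_ge0.
  by rewrite divr_ge0// ltW.
exact: integral0_gauss_ge0.
Qed.

Lemma erfc_ge0 x : 0 <= x -> 0 <= erfc x.
Proof.
move=> x0; rewrite erfcE// subr_ge0 mulrC -ler_pdivlMr ?divr_gt0//.
rewrite div1r invf_div /integral0_gauss -lee_fin.
rewrite -gauss_integral.integral0y_gauss /Rintegral fineK; last first.
  by apply: integrable_fin_num => //; exact: gauss_int.
apply: ge0_subset_integral => //.
- by apply/measurable_EFinP; apply: measurable_funTS; exact: measurable_gauss_fun.
- by move=> z _; rewrite lee_fin gauss_fun_ge0.
- by move=> z /=; rewrite !in_itv/= andbT => /andP[].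
Qed.

Lemma cvg_erfc : erfc x @[x --> +oo] --> (0 : R).
Proof.
have cI : integral0_gauss x @[x --> +oo] --> (Num.sqrt pi / 2 : R).
  have : Num.sqrt (integral0_gauss x ^+ 2) @[x --> +oo] --> (Num.sqrt (pi / 4) : R).
    by apply: continuous_cvg; [exact: sqrt_continuous|exact: cvg_integral0_gauss_sqr].
  rewrite sqrtrM ?pi_ge0// sqrtrV// (_ : 4 = 2 ^+ 2) ?sqrtr_sqr ?ger0_norm//; last by ring.
  apply: cvg_trans; apply: near_eq_cvg; near=> x.
  by rewrite sqrtr_sqr ger0_norm// integral0_gauss_ge0.
have -> : 0 = 1 - 2 / Num.sqrt pi * (Num.sqrt pi / 2) :> R.
  by field; rewrite gt_eqF.
have : 1 - 2 / Num.sqrt pi * integral0_gauss x @[x --> +oo] -->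
    (1 - 2 / Num.sqrt pi * (Num.sqrt pi / 2) : R).
  by apply: cvgB; [exact: cvg_cst|apply: cvgM => //; exact: cvg_cst].
apply: cvg_trans; apply: near_eq_cvg; near=> x.
by rewrite erfcE//.
Unshelve. all: by end_near. Qed.

End erfc.

(** * Heat kernels on the half-line *)

Section heat_kernels.
Context {R : realType}.
Implicit Types s y z : R.

Definition heat_exp s y := expR (- (y ^+ 2 / (4 * s))).
(** Twice the Gauss kernel at time s: the heat kernel of the half-line with
    reflection at 0. *)
Definition kerG s y := heat_exp s y / (Num.sqrt pi * Num.sqrt s).
(** The Poisson kernel, with s^(3/2) written as s sqrt(s). *)
Definition kerP s y := y * heat_exp s y / (2 * Num.sqrt pi * (s * Num.sqrt s)).
(** The derivative of [kerP] in y. *)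
Definition kerP' s y :=
  (1 - y ^+ 2 / (2 * s)) * heat_exp s y / (2 * Num.sqrt pi * (s * Num.sqrt s)).
(** The integral of the Poisson kernel over ]0, s]: the solution with boundary
    value 1. *)
Definition kerQ s y := erfc (y / (2 * Num.sqrt s)).
(** The integral of [kerG] over ]0, s]. *)
Definition kerJ s y :=
  2 / Num.sqrt pi * (Num.sqrt s * heat_exp s y) - y * kerQ s y.

Let p : R := Num.sqrt pi.
Let p_gt0 : 0 < p. Proof. by rewrite sqrtr_gt0 pi_gt0. Qed.
Let p_ge1 : 1 <= p.
Proof.
rewrite -[1]sqrtr1 ler_sqrt ?pi_ge0//.
by apply: le_trans (pi_ge2 R); rewrite ler1n.
Qed.

Lemma sqr_sqrt s : 0 < s -> exists2 r, 0 < r & s = r ^+ 2 /\ Num.sqrt s = r.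
Proof.
move=> s0; exists (Num.sqrt s); first by rewrite sqrtr_gt0.
by rewrite sqr_sqrtr// ltW.
Qed.

Lemma poisson_kernelE s y : 0 < s -> poisson_kernel s y = kerP s y.
Proof.
move=> s0; rewrite /poisson_kernel /kerP /heat_exp.
have -> : s `^ (3 / 2) = s * Num.sqrt s.
  rewrite -powR12_sqrt ?ltW// -{2}(powRr1 (ltW s0)) -powRD; last first.
    by rewrite gt_eqF// implybT.
  by congr (_ `^ _); field.
by field; rewrite !gt_eqF// sqrtr_gt0.
Qed.

Lemma is_derive_heat_exp_y s y : is_derive y 1 (heat_exp s) (- (y / (2 * s)) * heat_exp s y).
Proof.
have D := dexp (dZ (- (4 * s)^-1) (dM (did y) (did y))).
have E : heat_exp s = fun z => expR (- (4 * s)^-1 * (z * z)).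
  by apply/funext => z; rewrite /heat_exp; congr expR; rewrite expr2; ring.
rewrite {1}E; apply: (is_derive_eq D); rewrite E.
have [->|s0] := eqVneq s 0; first by rewrite !mulr0 invr0; ring.
by field.
Qed.

Lemma is_derive_kerG_y s y : 0 < s -> is_derive y 1 (kerG s) (- kerP s y).
Proof.
move=> s0.
have D := dM (is_derive_heat_exp_y s y) (dcst (p * Num.sqrt s)^-1 y).
apply: (is_derive_eq D); rewrite /kerP -/p.
have [r r0 [-> ->]] := sqr_sqrt s0.
by field; rewrite !gt_eqF.
Qed.

Lemma is_derive_kerP_y s y : 0 < s -> is_derive y 1 (kerP s) (kerP' s y).
Proof.
move=> s0.
have D := dM (dM (did y) (is_derive_heat_exp_y s y)) (dcst (2 * p * (s * Num.sqrt s))^-1 y).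
apply: (is_derive_eq D); rewrite /kerP' -/p.
have [r r0 [-> ->]] := sqr_sqrt s0.
by field; rewrite !gt_eqF.
Qed.

Let heat_expE s y : 0 < s -> expR (- (y / (2 * Num.sqrt s)) ^+ 2) = heat_exp s y.
Proof.
move=> s0; rewrite /heat_exp; congr expR; congr (- _).
have [r r0 [-> ->]] := sqr_sqrt s0.
by field; rewrite !gt_eqF.
Qed.

Lemma is_derive_kerQ_y s y : 0 < s -> is_derive y 1 (kerQ s) (- kerG s y).
Proof.
move=> s0.
have D := @dcomp _ _ (fun z => z / (2 * Num.sqrt s)) _ _ _ (is_derive_erfc _)
  (dM (did y) (dcst (2 * Num.sqrt s)^-1 y)).
apply: (is_derive_eq D); rewrite heat_expE// /kerG -/p.
have [r r0 [-> ->]] := sqr_sqrt s0.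
by field; rewrite !gt_eqF.
Qed.

Lemma is_derive_kerJ_y s y : 0 < s -> is_derive y 1 (kerJ s) (- kerQ s y).
Proof.
move=> s0.
have D := dB (dZ (2 / p) (dZ (Num.sqrt s) (is_derive_heat_exp_y s y)))
  (dM (did y) (is_derive_kerQ_y y s0)).
apply: (is_derive_eq D); rewrite /kerG -/p.
have [r r0 [-> ->]] := sqr_sqrt s0.
by field; rewrite !gt_eqF.
Qed.

Lemma is_derive_heat_exp_s s y : 0 < s ->
  is_derive s 1 (heat_exp ^~ y) (y ^+ 2 / (4 * s ^+ 2) * heat_exp s y).
Proof.
move=> s0.
have s0' : 4 * s != 0 by rewrite gt_eqF// mulr_gt0.
have D := dexp (dZ (- y ^+ 2) (dV s0' (dZ 4 (did s)))).
have E : heat_exp ^~ y = fun z => expR (- y ^+ 2 * (4 * z)^-1).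
  by apply/funext => z; rewrite /heat_exp mulNr.
rewrite {1}E; apply: (is_derive_eq D).
by rewrite /heat_exp mulNr; field; rewrite gt_eqF.
Qed.

Lemma is_derive_kerQ_s s y : 0 < s -> is_derive s 1 (kerQ ^~ y) (kerP s y).
Proof.
move=> s0.
have r0 : 2 * Num.sqrt s != 0 by rewrite gt_eqF// mulr_gt0// sqrtr_gt0.
have D := @dcomp _ _ (fun z => y / (2 * Num.sqrt z)) _ _ _ (is_derive_erfc _)
  (dZ y (@dV _ (fun z => 2 * Num.sqrt z) _ _ r0 (dZ 2 (is_derive1_sqrt s0)))).
apply: (is_derive_eq D); rewrite heat_expE// /kerP -/p.
have [r r0' [-> ->]] := sqr_sqrt s0.
by field; rewrite !gt_eqF.
Qed.

Lemma is_derive_kerJ_s s y : 0 < s -> is_derive s 1 (kerJ ^~ y) (kerG s y).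
Proof.
move=> s0.
have D := dB (dZ (2 / p) (dM (is_derive1_sqrt s0) (is_derive_heat_exp_s y s0)))
  (dZ y (is_derive_kerQ_s y s0)).
apply: (is_derive_eq D); rewrite /kerG /kerP -/p.
have [r r0' [-> ->]] := sqr_sqrt s0.
by field; rewrite !gt_eqF.
Qed.

Lemma kerG_continuous_s s y : 0 < s -> {for s, continuous (kerG ^~ y)}.
Proof.
move=> s0.
have r0 : p * Num.sqrt s != 0 by rewrite gt_eqF// mulr_gt0// sqrtr_gt0.
have D := dM (is_derive_heat_exp_s y s0)
  (@dV _ (fun z => p * Num.sqrt z) _ _ r0 (dZ p (is_derive1_sqrt s0))).
exact: is_derive_continuous D.
Qed.

Lemma kerP_continuous_s s y : 0 < s -> {for s, continuous (kerP ^~ y)}.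
Proof.
move=> s0.
have r0 : 2 * p * (s * Num.sqrt s) != 0.
  by rewrite gt_eqF// !mulr_gt0// sqrtr_gt0.
have D := dM (dZ y (is_derive_heat_exp_s y s0))
  (@dV _ (fun z => 2 * p * (z * Num.sqrt z)) _ _ r0 (dZ (2 * p) (dM (did s) (is_derive1_sqrt s0)))).
exact: is_derive_continuous D.
Qed.

Lemma kerQ_continuous_s s y : 0 < s -> {for s, continuous (kerQ ^~ y)}.
Proof. by move=> s0; exact: is_derive_continuous (is_derive_kerQ_s y s0). Qed.

Lemma heat_exp_ge0 s y : 0 <= heat_exp s y. Proof. exact: expR_ge0. Qed.

Lemma heat_exp_le1 s y : 0 <= s -> heat_exp s y <= 1.
Proof.
move=> s0; rewrite /heat_exp -expR0 ler_expR oppr_le0.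
by rewrite divr_ge0// ?sqr_ge0// mulr_ge0.
Qed.

Lemma kerG_ge0 s y : 0 <= kerG s y.
Proof. by rewrite divr_ge0 ?heat_exp_ge0// mulr_ge0// ?sqrtr_ge0// ltW. Qed.

Lemma kerG_le s y : 0 < s -> kerG s y <= (Num.sqrt s)^-1.
Proof.
move=> s0; have r0 : 0 < Num.sqrt s by rewrite sqrtr_gt0.
rewrite /kerG ler_pdivrMr ?mulr_gt0// mulrCA mulVf ?gt_eqF// mulr1.
by apply: le_trans p_ge1; apply: heat_exp_le1; exact: ltW.
Qed.

Lemma kerQ_ge0 s y : 0 <= y -> 0 <= kerQ s y.
Proof. by move=> y0; apply: erfc_ge0; rewrite divr_ge0// mulr_ge0// sqrtr_ge0. Qed.

Lemma kerQ_le1 s y : 0 <= y -> kerQ s y <= 1.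
Proof. by move=> y0; apply: erfc_le1; rewrite divr_ge0// mulr_ge0// sqrtr_ge0. Qed.

Lemma kerQ0 s : kerQ s 0 = 1. Proof. by rewrite /kerQ mul0r erfc0. Qed.

Lemma kerP0 s : kerP s 0 = 0. Proof. by rewrite /kerP !mul0r. Qed.

Lemma kerP_ge0 s y : 0 <= s -> 0 <= y -> 0 <= kerP s y.
Proof.
move=> s0 y0; rewrite divr_ge0 ?mulr_ge0 ?heat_exp_ge0 ?sqrtr_ge0//.
Qed.

(** With a = y / (2 sqrt s) this is a exp(- a^2) <= sqrt pi. *)
Lemma kerP_le s y : 0 < s -> kerP s y <= s^-1.
Proof.
move=> s0; have r0 : 0 < Num.sqrt s by rewrite sqrtr_gt0.
rewrite /kerP -heat_expE// expRN.
set a := y / (2 * Num.sqrt s); pose x := expR (a ^+ 2).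
have ax : a <= x.
  apply: le_trans (expR_ge1Dx _).
  have := sqr_ge0 (a - 1); have := sqr_ge0 a; rewrite !expr2; lra.
have x0 : 0 < x by exact: expR_gt0.
have -> : y * x^-1 / (2 * Num.sqrt pi * (s * Num.sqrt s)) = (a / x / p) * s^-1.
  by rewrite /a -/p; field; rewrite !gt_eqF.
rewrite ler_piMl ?invr_ge0 ?(ltW s0)//.
rewrite ler_pdivrMr// mul1r; apply: le_trans p_ge1.
by rewrite ler_pdivrMr// mul1r.
Qed.

(** With w = y^2 / (4 s) this follows from |1 - 2 w| <= 2 (1 + w) <= 2 exp w. *)
Lemma kerP'_le s y : 0 < s -> `|kerP' s y| <= (s * Num.sqrt s)^-1.
Proof.
move=> s0; have r0 : 0 < Num.sqrt s by rewrite sqrtr_gt0.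
rewrite /kerP'; set c := 2 * Num.sqrt pi * (s * Num.sqrt s).
have c0 : 0 < c by rewrite !mulr_gt0.
rewrite normrM (ger0_norm (_ : 0 <= c^-1)) ?invr_ge0 ?(ltW c0)// ler_pdivrMr//.
have -> : (s * Num.sqrt s)^-1 * c = 2 * p.
  by rewrite /c -/p; field; rewrite !gt_eqF.
rewrite normrM (ger0_norm (heat_exp_ge0 _ _)) /heat_exp expRN.
pose w := y ^+ 2 / (4 * s).
have w0 : 0 <= w by rewrite divr_ge0 ?sqr_ge0// mulr_ge0// ltW.
have ew := expR_ge1Dx w.
rewrite -/w ler_pdivrMr ?expR_gt0//.
have -> : y ^+ 2 / (2 * s) = 2 * w by rewrite /w; field; rewrite gt_eqF.
apply: (@le_trans _ _ (2 * expR w)).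
  by rewrite ler_norml; apply/andP; split; lra.
by rewrite ler_pM2r ?expR_gt0// ler_peMr.
Qed.

(** For each kernel, the mean value theorem bounds an increment by the distance
    and a worse power of s, and its size alone bounds it by a better one; the
    two are balanced later. *)
Lemma kerG_dist s y z : 0 < s -> 0 <= y -> 0 <= z ->
  `|kerG s z - kerG s y| <= s^-1 * `|z - y|.
Proof.
move=> s0 y0 z0.
have [c cyz ->] := mean_value y z (fun x => is_derive_kerG_y x s0).
have c0 := between_ge0 y0 z0 cyz.
rewrite normrM ler_wpM2r// normrN ger0_norm; first exact: kerP_le.
exact: kerP_ge0 (ltW s0) c0.
Qed.

Lemma kerG_dist' s y z : 0 < s -> `|kerG s z - kerG s y| <= (Num.sqrt s)^-1.
Proof.
move=> s0; rewrite ler_norml.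
have := kerG_le y s0; have := kerG_le z s0; have := kerG_ge0 s y; have := kerG_ge0 s z.
by move=> *; apply/andP; split; lra.
Qed.

Lemma kerP_dist s y z : 0 < s ->
  `|kerP s z - kerP s y| <= (s * Num.sqrt s)^-1 * `|z - y|.
Proof.
move=> s0; have [c cyz ->] := mean_value y z (fun x => is_derive_kerP_y x s0).
by rewrite normrM ler_wpM2r// kerP'_le.
Qed.

Lemma kerP_dist' s y z : 0 < s -> 0 <= y -> 0 <= z ->
  `|kerP s z - kerP s y| <= s^-1.
Proof.
move=> s0 y0 z0; rewrite ler_norml.
have := kerP_le y s0; have := kerP_le z s0.
have := kerP_ge0 (ltW s0) y0; have := kerP_ge0 (ltW s0) z0.
by move=> *; apply/andP; split; lra.
Qed.

Lemma kerQ_dist s y z : 0 < s -> `|kerQ s z - kerQ s y| <= (Num.sqrt s)^-1 * `|z - y|.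
Proof.
move=> s0; have [c cyz ->] := mean_value y z (fun x => is_derive_kerQ_y x s0).
by rewrite normrM ler_wpM2r// normrN ger0_norm ?kerG_ge0// kerG_le.
Qed.

Lemma kerQ_dist' s y z : 0 <= y -> 0 <= z -> `|kerQ s z - kerQ s y| <= 1.
Proof.
move=> y0 z0; rewrite ler_norml.
have := kerQ_le1 s y0; have := kerQ_le1 s z0.
have := kerQ_ge0 s y0; have := kerQ_ge0 s z0.
by move=> *; apply/andP; split; lra.
Qed.

Lemma cvg_kerQ_0 y : 0 < y -> kerQ s y @[s --> 0^'+] --> (0 : R).
Proof.
move=> y0; apply: (@cvg_comp _ _ _ (fun s => y / (2 * Num.sqrt s)) erfc _ +oo); last exact: cvg_erfc.
apply/cvgryPge => A; pose B := Num.max A 1.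
have B0 : 0 < B by rewrite /B lt_max ltr01 orbT.
have c0 : 0 < (y / (2 * B)) ^+ 2 by rewrite exprn_gt0// divr_gt0// mulr_gt0.
near=> s.
have s0 : 0 < s by near: s; exact: nbhs_right_gt.
have sc : s <= (y / (2 * B)) ^+ 2 by near: s; exact: nbhs_right_le.
apply: (@le_trans _ _ B); first by rewrite /B le_max lexx.
have : Num.sqrt s <= y / (2 * B).
  have -> : y / (2 * B) = Num.sqrt ((y / (2 * B)) ^+ 2).
    by rewrite sqrtr_sqr gtr0_norm// divr_gt0// mulr_gt0.
  by rewrite ler_sqrt// ltW.
rewrite ler_pdivlMr ?mulr_gt0// => H; rewrite ler_pdivlMr ?mulr_gt0 ?sqrtr_gt0//.
by apply: le_trans H; rewrite le_eqVlt; apply/orP; left; apply/eqP; ring.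
Unshelve. all: by end_near. Qed.

Lemma cvg_sqrt_0 : Num.sqrt s @[s --> 0^'+] --> (0 : R).
Proof.
have : Num.sqrt s @[s --> (0 : R)] --> Num.sqrt (0 : R) by exact: sqrt_continuous.
by rewrite sqrtr0; exact: cvg_at_right_filter.
Qed.

Lemma cvg_kerJ_0 y : 0 <= y -> kerJ s y @[s --> 0^'+] --> (0 : R).
Proof.
move=> y0.
have c1 : 2 / Num.sqrt pi * (Num.sqrt s * heat_exp s y) @[s --> 0^'+] --> (0 : R).
  rewrite -[X in _ --> X](mulr0 (2 / Num.sqrt pi)); apply: cvgMr.
  apply: (@squeeze_cvgr _ _ _ _ (cst 0) Num.sqrt); last 2 first.
  - exact: cvg_cst.
  - exact: cvg_sqrt_0.
  near=> s; have s0 : 0 < s by near: s; exact: nbhs_right_gt.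
  rewrite mulr_ge0 ?sqrtr_ge0 ?heat_exp_ge0//= ler_piMr ?sqrtr_ge0//.
  by apply: heat_exp_le1; exact: ltW.
have c2 : y * kerQ s y @[s --> 0^'+] --> (0 : R).
  have [->|yN0] := eqVneq y 0.
    by under eq_fun do rewrite mul0r; exact: cvg_cst.
  by rewrite -[X in _ --> X](mulr0 y); apply: cvgMr; apply: cvg_kerQ_0; rewrite lt_def yN0.
by rewrite -[X in _ --> X](subr0 0); exact: cvgB.
Unshelve. all: by end_near. Qed.

End heat_kernels.

(** * Integrals over ]0, T] *)

Section half_open_integrals.
Context {R : realType}.
Local Notation mu := (@lebesgue_measure R).
Implicit Types (f g F m k : R -> R) (T : R).

Lemma measurable_oc f (a b : R) : 0 <= a -> (forall s, 0 < s -> {for s, continuous f}) ->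
  measurable_fun `]a, b] f.
Proof.
move=> a0 cf.
have m0 : measurable_fun (`]0, +oo[%classic : set R) f.
  apply: open_continuous_measurable_fun; first exact: interval_open.
  by move=> s; rewrite inE/= in_itv/= andbT => s0; exact: cf.
apply: measurable_funS m0 => //.
by move=> s /=; rewrite !in_itv/= andbT => /andP[+ _]; exact: le_lt_trans.
Qed.

Lemma FTC_closed f F (a b : R) : 0 < a -> a < b ->
  (forall s : R, 0 < s -> is_derive s 1 F (f s)) ->
  (forall s, 0 < s -> {for s, continuous f}) ->
  (\int[mu]_(s in `[a, b]) (f s)%:E = (F b)%:E - (F a)%:E)%E.
Proof.
move=> a0 ab dF cf; apply: continuous_FTC2 => //.
- apply: continuous_in_subspaceT => s; rewrite inE/= in_itv/= => /andP[as_ _].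
  by apply: cf; exact: lt_le_trans as_.
- split=> [s||].
  + by rewrite in_itv/= => /andP[as_ _]; have [] := dF s (lt_trans a0 as_).
  + by apply: cvg_at_right_filter; exact: is_derive_continuous (dF a a0).
  + by apply: cvg_at_left_filter; exact: is_derive_continuous (dF b (lt_trans a0 ab)).
- move=> s; rewrite in_itv/= => /andP[as_ _].
  by rewrite derive1E; have [_] := dF s (lt_trans a0 as_).
Qed.

(** Monotone convergence over the intervals [T / (n + 2), T]. *)
Lemma FTC_ge0_oc f F (F0 T : R) : 0 < T ->
  (forall s, 0 < s -> 0 <= f s) ->
  (forall s : R, 0 < s -> is_derive s 1 F (f s)) ->
  (forall s, 0 < s -> {for s, continuous f}) ->
  F s @[s --> 0^'+] --> F0 ->
  mu.-integrable `]0, T] (EFin \o f) /\ \int[mu]_(s in `]0, T]) f s = F T - F0.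
Proof.
move=> T0 f0 dF cf F0cvg.
have a_gt0 n : 0 < T / n.+2%:R by rewrite divr_gt0.
have a_ltT n : T / n.+2%:R < T.
  by rewrite ltr_pdivrMr// ltr_pMr// ltr1n.
have mf : measurable_fun `]0, T] (EFin \o f).
  by apply/measurable_EFinP; exact: measurable_oc.
have E : (\int[mu]_(s in `]0%R, T]) (f s)%:E = (F T - F0)%:E)%E.
  have UE : `]0, T]%classic = \bigcup_n `[T / n.+2%:R, T]%classic.
    apply/seteqP; split => s /=.
      rewrite in_itv/= => /andP[s0 sT].
      have [n _ /(_ n (leqnn n)) Hn] := near_infty_natSinv_lt (PosNum (divr_gt0 s0 T0)).
      exists n => //=; rewrite in_itv/= sT andbT.
      rewrite mulrC -ler_pdivlMr// ltW//; apply: le_lt_trans Hn.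
      by rewrite lef_pV2 ?posrE// ler_nat.
    by move=> [n _]/=; rewrite !in_itv/= => /andP[ns ->]; rewrite (lt_le_trans (a_gt0 n) ns).
  have h1 : (\int[mu]_(s in `[(T / n.+2%:R)%R, T]) (f s)%:E)%E @[n --> \oo] -->
      (\int[mu]_(s in `]0%R, T]) (f s)%:E)%E.
    rewrite UE; apply: ge0_nondecreasing_set_cvg_integral => //.
    - move=> n m nm; apply/subsetPset => s /=; rewrite !in_itv/= => /andP[ns ->].
      rewrite andbT; apply: le_trans ns.
      by rewrite ler_pM2l// lef_pV2 ?posrE// ler_nat.
    - move=> n; apply: measurable_funS mf => //.
      by move=> s /=; rewrite !in_itv/= => /andP[ns ->]; rewrite (lt_le_trans (a_gt0 n) ns).
    - move=> n s /=; rewrite in_itv/= => /andP[ns _]; rewrite lee_fin f0//.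
      exact: lt_le_trans ns.
  have h2 : (\int[mu]_(s in `[(T / n.+2%:R)%R, T]) (f s)%:E)%E @[n --> \oo] -->
      (F T - F0)%:E.
    rewrite (_ : (fun n => _) = EFin \o (fun n => F T - F (T / n.+2%:R))); last first.
      by apply/funext => n /=; rewrite (FTC_closed _ _ dF)// EFinB.
    apply: cvg_EFin; first exact: nearW.
    apply: cvgB; first exact: cvg_cst.
    move/cvg_at_rightP : F0cvg => /(_ (fun n => T / n.+2%:R)); apply; split => //.
    rewrite -[X in _ --> X](mulr0 T); apply: cvgMr.
    by have := @cvg_harmonic R; rewrite -cvg_shiftS.
  exact: (cvg_unique _ h1 h2).
have iF : mu.-integrable `]0, T] (EFin \o f).
  apply/integrableP; split => //.
  rewrite (_ : \int[mu]_(x in _) _ = (F T - F0)%:E)%E ?ltry// -E.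
  by apply: eq_integral => s; rewrite inE/= in_itv/= => /andP[s0 _]; rewrite ger0_norm// f0.
by split => //; rewrite /Rintegral E.
Qed.

Lemma powR_continuous_gt0 (p s : R) : 0 < s -> {for s, continuous (fun x : R => x `^ p)}.
Proof. by move=> s0; exact: is_derive_continuous (is_derive1_powR p s0). Qed.

Lemma int_powR (r T : R) : 0 < r -> 0 < T ->
  mu.-integrable `]0, T] (EFin \o (fun s => s `^ (r - 1))) /\
  \int[mu]_(s in `]0, T]) (s `^ (r - 1)) = r^-1 * T `^ r.
Proof.
move=> r0 T0.
have [|||| i E] := @FTC_ge0_oc (fun s => s `^ (r - 1)) (fun s => r^-1 * s `^ r) 0 T T0.
- by move=> s s0; exact: powR_ge0.
- move=> s s0; apply: (is_derive_eq (dZ r^-1 (is_derive1_powR r s0))).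
  by rewrite mulrA mulVf ?mul1r// gt_eqF.
- by move=> s s0; exact: powR_continuous_gt0.
- by rewrite -[X in _ --> X](mulr0 r^-1); apply: cvgMr; exact: powR_cvg0.
- by split => //; rewrite E subr0.
Qed.

Lemma Rintegral_dominated (D : set R) f m : measurable D -> measurable_fun D f ->
  mu.-integrable D (EFin \o m) -> (forall s, D s -> `|f s| <= m s) ->
  mu.-integrable D (EFin \o f) /\ `|\int[mu]_(s in D) f s| <= \int[mu]_(s in D) m s.
Proof.
move=> mD mf im fm.
have i_f : mu.-integrable D (EFin \o f).
  apply: le_integrable im => //; first exact/measurable_EFinP.
  move=> s Ds; rewrite /= lee_fin; apply: le_trans (fm s Ds) _; exact: ler_norm.
split => //; apply: le_trans (le_normr_Rintegral _ _) _ => //.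
apply: le_Rintegral => //.
exact: (integrable_norm i_f).
Qed.

Lemma integrable_cstM (D : set R) f (c : R) : measurable D ->
  mu.-integrable D (EFin \o f) -> mu.-integrable D (EFin \o (fun s => c * f s)).
Proof.
move=> mD fi; rewrite (_ : EFin \o _ = (fun s => c%:E * (f s)%:E)%E)//.
exact: integrableZl.
Qed.

Lemma setU_oc (a b c : R) : a <= b -> b <= c ->
  `]a, c]%classic = `]a, b] `|` `]b, c] /\ [disjoint `]a, b]%classic & `]b, c]%classic].
Proof.
move=> ab bc; split.
  apply/seteqP; split => s /=; rewrite !in_itv/=.
    by move=> /andP[as_ sc]; have [sb|bs] := leP s b; [left|right]; apply/andP.
  by move=> [/andP[-> sb]|/andP[bs ->]]; rewrite ?(le_trans sb)// (le_lt_trans ab).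
apply/disj_setPS => s /= []; rewrite !in_itv/= => /andP[_ sb] /andP[bs _].
by move: (le_lt_trans sb bs); rewrite ltxx.
Qed.

(** The two bounds on k agree at s = delta^2.  Below, the integral of s^(b - 1)
    contributes delta^(2b) / b; above, that of delta s^(b - 3/2) contributes
    delta^(2b) / (1/2 - b), which is where b < 1/2 enters. *)
Lemma increment_bound k g (b A N delta T : R) : 0 < b -> b < 2^-1 -> 0 <= A -> 0 <= N ->
  0 < delta -> 0 < T ->
  measurable_fun (`]0, T]%classic : set R) k -> measurable_fun (`]0, T]%classic : set R) g ->
  (forall s, 0 < s <= T -> `|k s| <= A * s^-1) ->
  (forall s, 0 < s <= T -> `|k s| <= A * ((s * Num.sqrt s)^-1 * delta)) ->
  (forall s, 0 < s <= T -> `|g s| <= N * s `^ b) ->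
  mu.-integrable `]0, T] (EFin \o (fun s => k s * g s)) /\
  `|\int[mu]_(s in `]0, T]) (k s * g s)| <= A * N * (b^-1 + (2^-1 - b)^-1) * delta `^ (2 * b).
Proof.
move=> b0 b12 A0 N0 d0 T0 mk mg k1 k2 g1.
have c0 : 0 < 2^-1 - b by rewrite subr_gt0.
have AN0 : 0 <= A * N by rewrite mulr_ge0.
have mkg : measurable_fun (`]0, T]%classic : set R) (fun s => k s * g s).
  exact: measurable_funM.
have kg1 s : 0 < s <= T -> `|k s * g s| <= A * N * s `^ (b - 1).
  move=> sT; have s0 : 0 < s by case/andP: sT.
  have -> : A * N * s `^ (b - 1) = (A * s^-1) * (N * s `^ b).
    rewrite powRB; last by rewrite (gt_eqF s0) implybT.
    by rewrite powRr1 ?ltW//; ring.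
  by rewrite normrM ler_pM// ?k1// g1.
have kg2 s : 0 < s <= T -> `|k s * g s| <= A * N * delta * s `^ (b - 2^-1 - 1).
  move=> sT; have s0 : 0 < s by case/andP: sT.
  have -> : A * N * delta * s `^ (b - 2^-1 - 1) =
      (A * ((s * Num.sqrt s)^-1 * delta)) * (N * s `^ b).
    rewrite powRB; last by rewrite (gt_eqF s0) implybT.
    rewrite powRB; last by rewrite (gt_eqF s0) implybT.
    rewrite powRr1 ?ltW// powR12_sqrt ?ltW// invfM; ring.
  by rewrite normrM ler_pM// ?k2// g1.
have small (t : R) : 0 < t -> t <= T -> t <= delta ^+ 2 ->
    mu.-integrable `]0, t] (EFin \o (fun s => k s * g s)) /\
    `|\int[mu]_(s in `]0, t]) (k s * g s)| <= A * N * b^-1 * delta `^ (2 * b).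
  move=> t0 tT td; have [ip Ep] := int_powR b0 t0.
  have sub : `]0, t]%classic `<=` `]0, T]%classic.
    by move=> s /=; rewrite !in_itv/= => /andP[-> st]; exact: le_trans tT.
  have [||||i E] := @Rintegral_dominated `]0, t] (fun s => k s * g s)
      (fun s => A * N * s `^ (b - 1)) => //.
  - exact: measurable_funS mkg.
  - exact: integrable_cstM.
  - by move=> s /=; rewrite in_itv/= => /andP[s0 st]; apply: kg1; rewrite s0 (le_trans st).
  split => //; apply: le_trans E _; rewrite RintegralZl// Ep -!mulrA.
  rewrite !ler_wpM2l// ?invr_ge0 ?(ltW b0)//.
  rewrite [leRHS]powRrM powR_mulrn ?(ltW d0)//.
  by apply: ge0_ler_powR => //; rewrite ?nnegrE ?ltW// exprn_gt0.
have dge0 : 0 <= delta `^ (2 * b) by exact: powR_ge0.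
(* If T <= delta^2, only the first of the two regimes occurs. *)
have [Td|dT] := leP T (delta ^+ 2).
  have [i E] := small T T0 (lexx _) Td; split => //; apply: le_trans E _.
  by rewrite ler_wpM2r// ler_wpM2l// lerDl invr_ge0 ltW.
have d20 : 0 < delta ^+ 2 by rewrite exprn_gt0.
have [i1 E1] := small _ d20 (ltW dT) (lexx _).
have sub : `]delta ^+ 2, T]%classic `<=` `]0, T]%classic.
  by move=> s /=; rewrite !in_itv/= => /andP[ds ->]; rewrite (lt_trans d20).
pose p := b - 2^-1.
have p0 : p != 0 by rewrite lt_eqF// subr_lt0.
have dF (s : R) : 0 < s -> is_derive s 1 (fun s => p^-1 * s `^ p) (s `^ (p - 1)).
  move=> s0; apply: (is_derive_eq (dZ p^-1 (is_derive1_powR p s0))).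
  by rewrite mulrA mulVf ?mul1r// gt_eqF.
have Ep := FTC_closed d20 dT dF (fun s s0 => powR_continuous_gt0 (p := p - 1) s0).
have ic : mu.-integrable `[delta ^+ 2, T] (EFin \o (fun s => s `^ (p - 1))).
  apply: continuous_compact_integrable; first exact: segment_compact.
  apply: continuous_in_subspaceT => s; rewrite inE/= in_itv/= => /andP[ds _].
  by apply: powR_continuous_gt0; exact: lt_le_trans ds.
have ip : mu.-integrable `]delta ^+ 2, T] (EFin \o (fun s => s `^ (p - 1))).
  apply: integrableS ic => //.
  by move=> s /=; rewrite !in_itv/= => /andP[/ltW -> ->].
have {}Ep : \int[mu]_(s in `]delta ^+ 2, T]) (s `^ (p - 1)) = p^-1 * T `^ p - p^-1 * (delta ^+ 2) `^ p.
  by rewrite Rintegral_itv_obnd_cbnd// /Rintegral Ep.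
have [|||i2 E2] := @Rintegral_dominated `]delta ^+ 2, T] (fun s => k s * g s)
    (fun s => A * N * delta * s `^ (p - 1)) (measurable_itv _).
- exact: measurable_funS mkg.
- exact: integrable_cstM.
- by move=> s /=; rewrite in_itv/= => /andP[s0 st]; apply: kg2; rewrite st (lt_trans d20).
have [UE Udisj] := setU_oc (ltW d20) (ltW dT).
have i12 : mu.-integrable `]0, T] (EFin \o (fun s => k s * g s)).
  have [ip0 _] := int_powR b0 T0.
  have [||//] := @Rintegral_dominated `]0, T] _ (fun s => A * N * s `^ (b - 1)) (measurable_itv _) mkg.
    exact: integrable_cstM.
  by move=> s /=; rewrite in_itv/=; exact: kg1.
split => //; rewrite UE Rintegral_setU// -?UE//.
apply: le_trans (ler_normD _ _) _.
rewrite mulrDr mulrDl lerD//; apply: le_trans E2 _.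
rewrite RintegralZl// Ep.
have -> : p = - (2^-1 - b) by rewrite opprB.
rewrite invrN !mulNr opprK.
have Tp : 0 <= (2^-1 - b)^-1 * T `^ - (2^-1 - b) by rewrite mulr_ge0 ?powR_ge0// invr_ge0 ltW.
apply: (@le_trans _ _ (A * N * delta * ((2^-1 - b)^-1 * (delta ^+ 2) `^ - (2^-1 - b)))).
  by rewrite ler_wpM2l ?mulr_ge0 ?(ltW d0)// gerDr oppr_le0.
rewrite le_eqVlt; apply/orP; left; apply/eqP.
have -> : delta `^ (2 * b) = delta * (delta ^+ 2) `^ - (2^-1 - b); last by ring.
rewrite -powR_mulrn ?ltW// -powRrM -{2}(powRr1 (ltW d0)) -powRD; last first.
  by rewrite (gt_eqF d0) implybT.
by congr (_ `^ _); field.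
Qed.

End half_open_integrals.

(** * The scalar half-line problem *)

Section scalar_problem.
Context {R : realType}.
Local Notation mu := (@lebesgue_measure R).
Variables (T b N : R) (phi psi : R -> R).
Hypotheses (T0 : 0 < T) (b0 : 0 < b) (b12 : b < 2^-1) (N0 : 0 <= N).
Hypothesis phi0 : forall r, r <= 0 -> phi r = 0.
Hypothesis psi0 : forall r, r <= 0 -> psi r = 0.
Hypothesis psi_holder : forall r r', r <= T -> r' <= T ->
  `|psi r - psi r'| <= N * `|r - r'| `^ b.
Hypothesis phi_taylor : forall r r', r <= T -> r' <= T ->
  `|phi r' - phi r - (r' - r) * psi r| <= N * `|r' - r| `^ (1 + b).

Let D : set R := `]0, T]%classic.
Local Notation intD f := (mu.-integrable D (EFin \o f)).

Let mD : measurable D. Proof. exact: measurable_itv. Qed.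

Let DP s : D s -> 0 < s <= T. Proof. by rewrite /D/= in_itv. Qed.

Lemma psi_bound r : r <= T -> `|psi r| <= N * T `^ b.
Proof.
move=> rT; have [r0|r0] := leP r 0.
  by rewrite psi0// normr0 mulr_ge0// powR_ge0.
have := psi_holder rT (ltW T0); rewrite (psi0 (lexx 0)) !subr0 => H.
apply: le_trans H _; rewrite ler_wpM2l// (gtr0_norm r0).
by apply: ge0_ler_powR; rewrite ?nnegrE ?(ltW b0) ?(ltW r0) ?(ltW T0).
Qed.

Lemma phi_bound r : r <= T -> `|phi r| <= N * T `^ (1 + b).
Proof.
move=> rT; have [r0|r0] := leP r 0.
  by rewrite phi0// normr0 mulr_ge0// powR_ge0.
have := phi_taylor (ltW T0) rT; rewrite (phi0 (lexx 0)) (psi0 (lexx 0)) mulr0 !subr0 => H.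
apply: le_trans H _; rewrite ler_wpM2l// (gtr0_norm r0).
by apply: ge0_ler_powR; rewrite ?nnegrE ?addr_ge0 ?(ltW b0) ?(ltW r0) ?(ltW T0).
Qed.

Let holder_small (e : R) : 0 < e ->
  exists2 delta : R, 0 < delta & forall h : R, `|h| <= delta -> N * `|h| `^ b <= e.
Proof.
move=> e0; pose c := e / (N + 1).
have N1 : 0 < N + 1 by rewrite ltr_wpDl.
have c0 : 0 < c by rewrite divr_gt0.
exists (c `^ b^-1); first exact: powR_gt0.
move=> h hd; have : `|h| `^ b <= c.
  rewrite -[leRHS](powRr1 (ltW c0)) -(mulVf (lt0r_neq0 b0)) powRrM.
  by apply: ge0_ler_powR; rewrite ?nnegrE ?powR_ge0 ?(ltW b0).
move=> hc; apply: (@le_trans _ _ (N * c)); first by rewrite ler_wpM2l.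
by rewrite /c mulrA ler_pdivrMr// mulrC ler_pM2l// lerDl.
Qed.

Lemma psi_continuous r : r < T -> {for r, continuous psi}.
Proof.
move=> rT; apply/cvgrPdist_le => e e0.
have [delta d0 dP] := holder_small e0.
near=> x.
apply: le_trans (dP (r - x) _).
  apply: psi_holder; first exact: ltW.
  by near: x; exact: lt_le_nbhsl.
near: x; apply: filterS (nbhsx_ballx r delta d0) => z; exact: ltW.
Unshelve. all: by end_near. Qed.

Lemma is_derive_phi (r : R) : r < T -> is_derive r 1 phi (psi r).
Proof.
move=> rT.
have H : (fun h => h^-1 *: ((phi \o shift r) (h *: (1 : R)) - phi r)) @ (0 : R)^' --> psi r.
  apply/cvgrPdist_le => e e0.
  have [delta d0 dP] := holder_small e0.
  near=> h.
  have hN0 : h != 0 by near: h; exact: nbhs_dnbhs_neq.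
  have hd : `|h| <= delta by near: h; apply: dnbhs0_le.
  have hT : `|h| <= T - r by near: h; apply: dnbhs0_le; rewrite subr_gt0.
  have hrT : h + r <= T by rewrite -lerBrDr; apply: le_trans (ler_norm _) hT.
  apply: le_trans (dP h hd).
  rewrite /= /GRing.scale/= mulr1.
  have -> : psi r - h^-1 * (phi (h + r) - phi r) =
      - (h^-1 * (phi (h + r) - phi r - ((h + r) - r) * psi r)) by field.
  rewrite normrN normrM normfV.
  have h0 : 0 < `|h| by rewrite normr_gt0.
  rewrite mulrC ler_pdivrMr//.
  apply: le_trans (phi_taylor (ltW rT) hrT) _; rewrite addrK.
  by rewrite powRD ?powRr1// ?normr_eq0 ?hN0 ?implybT// mulrA mulrAC.
apply: DeriveDef; first exact: cvgP H.
exact: cvg_lim H.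
Unshelve. all: by end_near. Qed.

Lemma psi_shift_continuous (t s : R) : t <= T -> 0 < s -> {for s, continuous (fun s => psi (t - s))}.
Proof.
move=> tT s0; apply: (@continuous_comp _ _ _ (fun s => t - s) psi).
  exact: is_derive_continuous (dB (dcst t s) (did s)).
by apply: psi_continuous; rewrite ltrBlDr (le_lt_trans tT)// ltrDl.
Qed.

Lemma is_derive_phi_shift (t s : R) : t <= T -> 0 < s ->
  is_derive s 1 (fun s => phi (t - s)) (- psi (t - s)).
Proof.
move=> tT s0.
have ts : t - s < T by rewrite ltrBlDr (le_lt_trans tT)// ltrDl.
apply: (is_derive_eq (@dcomp _ phi (fun s => t - s) _ _ _ (is_derive_phi ts)
  (dB (dcst t s) (did s)))).
by rewrite sub0r mulrN1.
Qed.

Lemma integral_lin (f g : R -> R) (x y : R) : intD f -> intD g ->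
  intD (fun s => x * f s + y * g s) /\
  \int[mu]_(s in D) (x * f s + y * g s) =
  x * \int[mu]_(s in D) f s + y * \int[mu]_(s in D) g s.
Proof.
move=> fi gi.
have xf := integrable_cstM x mD fi; have yg := integrable_cstM y mD gi.
split; last by rewrite RintegralD// !RintegralZl.
rewrite (_ : EFin \o _ = (fun s => (x * f s)%:E + (y * g s)%:E)%E)//.
exact: integrableD.
Qed.

(** Adding the dominating function to the integrand makes it nonnegative. *)
Lemma FTC_oc (f F g G : R -> R) (F0 G0 : R) :
  (forall s, 0 < s -> `|f s| <= g s) ->
  (forall s : R, 0 < s -> is_derive s 1 F (f s)) ->
  (forall s, 0 < s -> {for s, continuous f}) ->
  (forall s : R, 0 < s -> is_derive s 1 G (g s)) ->
  (forall s, 0 < s -> {for s, continuous g}) ->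
  F s @[s --> 0^'+] --> F0 -> G s @[s --> 0^'+] --> G0 ->
  intD f /\ \int[mu]_(s in D) f s = F T - F0.
Proof.
move=> fg dF cf dG cg F0cvg G0cvg.
have g0 s : 0 < s -> 0 <= g s by move=> s0; apply: le_trans (fg s s0).
have [ig Eg] := FTC_ge0_oc T0 g0 dG cg G0cvg.
have [||||ifg Efg] := @FTC_ge0_oc _ (fun s => f s + g s) (fun s => F s + G s) (F0 + G0) T T0.
- by move=> s s0; have := fg s s0; rewrite ler_norml => /andP[+ _]; rewrite -subr_ge0 opprK.
- by move=> s s0; apply: dD; [exact: dF|exact: dG].
- by move=> s s0; apply: continuousD; [exact: cf|exact: cg].
- exact: cvgD.
have fE : f = fun s => 1 * (f s + g s) + (-1) * g s.
  by apply/funext => s; ring.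
have [i E] := integral_lin 1 (-1) ifg ig.
split; first by rewrite fE.
by rewrite [in LHS]fE E Efg Eg; ring.
Qed.

(** [Vsol] is the solution with boundary value phi, where psi is the derivative
    of phi.  [Usol] is its derivative in y, and [Wsol] both its derivative in t
    and its second derivative in y. *)
Definition Vsol t y := if y == 0 then phi t else \int[mu]_(s in D) (kerP s y * phi (t - s)).
Definition Usol t y := - \int[mu]_(s in D) (kerG s y * psi (t - s)).
Definition Wsol t y := if y == 0 then psi t else \int[mu]_(s in D) (kerP s y * psi (t - s)).

Lemma phi_shift_continuous (t s : R) : t <= T -> 0 < s -> {for s, continuous (fun s => phi (t - s))}.
Proof. by move=> tT s0; exact: is_derive_continuous (is_derive_phi_shift tT s0). Qed.

Let shift_le t s : t <= T -> 0 < s -> t - s <= T.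
Proof. by move=> tT s0; rewrite lerBlDr (le_trans tT)// lerDl ltW. Qed.

Lemma mpsi t : t <= T -> measurable_fun D (fun s => psi (t - s)).
Proof. by move=> tT; apply: measurable_oc => // s s0; exact: psi_shift_continuous. Qed.

Lemma mphi t : t <= T -> measurable_fun D (fun s => phi (t - s)).
Proof. by move=> tT; apply: measurable_oc => // s s0; exact: phi_shift_continuous. Qed.

Lemma integrable_kerP y : 0 < y ->
  intD (kerP ^~ y) /\ \int[mu]_(s in D) kerP s y = kerQ T y.
Proof.
move=> y0; have [||||i ->] := @FTC_ge0_oc _ (kerP ^~ y) (kerQ ^~ y) 0 T T0.
- by move=> s s0; exact: kerP_ge0 (ltW s0) (ltW y0).
- by move=> s s0; exact: is_derive_kerQ_s.
- by move=> s s0; exact: kerP_continuous_s.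
- exact: cvg_kerQ_0.
- by rewrite subr0.
Qed.

Lemma integrable_kerG y : 0 <= y ->
  intD (kerG ^~ y) /\ \int[mu]_(s in D) kerG s y = kerJ T y.
Proof.
move=> y0; have [||||i ->] := @FTC_ge0_oc _ (kerG ^~ y) (kerJ ^~ y) 0 T T0.
- by move=> s s0; exact: kerG_ge0.
- by move=> s s0; exact: is_derive_kerJ_s.
- by move=> s s0; exact: kerG_continuous_s.
- exact: cvg_kerJ_0.
- by rewrite subr0.
Qed.

Lemma integral_mul_bounded (k g : R -> R) (M : R) : intD k -> measurable_fun D k ->
  (forall s, 0 < s <= T -> 0 <= k s) -> measurable_fun D g ->
  (forall s, 0 < s <= T -> `|g s| <= M) ->
  intD (fun s => k s * g s) /\ `|\int[mu]_(s in D) (k s * g s)| <= M * \int[mu]_(s in D) k s.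
Proof.
move=> ik mk k0 mg gM.
have [|||i E] := @Rintegral_dominated _ D (fun s => k s * g s) (fun s => M * k s) mD.
- exact: measurable_funM.
- exact: integrable_cstM.
- move=> s /DP sT; rewrite normrM mulrC (ger0_norm (k0 s sT)) ler_wpM2r ?k0//.
  exact: gM.
- by split => //; rewrite -RintegralZl.
Qed.

Let mkerP y : measurable_fun D (kerP ^~ y).
Proof. by apply: measurable_oc => // s s0; exact: kerP_continuous_s. Qed.
Let mkerG y : measurable_fun D (kerG ^~ y).
Proof. by apply: measurable_oc => // s s0; exact: kerG_continuous_s. Qed.
Let mkerQ y : measurable_fun D (kerQ ^~ y).
Proof. by apply: measurable_oc => // s s0; exact: kerQ_continuous_s. Qed.

Let kerP_ge0' y : 0 <= y -> forall s, 0 < s <= T -> 0 <= kerP s y.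
Proof. by move=> y0 s /andP[s0 _]; exact: kerP_ge0 (ltW s0) y0. Qed.

Lemma integrable_cst (c : R) : intD (cst c).
Proof.
have Doo : (mu D < +oo)%E.
  by rewrite /D lebesgue_measure_itv/=; case: ifPn => _; rewrite ?ltry// -EFinB ltry.
apply: measurable_bounded_integrable => //.
exists `|c|; split; first exact: num_real.
by move=> M cM s _ /=; exact: ltW.
Qed.

Lemma integrable_kerP_psi t y : t <= T -> 0 < y -> intD (fun s => kerP s y * psi (t - s)).
Proof.
move=> tT y0; have [iP _] := integrable_kerP y0.
have [] // := @integral_mul_bounded (kerP ^~ y) (fun s => psi (t - s)) (N * T `^ b) iP.
- by apply: kerP_ge0'; exact: ltW.
- exact: mpsi.
- by move=> s /andP[s0 _]; apply: psi_bound; exact: shift_le.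
Qed.

Lemma integrable_kerP_phi t y : t <= T -> 0 < y -> intD (fun s => kerP s y * phi (t - s)).
Proof.
move=> tT y0; have [iP _] := integrable_kerP y0.
have [] // := @integral_mul_bounded (kerP ^~ y) (fun s => phi (t - s)) (N * T `^ (1 + b)) iP.
- by apply: kerP_ge0'; exact: ltW.
- exact: mphi.
- by move=> s /andP[s0 _]; apply: phi_bound; exact: shift_le.
Qed.

Lemma integrable_kerG_psi t y : t <= T -> 0 <= y -> intD (fun s => kerG s y * psi (t - s)).
Proof.
move=> tT y0; have [iG _] := integrable_kerG y0.
have [] // := @integral_mul_bounded (kerG ^~ y) (fun s => psi (t - s)) (N * T `^ b) iG.
- by move=> s _; exact: kerG_ge0.
- exact: mpsi.
- by move=> s /andP[s0 _]; apply: psi_bound; exact: shift_le.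
Qed.

Lemma integrable_kerQ_psi t y : t <= T -> 0 <= y -> intD (fun s => kerQ s y * psi (t - s)).
Proof.
move=> tT y0.
have [|||//] := @Rintegral_dominated _ D (fun s => kerQ s y * psi (t - s)) (fun s => N * T `^ b) mD.
- by apply: measurable_funM => //; exact: mpsi.
- exact: integrable_cst.
move=> s /DP /andP[s0 _]; rewrite normrM.
rewrite ger0_norm ?kerQ_ge0//; apply: (@le_trans _ _ (1 * `|psi (t - s)|)).
  by rewrite ler_wpM2r// kerQ_le1.
by rewrite mul1r; apply: psi_bound; exact: shift_le.
Qed.

Let cvg_psi_id (t : R) : t <= T -> phi (t - s) @[s --> 0^'+] --> phi t.
Proof.
move=> tT.
have [c cP] : exists c, forall s : R, 0 < s < 1 -> `|phi (t - s) - phi t| <= c * s.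
  exists (N + N * T `^ b) => s /andP[s0 s1].
  have := phi_taylor tT (shift_le tT s0).
  have -> : t - s - t = - s by ring.
  rewrite normrN (gtr0_norm s0) => H.
  have -> : phi (t - s) - phi t = (phi (t - s) - phi t - - s * psi t) - s * psi t by ring.
  apply: le_trans (ler_normB _ _) _; rewrite mulrDl lerD//.
    apply: le_trans H _; rewrite ler_wpM2l//.
    rewrite -[leRHS](powRr1 (ltW s0)); apply: ger_powR; first by rewrite s0 ltW.
    by rewrite lerDl ltW.
  rewrite normrM (gtr0_norm s0) mulrC ler_wpM2r ?(ltW s0)//; exact: psi_bound.
apply/cvgrPdist_le => e e0.
have c0 : 0 < `|c| + 1 by rewrite ltr_wpDl.
near=> s.
have s0 : 0 < s by near: s; exact: nbhs_right_gt.
have s1 : s < 1 by near: s; exact: nbhs_right_lt.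
have se : s <= e / (`|c| + 1) by near: s; apply: nbhs_right_le; rewrite divr_gt0.
rewrite distrC; apply: le_trans (cP s _) _; first by rewrite s0.
apply: (@le_trans _ _ ((`|c| + 1) * s)).
  by rewrite ler_wpM2r ?(ltW s0)//; apply: le_trans (ler_norm _) _; rewrite lerDl.
by rewrite mulrC -ler_pdivlMr.
Unshelve. all: by end_near. Qed.

(** Integration by parts in s.  Both boundary terms vanish for y > 0, at s = T
    because phi vanishes at negative times and at s = 0 because kerQ tends to 0
    there; for y = 0 one has kerQ = 1, and the term at s = 0 is the boundary
    value. *)
Lemma VsolE t y : t <= T -> 0 <= y -> Vsol t y = \int[mu]_(s in D) (kerQ s y * psi (t - s)).
Proof.
move=> tT y0; have tT0 : t - T <= 0 by rewrite subr_le0.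
pose M := N * T `^ b; pose L := N * T `^ (1 + b).
have psiM s : 0 < s -> `|psi (t - s)| <= M by move=> s0; apply: psi_bound; exact: shift_le.
have phiL s : 0 < s -> `|phi (t - s)| <= L by move=> s0; apply: phi_bound; exact: shift_le.
have cMs : M * s @[s --> 0^'+] --> (0 : R).
  rewrite -[X in _ --> X](mulr0 M); apply: cvgMr.
  by apply: cvg_at_right_filter; exact: cvg_id.
rewrite /Vsol; have [->|yN0] := eqVneq y 0.
  under eq_Rintegral do rewrite kerQ0 mul1r.
  have [|||||||i ->] := @FTC_oc (fun s => psi (t - s)) (fun s => - phi (t - s))
    (fun s => M) (fun s => M * s) (- phi t) 0.
  - exact: psiM.
  - move=> s s0; apply: (is_derive_eq (is_deriveN (is_derive_phi_shift tT s0))).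
    by rewrite opprK.
  - by move=> s s0; exact: psi_shift_continuous.
  - by move=> s s0; apply: (is_derive_eq (dZ M (did s))); rewrite mulr1.
  - by move=> s s0; exact: cst_continuous.
  - by apply: cvgN; exact: cvg_psi_id.
  - exact: cMs.
  - by rewrite (phi0 tT0) oppr0 opprK add0r.
have ygt0 : 0 < y by rewrite lt_def yN0.
have [|||||||i] := @FTC_oc (fun s => kerP s y * phi (t - s) - kerQ s y * psi (t - s))
    (fun s => kerQ s y * phi (t - s))
    (fun s => L * kerP s y + M) (fun s => L * kerQ s y + M * s) 0 0.
- move=> s s0; apply: le_trans (ler_normB _ _) _.
  rewrite (normrM (kerP s y)) (normrM (kerQ s y)).
  rewrite (ger0_norm (kerP_ge0 (ltW s0) y0)) (ger0_norm (kerQ_ge0 s y0)) lerD//.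
    by rewrite mulrC ler_wpM2r ?phiL// kerP_ge0// ltW.
  rewrite -[leRHS]mul1r; apply: ler_pM => //; first exact: kerQ_ge0.
    exact: kerQ_le1.
  exact: psiM.
- move=> s s0; apply: (is_derive_eq (dM (is_derive_kerQ_s y s0) (is_derive_phi_shift tT s0))).
  by rewrite mulrN.
- move=> s s0; apply: continuousB; apply: continuousM.
  + exact: kerP_continuous_s.
  + exact: phi_shift_continuous.
  + exact: kerQ_continuous_s.
  + exact: psi_shift_continuous.
- move=> s s0; apply: (is_derive_eq (dD (dZ L (is_derive_kerQ_s y s0)) (dZ M (did s)))).
  by rewrite mulr1.
- move=> s s0; apply: continuousD; last exact: cst_continuous.
  by apply: continuousM; [exact: cst_continuous|exact: kerP_continuous_s].
- have H := cvgM (cvg_kerQ_0 ygt0) (cvg_psi_id tT); rewrite mul0r in H; exact: H.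
- have cQ : L * kerQ s y @[s --> 0^'+] --> L * 0 by apply: cvgMr; exact: cvg_kerQ_0.
  have H := cvgD cQ cMs; rewrite mulr0 addr0 in H; exact: H.
- rewrite (phi0 tT0) mulr0 subr0.
  rewrite RintegralB//; last 2 first.
  + exact: integrable_kerP_phi.
  + exact: integrable_kerQ_psi.
  by move/eqP; rewrite subr_eq0 => /eqP.
Qed.

(** After subtraction of psi t the integrand gains a factor s^b, which makes the
    singularity 1 / s of the kernels integrable uniformly in y. *)
Let eta t s := psi (t - s) - psi t.

Let eta_bound t s : t <= T -> 0 < s -> `|eta t s| <= N * s `^ b.
Proof.
move=> tT s0; apply: le_trans (psi_holder (shift_le tT s0) tT) _.
by rewrite (_ : t - s - t = - s) ?normrN ?gtr0_norm//; ring.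
Qed.

Let meta t : t <= T -> measurable_fun D (eta t).
Proof. by move=> tT; apply: measurable_funB; [exact: mpsi|exact: measurable_cst]. Qed.

Let integrable_kerP_eta t y : t <= T -> 0 <= y -> intD (fun s => kerP s y * eta t s).
Proof.
move=> tT y0.
have [|||//] := @Rintegral_dominated _ D (fun s => kerP s y * eta t s) (fun s => N * s `^ (b - 1)) mD.
- by apply: measurable_funM => //; exact: meta.
- by apply: integrable_cstM => //; have [] := int_powR b0 T0.
- move=> s /DP /andP[s0 _]; rewrite normrM ger0_norm; last exact: kerP_ge0 (ltW s0) y0.
  rewrite powRB; last by rewrite (gt_eqF s0) implybT.
  rewrite powRr1 ?(ltW s0)// (_ : N * (s `^ b / s) = s^-1 * (N * s `^ b)); last by ring.
  by apply: ler_pM; [exact: kerP_ge0 (ltW s0) y0|by []|exact: kerP_le|exact: eta_bound].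
Qed.

Lemma WsolE t y : t <= T -> 0 <= y ->
  Wsol t y = \int[mu]_(s in D) (kerP s y * eta t s) + psi t * kerQ T y.
Proof.
move=> tT y0; rewrite /Wsol; have [->|yN0] := eqVneq y 0.
  under eq_Rintegral do rewrite kerP0 mul0r.
  by rewrite Rintegral_cst// mul0r add0r kerQ0 mulr1.
have ygt0 : 0 < y by rewrite lt_def yN0.
have [iP <-] := integrable_kerP ygt0.
rewrite -RintegralZl// -RintegralD//; last 2 first.
- exact: integrable_kerP_eta.
- exact: integrable_cstM.
by apply: eq_Rintegral => s _; rewrite /eta; ring.
Qed.

(** The kernel is nonnegative with mass at most 1, so the Taylor remainder of
    phi bounds that of the solution. *)
Lemma Vsol_time t t' y : t <= T -> t' <= T -> 0 <= y ->
  `|Vsol t' y - Vsol t y - (t' - t) * Wsol t y| <= N * `|t' - t| `^ (1 + b).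
Proof.
move=> tT t'T y0; rewrite /Vsol /Wsol; have [_|yN0] := eqVneq y 0.
  exact: phi_taylor.
have ygt0 : 0 < y by rewrite lt_def yN0.
have [iP EP] := integrable_kerP ygt0.
have i1 := integrable_kerP_phi t'T ygt0.
have i2 := integrable_kerP_phi tT ygt0.
have i3 := integrable_kerP_psi tT ygt0.
have [i12 E12] := integral_lin 1 (-1) i1 i2.
have [i123 E123] := integral_lin 1 (- (t' - t)) i12 i3.
have {}E123 : \int[mu]_(s in D) (kerP s y * phi (t' - s)) - \int[mu]_(s in D) (kerP s y * phi (t - s)) -
    (t' - t) * \int[mu]_(s in D) (kerP s y * psi (t - s)) =
  \int[mu]_(s in D) (kerP s y * (phi (t' - s) - phi (t - s) - (t' - t) * psi (t - s))).
  transitivity (1 * (1 * \int[mu]_(s in D) (kerP s y * phi (t' - s)) +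
    -1 * \int[mu]_(s in D) (kerP s y * phi (t - s))) +
    - (t' - t) * \int[mu]_(s in D) (kerP s y * psi (t - s))); first by ring.
  by rewrite -E12 -E123; apply: eq_Rintegral => s _; ring.
rewrite E123.
have [|||_ E] := @integral_mul_bounded (kerP ^~ y)
   (fun s => phi (t' - s) - phi (t - s) - (t' - t) * psi (t - s)) (N * `|t' - t| `^ (1 + b)) iP (mkerP y).
- by apply: kerP_ge0'; exact: ltW.
- apply: measurable_funB; first by apply: measurable_funB; exact: mphi.
  by apply: measurable_funM => //; exact: mpsi.
- move=> s /andP[s0 _].
  have := phi_taylor (shift_le tT s0) (shift_le t'T s0).
  by rewrite (_ : t' - s - (t - s) = t' - t)//; ring.
apply: le_trans E _; rewrite ler_piMr ?mulr_ge0 ?powR_ge0// EP.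
exact: kerQ_le1.
Qed.

Lemma Wsol_le (M : R) t y : t <= T -> 0 <= y ->
  (forall r, r <= T -> `|psi r| <= M) -> `|Wsol t y| <= M.
Proof.
move=> tT y0 psiM; rewrite /Wsol; have [_|yN0] := eqVneq y 0; first exact: psiM.
have ygt0 : 0 < y by rewrite lt_def yN0.
have [iP EP] := integrable_kerP ygt0.
have [|||_ E] := @integral_mul_bounded (kerP ^~ y) (fun s => psi (t - s)) M iP (mkerP y).
- by apply: kerP_ge0'; exact: ltW.
- exact: mpsi.
- by move=> s /andP[s0 _]; apply: psiM; exact: shift_le.
apply: le_trans E _; rewrite ler_piMr//.
  by apply: le_trans (psiM _ tT).
by rewrite EP; exact: kerQ_le1.
Qed.

Lemma Wsol_time t t' y : t <= T -> t' <= T -> 0 <= y ->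
  `|Wsol t y - Wsol t' y| <= N * `|t - t'| `^ b.
Proof.
move=> tT t'T y0; rewrite /Wsol; have [_|yN0] := eqVneq y 0; first exact: psi_holder.
have ygt0 : 0 < y by rewrite lt_def yN0.
have [iP EP] := integrable_kerP ygt0.
rewrite -RintegralB//; last 2 first.
- exact: integrable_kerP_psi.
- exact: integrable_kerP_psi.
under eq_Rintegral do rewrite -mulrBr.
have [|||_ E] := @integral_mul_bounded (kerP ^~ y)
   (fun s => psi (t - s) - psi (t' - s)) (N * `|t - t'| `^ b) iP (mkerP y).
- by apply: kerP_ge0'; exact: ltW.
- by apply: measurable_funB; exact: mpsi.
- move=> s /andP[s0 _].
  have := psi_holder (shift_le tT s0) (shift_le t'T s0).
  by rewrite (_ : t - s - (t' - s) = t - t')//; ring.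
apply: le_trans E _; rewrite ler_piMr ?mulr_ge0 ?powR_ge0// EP.
exact: kerQ_le1.
Qed.

Let K := b^-1 + (2^-1 - b)^-1.

Lemma le_powR_min (v x p : R) : 0 <= x -> v <= 1 -> v <= x -> 0 < p -> p <= 1 -> v <= x `^ p.
Proof.
move=> x0 v1 vx p0 p1; have [x1|x1] := leP x 1.
  have [xE|xN0] := eqVneq x 0; first by apply: le_trans vx _; rewrite xE powR_ge0.
  apply: le_trans vx _; apply: ger1_powR => //.
  by rewrite x1 lt_def xN0 x0.
apply: le_trans v1 _; rewrite -[leLHS](powRr0 x); apply: ler_powR; exact: ltW.
Qed.

(** The bound N T^b on psi t compensates exactly the factor T^(-b) in the
    increments of kerQ T of order 2 b. *)
Let psi_kerQ_dist t y z : t <= T -> 0 <= y -> 0 <= z ->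
  `|psi t| * `|kerQ T z - kerQ T y| <= N * `|z - y| `^ (2 * b).
Proof.
move=> tT y0 z0.
have x0 : 0 <= (Num.sqrt T)^-1 * `|z - y| by rewrite mulr_ge0// invr_ge0 sqrtr_ge0.
have : `|kerQ T z - kerQ T y| <= ((Num.sqrt T)^-1 * `|z - y|) `^ (2 * b).
  apply: le_powR_min => //.
  - exact: kerQ_dist'.
  - exact: kerQ_dist.
  - by rewrite mulr_gt0.
  - by move: b12; lra.
move=> H; apply: le_trans (ler_pM _ _ (psi_bound tT) H) _ => //.
rewrite powRM ?invr_ge0 ?sqrtr_ge0// !mulrA ler_wpM2r ?powR_ge0//.
rewrite -mulrA -[leRHS]mulr1 ler_wpM2l// le_eqVlt; apply/orP; left; apply/eqP.
rewrite powRrM powR_mulrn ?invr_ge0 ?sqrtr_ge0// exprVn sqr_sqrtr ?(ltW T0)//.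
by rewrite -powRM ?invr_ge0 ?(ltW T0)// divff ?gt_eqF// powR1.
Qed.

Lemma Wsol_space (t y z : R) : t <= T -> 0 <= y -> 0 <= z ->
  `|Wsol t z - Wsol t y| <= (K + 1) * N * `|z - y| `^ (2 * b).
Proof.
move=> tT y0 z0; have [->|zy] := eqVneq z y.
  by rewrite subrr normr0 !mulr_ge0 ?powR_ge0// addr_ge0// addr_ge0// invr_ge0 ?subr_ge0 ltW.
have d0 : 0 < `|z - y| by rewrite normr_gt0 subr_eq0.
rewrite !WsolE//.
set Iz := \int[mu]_(s in D) _; set Iy := \int[mu]_(s in D) _.
have -> : Iz + psi t * kerQ T z - (Iy + psi t * kerQ T y) =
  (Iz - Iy) + psi t * (kerQ T z - kerQ T y) by ring.
apply: le_trans (ler_normD _ _) _; rewrite -mulrA mulrDl mul1r lerD//; last first.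
  by rewrite normrM; exact: psi_kerQ_dist.
rewrite /Iz /Iy -RintegralB//; last 2 first.
- exact: integrable_kerP_eta.
- exact: integrable_kerP_eta.
under eq_Rintegral do rewrite -mulrBl.
have [|||||_ E] := @increment_bound _ (fun s => kerP s z - kerP s y) (eta t) b 1 N `|z - y| T
  b0 b12 ler01 N0 d0 T0.
- by apply: measurable_funB; exact: mkerP.
- exact: meta.
- by move=> s /andP[s0 _]; rewrite mul1r; exact: kerP_dist'.
- by move=> s /andP[s0 _]; rewrite mul1r; exact: kerP_dist.
- by move=> s /andP[s0 _]; exact: eta_bound.
by apply: le_trans E _; rewrite mul1r [N * _]mulrC mulrA.
Qed.

Let K_ge0 : 0 <= K.
Proof. by rewrite addr_ge0// invr_ge0 ?subr_ge0 ltW. Qed.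

Let integrable_kerG_eta t y : t <= T -> 0 <= y ->
  intD (fun s => kerG s y * eta t s) /\
  Usol t y = - (\int[mu]_(s in D) (kerG s y * eta t s)) - psi t * kerJ T y.
Proof.
move=> tT y0; have [iG EG] := integrable_kerG y0.
have [i E] := integral_lin 1 (- psi t) (integrable_kerG_psi tT y0) iG.
have fE : (fun s => kerG s y * eta t s) = (fun s => 1 * (kerG s y * psi (t - s)) + - psi t * kerG s y).
  by apply/funext => s; rewrite /eta; ring.
rewrite fE; split=> //; rewrite E EG /Usol; ring.
Qed.

(** By the mean value theorem, the Taylor remainders of kerG and kerJ in y are
    |z - y| times an increment of kerP and of kerQ; what remains is the estimate
    of [Wsol_space]. *)
Lemma Usol_space (t y z : R) : t <= T -> 0 <= y -> 0 <= z ->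
  `|Usol t z - Usol t y - (z - y) * Wsol t y| <=
  (K + 1) * N * (`|z - y| * `|z - y| `^ (2 * b)).
Proof.
move=> tT y0 z0; have [->|zy] := eqVneq z y.
  by rewrite !subrr mul0r subrr normr0 mul0r mulr0.
have d0 : 0 < `|z - y| by rewrite normr_gt0 subr_eq0.
have [iz ->] := integrable_kerG_eta tT z0; have [iy ->] := integrable_kerG_eta tT y0.
rewrite WsolE//; have iP := integrable_kerP_eta tT y0.
have [i1 E1] := integral_lin (-1) 1 iz iy.
have [i2 E2] := integral_lin 1 (- (z - y)) i1 iP.
pose k s := - (kerG s z - kerG s y) - (z - y) * kerP s y.
pose r := - (kerJ T z - kerJ T y) - (z - y) * kerQ T y.
have -> : - (\int[mu]_(s in D) (kerG s z * eta t s)) - psi t * kerJ T z -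
    (- (\int[mu]_(s in D) (kerG s y * eta t s)) - psi t * kerJ T y) -
    (z - y) * (\int[mu]_(s in D) (kerP s y * eta t s) + psi t * kerQ T y) =
    \int[mu]_(s in D) (k s * eta t s) + psi t * r.
  transitivity (\int[mu]_(s in D) (1 * (-1 * (kerG s z * eta t s) + 1 * (kerG s y * eta t s)) +
      - (z - y) * (kerP s y * eta t s)) + psi t * r); last first.
    by congr (_ + _); apply: eq_Rintegral => s _; rewrite /k; ring.
  rewrite E2 E1 /r; move: (Rintegral _ _ _) (Rintegral _ _ _) (Rintegral _ _ _) => A B C.
  by ring.
have kE s : 0 < s -> exists2 c, Num.min y z <= c <= Num.max y z &
    k s = (z - y) * (kerP s c - kerP s y).
  move=> s0; have [c cyz E] := mean_value y z (fun x => is_derive_kerG_y x s0).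
  by exists c => //; rewrite /k E; ring.
apply: le_trans (ler_normD _ _) _; rewrite -mulrA mulrDl mul1r lerD//; last first.
  have [c cyz E] := mean_value y z (fun x => is_derive_kerJ_y x T0).
  have -> : r = (z - y) * (kerQ T c - kerQ T y) by rewrite /r E; ring.
  have c0 := between_ge0 y0 z0 cyz.
  rewrite normrM normrM mulrCA [leRHS]mulrCA ler_wpM2l//.
  apply: le_trans (psi_kerQ_dist tT y0 c0) _; rewrite ler_wpM2l//.
  by apply: ge0_ler_powR; rewrite ?nnegrE ?mulr_ge0 ?(ltW b0)//; exact: between_dist.
have [|||||_ E] := @increment_bound _ k (eta t) b `|z - y| N `|z - y| T b0 b12 (ltW d0) N0 d0 T0.
- apply: measurable_funB.
    by apply: measurableT_comp => //; apply: measurable_funB; exact: mkerG.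
  by apply: measurable_funM => //; exact: mkerP.
- exact: meta.
- move=> s /andP[s0 _]; have [c cyz ->] := kE s s0; rewrite normrM ler_wpM2l//.
  by apply: kerP_dist' => //; exact: between_ge0 y0 z0 cyz.
- move=> s /andP[s0 _]; have [c cyz ->] := kE s s0; rewrite normrM ler_wpM2l//.
  apply: le_trans (kerP_dist y c s0) _; rewrite ler_wpM2l//.
    by rewrite invr_ge0 mulr_ge0 ?sqrtr_ge0// ltW.
  exact: between_dist.
- by move=> s /andP[s0 _]; exact: eta_bound.
apply: le_trans E _; rewrite le_eqVlt; apply/orP; left; apply/eqP; rewrite /K; ring.
Qed.

(** Any positive order of the remainder identifies the derivative.  The order
    1/2 comes from min(1, d / sqrt s) <= (d / sqrt s)^(1/2), which leaves the
    integrable singularity s^(-3/4). *)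
Lemma Vsol_space (t y z : R) : t <= T -> 0 <= y -> 0 <= z ->
  `|Vsol t z - Vsol t y - (z - y) * Usol t y| <=
  4 * T `^ 4^-1 * T `^ b * N * (`|z - y| * `|z - y| `^ 2^-1).
Proof.
move=> tT y0 z0; rewrite !VsolE// /Usol.
have [i1 E1] := integral_lin 1 (-1) (integrable_kerQ_psi tT z0) (integrable_kerQ_psi tT y0).
have [i2 E2] := integral_lin 1 (z - y) i1 (integrable_kerG_psi tT y0).
pose k s := kerQ s z - kerQ s y + (z - y) * kerG s y.
have -> : \int[mu]_(s in D) (kerQ s z * psi (t - s)) - \int[mu]_(s in D) (kerQ s y * psi (t - s)) -
    (z - y) * - (\int[mu]_(s in D) (kerG s y * psi (t - s))) =
    \int[mu]_(s in D) (k s * psi (t - s)).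
  transitivity (\int[mu]_(s in D) (1 * (1 * (kerQ s z * psi (t - s)) +
      -1 * (kerQ s y * psi (t - s))) + (z - y) * (kerG s y * psi (t - s)))); last first.
    by apply: eq_Rintegral => s _; rewrite /k; ring.
  rewrite E2 E1; move: (Rintegral _ _ _) (Rintegral _ _ _) (Rintegral _ _ _) => A B C.
  by ring.
set d := `|z - y|; have d_ge0 : 0 <= d by exact: normr_ge0.
have kle s : 0 < s -> `|k s| <= d * d `^ 2^-1 * s `^ (4^-1 - 1).
  move=> s0; have r0 : 0 < Num.sqrt s by rewrite sqrtr_gt0.
  have [c cyz E] := mean_value y z (fun x => is_derive_kerQ_y x s0).
  have c0 := between_ge0 y0 z0 cyz; have cd := between_dist cyz.
  have -> : k s = (z - y) * - (kerG s c - kerG s y) by rewrite /k E; ring.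
  rewrite normrM normrN -/d -mulrA ler_wpM2l//.
  have dr0 : 0 <= d / Num.sqrt s by rewrite divr_ge0// ?normr_ge0// ltW.
  have : `|kerG s c - kerG s y| * Num.sqrt s <= (d / Num.sqrt s) `^ 2^-1.
    apply: le_powR_min => //.
    - by rewrite -ler_pdivlMr// div1r; exact: kerG_dist'.
    - rewrite -ler_pdivlMr//; apply: le_trans (kerG_dist s0 y0 c0) _.
      rewrite -mulrA -invfM -expr2 sqr_sqrtr ?(ltW s0)// mulrC.
      by rewrite ler_wpM2r// invr_ge0 ltW.
    - by rewrite invf_le1// ler1n.
  move=> H; rewrite -ler_pdivlMr// in H; apply: le_trans H _.
  rewrite powRM ?invr_ge0 ?(ltW r0)// -mulrA ler_wpM2l ?powR_ge0// le_eqVlt.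
  apply/orP; left; apply/eqP.
  rewrite -(powR12_sqrt (ltW s0)) -(powR_inv1 (powR_ge0 s 2^-1)) -!powRrM -powRD; last first.
    by rewrite (gt_eqF s0) implybT.
  by congr (_ `^ _); field.
have c4 : 0 < 4^-1 :> R by [].
have [ip Ep] := int_powR c4 T0.
pose c := d * d `^ 2^-1 * (N * T `^ b).
have [|||_ E] := @Rintegral_dominated _ D (fun s => k s * psi (t - s))
   (fun s => c * s `^ (4^-1 - 1)) mD.
- apply: measurable_funM; last exact: mpsi.
  apply: measurable_funD; first by apply: measurable_funB; exact: mkerQ.
  by apply: measurable_funM => //; exact: mkerG.
- exact: integrable_cstM.
- move=> s /DP /andP[s0 _]; rewrite normrM /c mulrAC; apply: ler_pM => //; first exact: kle.
  by apply: psi_bound; exact: shift_le.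
apply: le_trans E _; rewrite RintegralZl// Ep le_eqVlt; apply/orP; left; apply/eqP.
by rewrite /c invrK; ring.
Qed.

End scalar_problem.

(** * Extension of scalar data to negative times *)

Section scalar_extension.
Context {R : realType}.
Variables (T b N : R) (f g : R -> R).
Hypotheses (T0 : 0 < T) (b0 : 0 < b) (N0 : 0 <= N) (f0 : f 0 = 0) (g0 : g 0 = 0).
Hypothesis g_holder : forall s r, 0 <= s <= T -> 0 <= r <= T ->
  `|g s - g r| <= N * `|s - r| `^ b.
Hypothesis f_deriv : forall x, 0 <= x <= T -> forall e : R, 0 < e ->
  exists2 delta : R, 0 < delta & forall s, 0 <= s <= T -> `|x - s| < delta ->
    `|f s - f x - (s - x) * g x| <= e * `|s - x|.

Definition ext0 (u : R -> R) r := if r <= 0 then 0 else u r.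

Lemma ext0_le0 u r : r <= 0 -> ext0 u r = 0.
Proof. by rewrite /ext0 => ->. Qed.

Lemma ext0_ge0 u r : u 0 = 0 -> 0 <= r -> ext0 u r = u r.
Proof.
move=> u0; rewrite /ext0 le_eqVlt => /predU1P[<-|r0]; first by rewrite lexx u0.
by rewrite leNgt r0.
Qed.

Let f_taylor_pos r r' : 0 <= r <= T -> 0 <= r' <= T ->
  `|f r' - f r - (r' - r) * g r| <= N * `|r' - r| `^ (1 + b).
Proof.
move=> rT r'T.
have fd (x : R) : 0 < x < T -> is_derive x 1 f (g x).
  move=> /andP[x0 xT].
  have H : (fun h => h^-1 *: ((f \o shift x) (h *: (1 : R)) - f x)) @ (0 : R)^' --> g x.
    apply/cvgrPdist_le => e e0.
    have [|delta d0 dP] := @f_deriv x _ e e0; first by rewrite !ltW.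
    near=> h.
    have hN0 : h != 0 by near: h; exact: nbhs_dnbhs_neq.
    have hd : `|h| <= delta / 2 by near: h; apply: dnbhs0_le; rewrite divr_gt0.
    have hT : `|h| <= T - x by near: h; apply: dnbhs0_le; rewrite subr_gt0.
    have hx : `|h| <= x by near: h; apply: dnbhs0_le.
    have hxT : 0 <= h + x <= T.
      rewrite -lerBrDr (le_trans (ler_norm _) hT) andbT.
      by move: hx; rewrite ler_norml => /andP[+ _]; rewrite -subr_ge0 opprK addrC.
    have {}hd : `|x - (h + x)| < delta.
      rewrite (_ : x - (h + x) = - h); last by ring.
      by rewrite normrN; apply: le_lt_trans hd _; rewrite ltr_pdivrMr// ltr_pMr// ltr1n.
    have := dP _ hxT hd; rewrite addrK => E.
    rewrite /= /GRing.scale/= mulr1.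
    have -> : g x - h^-1 * (f (h + x) - f x) = - (h^-1 * (f (h + x) - f x - h * g x)) by field.
    rewrite normrN normrM normfV.
    have h0 : 0 < `|h| by rewrite normr_gt0.
    by rewrite mulrC ler_pdivrMr.
  apply: DeriveDef; first exact: cvgP H.
  exact: cvg_lim H.
have cf : {within `[0, T], continuous f}.
  apply: within_continuousP => x /=; rewrite in_itv/= => xT e e0.
  have [delta d0 dP] := f_deriv xT ltr01.
  have gx0 : 0 < `|g x| + 1 by rewrite ltr_wpDl.
  exists (Num.min delta (e / (`|g x| + 1))); first by rewrite lt_min d0 divr_gt0.
  move=> s /=; rewrite in_itv/= lt_min => sT0 /andP[xd xe].
  have := dP s sT0 xd; rewrite mul1r => E.
  rewrite distrC (_ : f s - f x = (f s - f x - (s - x) * g x) + (s - x) * g x); last by ring.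
  apply: le_trans (ler_normD _ _) _; rewrite normrM.
  apply: (@le_trans _ _ ((`|g x| + 1) * `|s - x|)); first
    by rewrite [leRHS]mulrDl mul1r addrC lerD// mulrC.
  by rewrite mulrC -ler_pdivlMr// distrC ltW.
have main (x y : R) : x < y -> 0 <= x -> y <= T -> exists2 c, x < c < y & f y - f x = g c * (y - x).
  move=> xy x0 yT.
  have [z|//|c cxy E] := @MVT R f g x y xy.
  - rewrite in_itv/= => /andP[xz zy]; apply: fd.
    by rewrite (le_lt_trans x0 xz) (lt_le_trans zy yT).
  - apply: continuous_subspaceW cf => z /=; rewrite !in_itv/= => /andP[xz zy].
    by rewrite (le_trans x0 xz) (le_trans zy yT).
  - by exists c => //; move: cxy; rewrite in_itv.
have core c : 0 <= c <= T -> `|c - r| <= `|r' - r| -> f r' - f r = g c * (r' - r) ->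
    `|f r' - f r - (r' - r) * g r| <= N * `|r' - r| `^ (1 + b).
  move=> cT cr ->.
  rewrite (_ : _ - _ = (r' - r) * (g c - g r)); last by ring.
  rewrite normrM powRD ?powRr1//; last by rewrite gt_eqF//= addr_gt0.
  rewrite mulrCA ler_wpM2l//; apply: le_trans (g_holder cT rT) _.
  by rewrite ler_wpM2l//; apply: ge0_ler_powR; rewrite ?nnegrE ?(ltW b0).
have [r0 rT1] := andP rT; have [r'0 r'T1] := andP r'T.
have [lt|gt|<-] := ltgtP r r'; last first.
- by rewrite !subrr mul0r subr0 normr0 mulr_ge0// powR_ge0.
- have [c /andP[rc cr] E] := main _ _ gt r'0 rT1.
  apply: (core c).
  + by rewrite (ltW (le_lt_trans r'0 rc)) (ltW (lt_le_trans cr rT1)).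
  + by rewrite !(distrC _ r) !gtr0_norm ?subr_gt0// lerB// ltW.
  + by rewrite -opprB E -mulrN opprB.
- have [c /andP[rc cr] E] := main _ _ lt r0 r'T1.
  apply: (core c) => //.
  + by rewrite (ltW (le_lt_trans r0 rc)) (ltW (lt_le_trans cr r'T1)).
  + by rewrite !gtr0_norm ?subr_gt0// lerB// ltW.
Unshelve. all: by end_near. Qed.

(** On [0, T] the mean value theorem reduces the remainder to an increment
    of g.  When r and r' have opposite signs the remainder splits at 0, where f
    and g vanish, and the two lengths add up to |r' - r|. *)
Lemma ext0_taylor r r' : r <= T -> r' <= T ->
  `|ext0 f r' - ext0 f r - (r' - r) * ext0 g r| <= N * `|r' - r| `^ (1 + b).
Proof.
move=> rT r'T.
have powS (x : R) : 0 <= x -> x `^ (1 + b) = x * x `^ b.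
  by move=> x0; rewrite powRD ?powRr1// gt_eqF//= addr_gt0.
have [r0|r0] := leP r 0.
  rewrite (ext0_le0 f r0) (ext0_le0 g r0) mulr0 !subr0.
  have [r'0|r'0] := leP r' 0.
    by rewrite (ext0_le0 f r'0) normr0 mulr_ge0// powR_ge0.
  rewrite ext0_ge0// ?(ltW r'0)//.
  have := @f_taylor_pos 0 r'; rewrite f0 g0 mulr0 !subr0 lexx (ltW T0) (ltW r'0) r'T.
  move=> /(_ isT isT) H; apply: le_trans H _; rewrite ler_wpM2l//.
  apply: ge0_ler_powR; rewrite ?nnegrE ?addr_ge0 ?(ltW b0)// gtr0_norm//.
  rewrite ger0_norm; first by rewrite lerBrDr gerDl.
  by rewrite subr_ge0 (le_trans r0)// ltW.
rewrite [ext0 f r]ext0_ge0 ?(ltW r0)// [ext0 g r]ext0_ge0 ?(ltW r0)//.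
have [r'0|r'0] := leP r' 0; last first.
  by rewrite ext0_ge0 ?(ltW r'0)//; apply: f_taylor_pos; rewrite ?(ltW r0) ?(ltW r'0).
rewrite (ext0_le0 f r'0).
have rT' : 0 <= r <= T by rewrite (ltW r0).
have t0 : (0 : R) <= 0 <= T by rewrite lexx ltW.
have H1 := f_taylor_pos rT' t0; have H2 := g_holder rT' t0.
rewrite f0 !sub0r normrN (gtr0_norm r0) in H1.
rewrite g0 !subr0 (gtr0_norm r0) in H2.
have -> : 0 - f r - (r' - r) * g r = (- f r - - r * g r) - r' * g r by ring.
apply: le_trans (ler_normB _ _) _; rewrite normrM.
have -> : `|r' - r| = r + `|r'|.
  by rewrite distrC (ler0_norm r'0) ger0_norm// subr_ge0 (le_trans r'0 (ltW r0)).
have rp : 0 <= r + `|r'| by rewrite addr_ge0// ltW.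
rewrite powS// mulrDl mulrDr lerD//.
  apply: le_trans H1 _; rewrite powS ?(ltW r0)// !ler_wpM2l ?(ltW r0)//.
  by apply: ge0_ler_powR; rewrite ?nnegrE ?(ltW b0) ?(ltW r0)// lerDl.
apply: (@le_trans _ _ (`|r'| * (N * r `^ b))); first by rewrite ler_wpM2l.
rewrite mulrCA !ler_wpM2l//.
by apply: ge0_ler_powR; rewrite ?nnegrE ?(ltW b0) ?(ltW r0)// lerDl.
Qed.

Lemma ext0_holder r r' : r <= T -> r' <= T ->
  `|ext0 g r - ext0 g r'| <= N * `|r - r'| `^ b.
Proof.
wlog rr' : r r' / r <= r'.
  move=> H rT r'T; have [|/ltW] := leP r r'; first by move=> rr'; exact: H.
  by move=> r'r; rewrite distrC (distrC r); exact: H.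
move=> rT r'T; have [r'0|r'0] := leP r' 0.
  rewrite !ext0_le0//; last exact: le_trans r'0.
  by rewrite subrr normr0 mulr_ge0// powR_ge0.
have r'T' : 0 <= r' <= T by rewrite (ltW r'0).
rewrite [ext0 g r']ext0_ge0 ?(ltW r'0)//.
have [r0|r0] := leP r 0; last first.
  by rewrite ext0_ge0 ?(ltW r0)//; apply: g_holder => //; rewrite (ltW r0).
rewrite ext0_le0//.
have := @g_holder 0 r'; rewrite g0 lexx (ltW T0) => /(_ isT r'T') H.
apply: le_trans H _; rewrite ler_wpM2l//.
apply: ge0_ler_powR; rewrite ?nnegrE ?(ltW b0)// !sub0r normrN gtr0_norm// distrC.
by rewrite ger0_norm ?subr_ge0// lerBrDr gerDl.
Qed.

End scalar_extension.

(** * The Poisson kernel up to s = 0 *)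

Section poisson_modulus.
Context {R : realType}.

(** Heine's theorem, in the form of a near covering of the segment. *)
Lemma uniformly_continuous_segment (t : R) (k : R -> R) :
  (forall x, 0 <= x <= t -> forall e : R, 0 < e -> exists2 delta : R, 0 < delta &
    forall r, 0 <= r <= t -> `|x - r| < delta -> `|k x - k r| <= e) ->
  forall e : R, 0 < e -> exists2 delta : R, 0 < delta &
    forall s r, 0 <= s <= t -> 0 <= r <= t -> `|s - r| < delta -> `|k s - k r| <= e.
Proof.
move=> kc e e0.
pose Q (delta s : R) := 0 <= s <= t -> forall r, 0 <= r <= t -> `|s - r| < delta -> `|k s - k r| <= e.
have : near_covering (`[0, t]%classic : set R) by apply/compact_near_coveringP; exact: segment_compact.
move=> /(_ R (0 : R)^'+ Q _); case.
  move=> x; rewrite /= in_itv/= => xt.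
  have e2 : 0 < e / 2 by rewrite divr_gt0.
  have [d d0 dP] := kc x xt (e / 2) e2.
  have d2 : 0 < d / 2 by rewrite divr_gt0.
  exists (ball x (d / 2), [set z : R | 0 < z < d / 2]); first split => /=.
  - exact: nbhsx_ballx.
  - by near=> z; apply/andP; split; near: z; [exact: nbhs_right_gt|exact: nbhs_right_lt].
  - move=> [s delta] /= [xs /andP[_ dd]] st r rt sr.
    have xs' : `|x - s| < d.
      by apply: lt_trans xs _; rewrite ltr_pdivrMr// ltr_pMr// ltr1n.
    have xr : `|x - r| < d.
      rewrite (_ : x - r = (x - s) + (s - r)); last by ring.
      apply: le_lt_trans (ler_normD _ _) _; rewrite [d]splitr ltrD//; exact: lt_trans dd.
    rewrite (_ : k s - k r = (k x - k r) - (k x - k s)); last by ring.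
    by apply: le_trans (ler_normB _ _) _; rewrite [e]splitr lerD// dP.
move=> d /= d0 dP; exists (d / 2); first by rewrite divr_gt0.
move=> s r st rt sr; apply: (dP (d / 2)) => //=.
- by rewrite sub0r normrN gtr0_norm ?divr_gt0// ltr_pdivrMr// ltr_pMr// ltr1n.
- by rewrite divr_gt0.
Unshelve. all: by end_near. Qed.

(** From exp w >= w^2 / 4 for w = y^2 / (4 s); any bound that tends to 0 with s
    would do to make the kernel continuous at s = 0. *)
Lemma kerP_sqrt_bound (s y : R) : 0 < s -> 0 < y -> kerP s y <= 32 / y ^+ 3 * Num.sqrt s.
Proof.
move=> s0 y0; rewrite /kerP /heat_exp expRN.
have [r r0 [-> ->]] := sqr_sqrt s0.
pose p : R := Num.sqrt pi; rewrite -/p.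
have p1 : 1 <= p.
  by rewrite -[1]sqrtr1 ler_sqrt ?pi_ge0// (le_trans _ (pi_ge2 R))// ler1n.
have p0 : 0 < p by apply: lt_le_trans p1.
set w := y ^+ 2 / (4 * r ^+ 2).
have w0 : 0 < w by rewrite divr_gt0 ?exprn_gt0// mulr_gt0// exprn_gt0.
(* Square of 1 + w / 2 <= exp (w / 2). *)
have ww : w ^+ 2 / 4 <= expR w.
  have -> : expR w = expR (w / 2) ^+ 2 by rewrite expr2 -expRD; congr expR; field.
  have -> : w ^+ 2 / 4 = (w / 2) ^+ 2 by field.
  have w2 : 0 <= w / 2 by rewrite mulr_ge0// ltW.
  rewrite ler_sqr ?nnegrE ?expR_ge0//.
  by apply: le_trans (expR_ge1Dx _); rewrite lerDr.
have w4 : 0 < w ^+ 2 / 4 by rewrite divr_gt0// exprn_gt0.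
apply: (@le_trans _ _ (y * (w ^+ 2 / 4)^-1 / (2 * p * (r ^+ 2 * r)))).
  rewrite ler_wpM2r ?invr_ge0 ?mulr_ge0 ?exprn_ge0 ?(ltW p0) ?(ltW r0)//.
  by rewrite ler_wpM2l ?(ltW y0)// lef_pV2 ?posrE// expR_gt0.
have -> : y * (w ^+ 2 / 4)^-1 / (2 * p * (r ^+ 2 * r)) = 32 / y ^+ 3 * r * p^-1.
  by rewrite /w; field; rewrite !gt_eqF.
by rewrite ler_piMr ?invf_le1// mulr_ge0 ?divr_ge0 ?exprn_ge0// ltW.
Qed.

Lemma poisson_kernel0 y : poisson_kernel (0 : R) y = 0.
Proof. by rewrite /poisson_kernel powR0 ?gt_eqF ?divr_gt0// mulr0 invr0 mulr0 mul0r. Qed.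

Lemma poisson_kernel_modulus (t y : R) : 0 < y ->
  forall e : R, 0 < e -> exists2 delta : R, 0 < delta &
    forall s r, 0 <= s <= t -> 0 <= r <= t -> `|s - r| < delta ->
      `|poisson_kernel s y - poisson_kernel r y| <= e.
Proof.
move=> y0; apply: uniformly_continuous_segment => x /andP[x0 xt] e e0.
have [xE|xN0] := eqVneq x 0.
  pose c := 32 / y ^+ 3.
  have c0 : 0 < c by rewrite divr_gt0// exprn_gt0.
  exists ((e / c) ^+ 2); first by rewrite exprn_gt0// divr_gt0.
  move=> r /andP[r0 _]; rewrite xE poisson_kernel0 !sub0r !normrN (ger0_norm r0) => rd.
  have [->|rN0] := eqVneq r 0; first by rewrite poisson_kernel0 normr0 ltW.
  have rgt0 : 0 < r by rewrite lt_def rN0.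
  rewrite poisson_kernelE// ger0_norm ?kerP_ge0 ?(ltW y0)//.
  apply: le_trans (kerP_sqrt_bound rgt0 y0) _.
  rewrite -/c mulrC -ler_pdivlMr//.
  have -> : e / c = Num.sqrt ((e / c) ^+ 2) by rewrite sqrtr_sqr gtr0_norm// divr_gt0.
  by rewrite ler_sqrt ?sqr_ge0// ltW.
have xgt0 : 0 < x by rewrite lt_def xN0.
have : \forall r \near x, `|poisson_kernel x y - poisson_kernel r y| <= e.
  have /cvgrPdist_le /(_ e e0) H := @kerP_continuous_s R x y xgt0.
  near=> r; rewrite !poisson_kernelE//; first by near: r; exact: H.
  by near: r; exact: lt_nbhsr.
move=> [d /= d0 dP]; exists d => // r _ xr; exact: dP.
Unshelve. all: by end_near. Qed.

Lemma poisson_kernel_bound (t s y : R) : 0 < y -> 0 <= s <= t ->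
  0 <= poisson_kernel s y <= 32 / y ^+ 3 * Num.sqrt t.
Proof.
move=> y0 /andP[s0 st].
have c0 : 0 <= 32 / y ^+ 3 by rewrite divr_ge0// exprn_ge0// ltW.
have [->|sN0] := eqVneq s 0; first by rewrite poisson_kernel0 lexx mulr_ge0// sqrtr_ge0.
have sgt0 : 0 < s by rewrite lt_def sN0.
rewrite poisson_kernelE// kerP_ge0 ?(ltW y0)//=.
apply: le_trans (kerP_sqrt_bound sgt0 y0) _; rewrite ler_wpM2l// ler_sqrt//.
exact: le_trans st.
Qed.

End poisson_modulus.

(** * From scalar estimates to derivatives in L^gamma *)

Section weak_derivatives.
Context {d : measure_display} {Omega : measurableType d} {R : realType}.
Variables (P : probability Omega R) (gamma : R).
Hypothesis gamma2 : 2 <= gamma.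
Local Notation Nm := (Lgnorm P gamma).
Local Notation Lg := (Lfun P gamma%:E).
Local Notation ball := (dual_ball P gamma).

Lemma powR_small (C p e : R) : 0 <= C -> 0 < p -> 0 < e ->
  exists2 delta : R, 0 < delta & forall x, 0 <= x -> x <= delta -> C * x `^ p <= e.
Proof.
move=> C0 p0 e0; pose c := e / (C + 1).
have C1 : 0 < C + 1 by rewrite ltr_wpDl.
have c0 : 0 < c by rewrite divr_gt0.
exists (c `^ p^-1); first exact: powR_gt0.
move=> h h0 hd; have : h `^ p <= c.
  rewrite -[leRHS](powRr1 (ltW c0)) -(mulVf (lt0r_neq0 p0)) powRrM.
  by apply: ge0_ler_powR; rewrite ?nnegrE ?powR_ge0 ?(ltW p0).
move=> hc; apply: (@le_trans _ _ (C * c)); first by rewrite ler_wpM2l.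
by rewrite /c mulrA ler_pdivrMr// mulrC ler_pM2l// lerDl.
Qed.

Lemma quotient_bound (C p a b c x : R) : x != 0 ->
  `|a - b - x * c| <= C * (`|x| * `|x| `^ p) -> `|x^-1 * (a - b) - c| <= C * `|x| `^ p.
Proof.
move=> x0 H; have ax : 0 < `|x| by rewrite normr_gt0.
rewrite (_ : x^-1 * (a - b) - c = x^-1 * (a - b - x * c)); last by field.
by rewrite normrM normfV mulrC ler_pdivrMr// -mulrA [_ * `|x|]mulrC.
Qed.

Lemma pairing_quotient (x : R) (X Y : Omega -> R) Z : X \in Lg -> Y \in Lg -> ball Z ->
  pairing P (x *: (X \- Y)) Z = x * (pairing P X Z - pairing P Y Z).
Proof. by move=> XL YL ZB; rewrite (pairingZ gamma2) ?(pairingB gamma2)//; exact: LfunB. Qed.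

(** If the pairings of f are differentiable at x with remainders uniform over the
    dual ball, then its difference quotients are the approximations that
    [exists_weak_limit] asks for. *)
Lemma weak_derivative_exists (D : set R) (f : R -> Omega -> R) (x C p : R)
    (l : (Omega -> R) -> R) : 0 <= C -> 0 < p -> D x ->
  (forall s, D s -> f s \in Lg) ->
  (forall delta : R, 0 < delta -> exists s, [/\ D s, s != x & `|s - x| <= delta]) ->
  (forall s Z, D s -> ball Z ->
    `|pairing P (f s) Z - pairing P (f x) Z - (s - x) * l Z| <= C * (`|s - x| * `|s - x| `^ p)) ->
  exists2 X, X \in Lg & forall Z, ball Z -> pairing P X Z = l Z.
Proof.
move=> C0 p0 Dx fL near_x H; apply: exists_weak_limit => // e e0.
have [delta d0 dP] := powR_small C0 p0 e0.
have [s [Ds sx sd]] := near_x delta d0.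
exists ((s - x)^-1 *: (f s \- f x)).
  by apply: LfunZ => //; apply: LfunB => //; exact: fL.
move=> Z ZB; rewrite pairing_quotient ?fL//.
apply: le_trans (quotient_bound _ (H s Z Ds ZB)) _; first by rewrite subr_eq0.
exact: dP.
Qed.

(** The uniform remainders bound, by the converse of Hölder's inequality, the
    distance in norm from the difference quotient to the derivative. *)
Lemma weak_is_derivative_on (D : set R) (f f' : R -> Omega -> R) (C p : R) :
  0 <= C -> 0 < p ->
  (forall s, D s -> f s \in Lg) -> (forall s, D s -> f' s \in Lg) ->
  (forall s x Z, D s -> D x -> ball Z ->
    `|pairing P (f s) Z - pairing P (f x) Z - (s - x) * pairing P (f' x) Z| <=
    C * (`|s - x| * `|s - x| `^ p)) ->
  is_derivative_on P gamma D f f'.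
Proof.
move=> C0 p0 fL f'L H x Dx; split; first exact: f'L.
have bound s : D s -> s != x ->
    (Nm ((s - x)^-1 *: (f s \- f x) \- f' x)%R <= (C * `|s - x| `^ p)%:E)%E.
  move=> Ds sx; have qL : (s - x)^-1 *: (f s \- f x) \in Lg.
    by apply: LfunZ => //; apply: LfunB => //; exact: fL.
  apply: (Lgnorm_le_dual gamma2); first by apply: LfunB => //; exact: f'L.
  move=> Z ZB; rewrite (pairingB gamma2) ?f'L// pairing_quotient ?fL//.
  by apply: quotient_bound; rewrite ?subr_eq0//; exact: H.
apply: (@cvge0_squeeze _ _ _ _ _ (fun s => C * `|s - x| `^ p)).
- by move=> s; exact: Lgnorm_ge0.
- have : \forall s \near x, s != x -> D s ->
    (Nm ((s - x)^-1 *: (f s \- f x) \- f' x)%R <= (C * `|s - x| `^ p)%:E)%E.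
    by apply: filterS (nbhsx_ballx x (1 : R) ltr01) => s _ sx Ds; exact: bound.
  by [].
- apply/cvgrPdist_le => e e0.
  have [delta d0 dP] := powR_small C0 p0 e0.
  have : \forall s \near x, s != x -> D s -> `|0 - C * `|s - x| `^ p| <= e.
    apply: filterS (nbhsx_ballx x delta d0) => s xs _ _.
    rewrite sub0r normrN ger0_norm ?mulr_ge0 ?powR_ge0//; apply: dP => //.
    by rewrite distrC ltW.
  by [].
Qed.

End weak_derivatives.

Section extended_pairing.
Context {d : measure_display} {Omega : measurableType d} {R : realType}.
Variable P : probability Omega R.

Definition ext_pairing (h : R -> Omega -> R) Z : R -> R := ext0 (fun r => pairing P (h r) Z).

Lemma ext_pairing_le0 h Z r : r <= 0 -> ext_pairing h Z r = 0.
Proof. exact: ext0_le0. Qed.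

End extended_pairing.

Section vector_problem.
Context {d : measure_display} {Omega : measurableType d} {R : realType}.
Variables (P : probability Omega R) (gamma : R).
Hypothesis gamma2 : 2 <= gamma.
Local Notation Nm := (Lgnorm P gamma).
Local Notation Lg := (Lfun P gamma%:E).
Local Notation ball := (dual_ball P gamma).
Local Notation mu := (@lebesgue_measure R).
Variables (T b N : R) (h h' : R -> Omega -> R).
Hypotheses (T0 : 0 < T) (b0 : 0 < b) (b12 : b < 2^-1) (N0 : 0 <= N).
Hypothesis hL : forall t, 0 <= t <= T -> h t \in Lg.
Hypothesis hd : is_derivative_on P gamma `[0, T] h h'.
Hypothesis h'_holder : forall s r, 0 <= s <= T -> 0 <= r <= T -> s != r ->
  (Nm (h' s \- h' r)%R <= (N * `|s - r| `^ b)%:E)%E.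
Hypothesis h0 : h 0 = cst 0 %[ae P].
Hypothesis h'0 : h' 0 = cst 0 %[ae P].

Let zeroT : (0 : R) <= 0 <= T. Proof. by rewrite lexx ltW. Qed.

Lemma h'L t : 0 <= t <= T -> h' t \in Lg.
Proof. by move=> tT; have [] := hd (x := t) tT. Qed.

Let f Z r := pairing P (h r) Z.
Let g Z r := pairing P (h' r) Z.
Local Notation phiZ := (ext_pairing P h).
Local Notation psiZ := (ext_pairing P h').

Let f0 Z : ball Z -> f Z 0 = 0.
Proof.
by move=> [mZ _]; apply: pairing_ae0 => //; apply: Lfun_measurable; exact: hL.
Qed.

Let g0 Z : ball Z -> g Z 0 = 0.
Proof.
by move=> [mZ _]; apply: pairing_ae0 => //; apply: Lfun_measurable; exact: h'L.
Qed.

Let g_holder Z : ball Z -> forall s r, 0 <= s <= T -> 0 <= r <= T ->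
  `|g Z s - g Z r| <= N * `|s - r| `^ b.
Proof.
move=> ZB s r sT rT; have [->|sr] := eqVneq s r.
  by rewrite subrr normr0 mulr_ge0// powR_ge0.
rewrite /g -(pairingB gamma2) ?h'L//; apply: (pairing_le gamma2) => //.
  by apply: LfunB => //; exact: h'L.
exact: h'_holder.
Qed.

Let f_deriv Z : ball Z -> forall x, 0 <= x <= T -> forall e : R, 0 < e ->
  exists2 delta : R, 0 < delta & forall s, 0 <= s <= T -> `|x - s| < delta ->
    `|f Z s - f Z x - (s - x) * g Z x| <= e * `|s - x|.
Proof.
move=> ZB x xT e e0; have [h'xL cv] := hd (x := x) xT.
have H : \forall s \near x, s != x -> (`[0, T]%classic : set R) s ->
  (Nm ((s - x)^-1 *: (h s \- h x) \- h' x)%R <= e%:E)%E by exact: (cvge0_le cv e0).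
have [delta /= d0 dP] := H; exists delta => // s sT xs.
have [->|sx] := eqVneq s x; first by rewrite !subrr mul0r subrr normr0 mulr0.
have := dP s xs sx sT => E.
have qL : (s - x)^-1 *: (h s \- h x) \in Lg.
  by apply: LfunZ => //; apply: LfunB => //; exact: hL.
have := pairing_le gamma2 (LfunB gamma2 qL h'xL) ZB E.
rewrite (pairingB gamma2)// (pairing_quotient gamma2) ?hL// -/(f Z s) -/(f Z x) -/(g Z x).
have x0 : s - x != 0 by rewrite subr_eq0.
rewrite (_ : (s - x)^-1 * (f Z s - f Z x) - g Z x =
  (s - x)^-1 * (f Z s - f Z x - (s - x) * g Z x)); last by field.
by rewrite normrM normfV mulrC ler_pdivrMr// normr_gt0.
Qed.

Let phiZE Z r : ball Z -> 0 <= r -> phiZ Z r = pairing P (h r) Z.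
Proof. by move=> ZB r0; exact: ext0_ge0 (f0 ZB) r0. Qed.

Lemma ext_pairing_holder Z : ball Z -> forall r r', r <= T -> r' <= T ->
  `|psiZ Z r - psiZ Z r'| <= N * `|r - r'| `^ b.
Proof. by move=> ZB; exact: ext0_holder T0 b0 N0 (g0 ZB) (g_holder ZB). Qed.

Lemma ext_pairing_taylor Z : ball Z -> forall r r', r <= T -> r' <= T ->
  `|phiZ Z r' - phiZ Z r - (r' - r) * psiZ Z r| <= N * `|r' - r| `^ (1 + b).
Proof.
by move=> ZB; exact: ext0_taylor T0 b0 N0 (f0 ZB) (g0 ZB) (g_holder ZB) (f_deriv ZB).
Qed.

Let v := half_line_solution P gamma h.

Let L := N * T `^ (1 + b).
Let L' := 2 * (N * T `^ b).

Let phiZ_bound Z r : ball Z -> r <= T -> `|phiZ Z r| <= L.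
Proof.
move=> ZB rT; exact: (phi_bound T0 b0 N0 (@ext_pairing_le0 _ _ _ P h Z)
  (@ext_pairing_le0 _ _ _ P h' Z) (ext_pairing_taylor ZB) rT).
Qed.

Let phiZ_lip Z r r' : ball Z -> 0 <= r <= T -> 0 <= r' <= T ->
  `|phiZ Z r' - phiZ Z r| <= L' * `|r' - r|.
Proof.
move=> ZB /andP[r0 rT] /andP[r'0 r'T].
have H := ext_pairing_taylor ZB rT r'T.
have H' : `|psiZ Z r| <= N * T `^ b.
  exact: (psi_bound T0 b0 N0 (@ext_pairing_le0 _ _ _ P h' Z) (ext_pairing_holder ZB) rT).
rewrite (_ : _ - _ = phiZ Z r' - phiZ Z r - (r' - r) * psiZ Z r + (r' - r) * psiZ Z r); last by ring.
apply: le_trans (ler_normD _ _) _.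
rewrite (_ : L' * _ = N * T `^ b * `|r' - r| + N * T `^ b * `|r' - r|); last by rewrite /L'; ring.
rewrite lerD//; last first.
  by rewrite normrM mulrC ler_wpM2r.
apply: le_trans H _; rewrite powRD ?powRr1//; last by rewrite gt_eqF//= addr_gt0.
rewrite -mulrA ler_wpM2l// mulrC ler_wpM2r//.
apply: ge0_ler_powR; rewrite ?nnegrE ?(ltW b0) ?(ltW T0)//.
by rewrite ler_norml; apply/andP; split; lra.
Qed.

(** The Poisson kernel is continuous on [0, t] for fixed y > 0 and h is
    Lipschitz, so the integrand is uniformly continuous and the Bochner integral
    exists.  The scalar integral extends from ]0, t] to ]0, T] because the
    extended datum vanishes at negative times. *)
Lemma solution_pairing t y : 0 <= t <= T -> 0 <= y ->
  v t y \in Lg /\ forall Z, ball Z -> pairing P (v t y) Z = Vsol T (phiZ Z) t y.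
Proof.
move=> tT y0; rewrite /v /half_line_solution /Vsol; have [yE|yN0] := eqVneq y 0.
  split; first exact: hL.
  by move=> Z ZB; rewrite phiZE//; case/andP: tT.
have ygt0 : 0 < y by rewrite lt_def yN0.
have [t0 tT1] := andP tT.
have tsT s : 0 <= s <= t -> 0 <= t - s <= T.
  by move=> /andP[s0 st]; rewrite subr_ge0 st lerBlDr (le_trans tT1)// lerDl.
pose k s := poisson_kernel s y.
pose F s := k s *: h (t - s).
have FL s : 0 <= s <= t -> F s \in Lg.
  by move=> st; apply: LfunZ => //; apply: hL; exact: tsT.
have Fpair s Z : ball Z -> 0 <= s <= t -> pairing P (F s) Z = k s * phiZ Z (t - s).
  move=> ZB st; rewrite (pairingZ gamma2)//; last by apply: hL; exact: tsT.
  by rewrite phiZE//; case/andP: (tsT s st).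
have Fmod e : 0 < e -> exists2 delta : R, 0 < delta &
    forall s r, 0 <= s <= t -> 0 <= r <= t -> `|s - r| < delta -> (Nm (F s \- F r)%R <= e%:E)%E.
  (* B bounds the kernel, and L and L' bound the size and the Lipschitz
     constant of the paired datum; each half of e is spent on one factor. *)
  move=> e0; pose B := 32 / y ^+ 3 * Num.sqrt t.
  have L0 : 0 <= L by rewrite mulr_ge0// powR_ge0.
  have L'0 : 0 <= L' by rewrite !mulr_ge0// powR_ge0.
  have B0 : 0 <= B by rewrite mulr_ge0 ?sqrtr_ge0// divr_ge0// exprn_ge0.
  have e1 : 0 < e / 2 / (L + 1) by rewrite !divr_gt0// ltr_wpDl.
  have BL1 : 0 < B * L' + 1 by rewrite ltr_wpDl// mulr_ge0.
  have e2 : 0 < e / 2 / (B * L' + 1) by rewrite !divr_gt0.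
  have [d1 d10 d1P] := @poisson_kernel_modulus R t y ygt0 _ e1.
  exists (Num.min d1 (e / 2 / (B * L' + 1))); first by rewrite lt_min d10 e2.
  move=> s r st rt; rewrite lt_min => /andP[sr1 sr2].
  apply: (Lgnorm_le_dual gamma2); first by apply: LfunB => //; exact: FL.
  move=> Z ZB; rewrite (pairingB gamma2) ?FL// !Fpair//.
  have -> : k s * phiZ Z (t - s) - k r * phiZ Z (t - r) =
    (k s - k r) * phiZ Z (t - s) + k r * (phiZ Z (t - s) - phiZ Z (t - r)) by ring.
  apply: le_trans (ler_normD _ _) _; rewrite [e]splitr lerD//.
    rewrite normrM; apply: (@le_trans _ _ (e / 2 / (L + 1) * L)).
      apply: ler_pM => //; first exact: d1P.
      by apply: phiZ_bound => //; case/andP: (tsT s st).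
    rewrite mulrAC ler_pdivrMr ?ltr_wpDl// ler_pM2l ?divr_gt0// lerDl//.
  rewrite normrM; have /andP[k0 kB] := poisson_kernel_bound ygt0 rt.
  apply: (@le_trans _ _ (B * (L' * `|s - r|))).
    apply: ler_pM => //; first by rewrite ger0_norm.
    apply: le_trans (phiZ_lip ZB (tsT r rt) (tsT s st)) _.
    by rewrite (_ : t - s - (t - r) = r - s) 1?distrC//; ring.
  rewrite mulrA; apply: (@le_trans _ _ ((B * L' + 1) * `|s - r|)).
    by rewrite ler_wpM2r// lerDl.
  by rewrite mulrC -ler_pdivlMr// ltW.
have [IL IP] := bochner_integralP gamma2 t0 FL Fmod.
split => // Z ZB; rewrite IP//.
have i0T : mu.-integrable (`]0, T]%classic : set R) (EFin \o (fun s => kerP s y * phiZ Z (t - s))).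
  exact: (integrable_kerP_phi T0 b0 N0 (@ext_pairing_le0 _ _ _ P h Z)
    (@ext_pairing_le0 _ _ _ P h' Z) (ext_pairing_taylor ZB) tT1 ygt0).
have [UE Udisj] := setU_oc t0 tT1.
rewrite UE Rintegral_setU// -?UE//.
have -> : \int[mu]_(s in `]t, T]) (kerP s y * phiZ Z (t - s)) = 0.
  rewrite (@eq_Rintegral _ _ _ _ _ (cst 0)); first by rewrite Rintegral_cst// mul0r.
  move=> s; rewrite inE/= in_itv/= => /andP[ts _].
  by rewrite ext_pairing_le0 ?mulr0// subr_le0 ltW.
rewrite addr0 -Rintegral_itv_obnd_cbnd.
  apply: eq_Rintegral => s; rewrite inE/= in_itv/= => /andP[s0 st].
  by rewrite Fpair ?(ltW s0)// /k poisson_kernelE.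
have i0t : mu.-integrable (`]0, t]%classic : set R) (EFin \o (fun s => kerP s y * phiZ Z (t - s))).
  by apply: integrableS i0T => // s /=; rewrite !in_itv/= => /andP[-> st]; exact: le_trans tT1.
apply: eq_integrable i0t => // s; rewrite inE/= in_itv/= => /andP[s0 st].
by rewrite Fpair ?(ltW s0)// /k poisson_kernelE.
Qed.

End vector_problem.

(** * Derivatives of the L^gamma-valued solution *)

Section regular_representation.
Context {d : measure_display} {Omega : measurableType d} {R : realType}.
Variables (P : probability Omega R) (gamma : R).
Hypothesis gamma2 : 2 <= gamma.
Local Notation Nm := (Lgnorm P gamma).
Local Notation Lg := (Lfun P gamma%:E).
Local Notation ball := (dual_ball P gamma).
Variables (T b N : R) (v : R -> R -> Omega -> R) (phi psi : (Omega -> R) -> R -> R).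
Hypotheses (T0 : 0 < T) (b0 : 0 < b) (b12 : b < 2^-1) (N0 : 0 <= N).
Hypothesis phi_le0 : forall Z r, r <= 0 -> phi Z r = 0.
Hypothesis psi_le0 : forall Z r, r <= 0 -> psi Z r = 0.
Hypothesis psi_holder : forall Z, ball Z -> forall r r', r <= T -> r' <= T ->
  `|psi Z r - psi Z r'| <= N * `|r - r'| `^ b.
Hypothesis phi_taylor : forall Z, ball Z -> forall r r', r <= T -> r' <= T ->
  `|phi Z r' - phi Z r - (r' - r) * psi Z r| <= N * `|r' - r| `^ (1 + b).
Hypothesis solution_pairing : forall t y, 0 <= t <= T -> 0 <= y ->
  v t y \in Lg /\ forall Z, ball Z -> pairing P (v t y) Z = Vsol T (phi Z) t y.

Let K := b^-1 + (2^-1 - b)^-1.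

Let K0 : 0 <= K. Proof. by rewrite addr_ge0// invr_ge0 ?subr_ge0 ltW. Qed.

Let time_taylor t t' y Z : 0 <= t <= T -> 0 <= t' <= T -> 0 <= y -> ball Z ->
  `|pairing P (v t' y) Z - pairing P (v t y) Z - (t' - t) * Wsol T (psi Z) t y| <=
  N * (`|t' - t| * `|t' - t| `^ b).
Proof.
move=> tT t'T y0 ZB.
have [_ tT1] := andP tT; have [_ t'T1] := andP t'T.
rewrite (solution_pairing tT y0).2// (solution_pairing t'T y0).2//.
have := Vsol_time T0 b0 N0 (phi_le0 Z) (psi_le0 Z) (psi_holder ZB) (phi_taylor ZB) tT1 t'T1 y0.
by rewrite powRD ?powRr1//; rewrite gt_eqF//= addr_gt0.
Qed.

Let C2 := 4 * T `^ 4^-1 * T `^ b * N.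

Let C20 : 0 <= C2. Proof. by rewrite !mulr_ge0// powR_ge0. Qed.

Let space_taylor t y y' Z : 0 <= t <= T -> 0 <= y -> 0 <= y' -> ball Z ->
  `|pairing P (v t y') Z - pairing P (v t y) Z - (y' - y) * Usol T (psi Z) t y| <=
  C2 * (`|y' - y| * `|y' - y| `^ 2^-1).
Proof.
move=> tT y0 y'0 ZB; have [_ tT1] := andP tT.
rewrite (solution_pairing tT y0).2// (solution_pairing tT y'0).2//.
exact: (Vsol_space T0 b0 N0 (phi_le0 Z) (psi_le0 Z) (psi_holder ZB) (phi_taylor ZB) tT1 y0 y'0).
Qed.

Let DT (s : R) : (`[0, T]%classic : set R) s -> 0 <= s <= T.
Proof. by rewrite /= in_itv. Qed.

Let DY (y : R) : (`[0, +oo[%classic : set R) y -> 0 <= y.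
Proof. by rewrite /= in_itv/= andbT. Qed.

Lemma exists_time_derivative t y : 0 <= t <= T -> 0 <= y ->
  exists2 X, X \in Lg & forall Z, ball Z -> pairing P X Z = Wsol T (psi Z) t y.
Proof.
move=> tT y0; pose D : set R := `[0, T]%classic.
have Dt : D t by rewrite /D/= in_itv.
apply: (@weak_derivative_exists _ _ _ P gamma gamma2 D (v ^~ y) t N b) => //.
- by move=> s /DT sT; have [] := solution_pairing sT y0.
- move=> delta d0; have [t0 tT1] := andP tT.
  have [tltT|] := ltP t T.
    have m0 : 0 < Num.min delta (T - t) by rewrite lt_min d0 subr_gt0.
    exists (t + Num.min delta (T - t)); split.
    + rewrite /D/= in_itv/= addr_ge0 ?(ltW m0)//= addrC -lerBrDr ge_min lexx orbT//.
    + by rewrite gt_eqF// ltrDl.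
    + by rewrite addrAC subrr add0r gtr0_norm// ge_min lexx.
  move=> Tt; have tE : t = T by apply/eqP; rewrite eq_le tT1.
  have m0 : 0 < Num.min delta T by rewrite lt_min d0.
  exists (t - Num.min delta T); split.
  + by rewrite /D/= in_itv/= tE subr_ge0 ge_min lexx orbT/= lerBlDr lerDl ltW.
  + by rewrite lt_eqF// ltrBlDr ltrDl.
  + by rewrite addrAC subrr sub0r normrN gtr0_norm// ge_min lexx.
- by move=> s Z /DT sT ZB; exact: time_taylor.
Qed.

Lemma exists_space_derivative t y : 0 <= t <= T -> 0 <= y ->
  exists2 X, X \in Lg & forall Z, ball Z -> pairing P X Z = Usol T (psi Z) t y.
Proof.
move=> tT y0; pose D : set R := `[0, +oo[%classic.
have Dy : D y by rewrite /D/= in_itv/= andbT.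
have h2 : 0 < 2^-1 :> R by [].
apply: (@weak_derivative_exists _ _ _ P gamma gamma2 D (v t) y C2 2^-1) => //.
- by move=> z /DY z0; have [] := solution_pairing tT z0.
- move=> delta d0; exists (y + delta); split.
  + by rewrite /D/= in_itv/= andbT addr_ge0// ltW.
  + by rewrite gt_eqF// ltrDl.
  + by rewrite addrAC subrr add0r gtr0_norm.
- by move=> z Z /DY z0 ZB; exact: space_taylor.
Qed.

Lemma exists_derivatives : exists u w : R -> R -> Omega -> R,
  (forall t y, 0 <= t <= T -> 0 <= y -> u t y \in Lg /\
    forall Z, ball Z -> pairing P (u t y) Z = Usol T (psi Z) t y) /\
  (forall t y, 0 <= t <= T -> 0 <= y -> w t y \in Lg /\
    forall Z, ball Z -> pairing P (w t y) Z = Wsol T (psi Z) t y).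
Proof.
have /choice[u uP] : forall q : R * R, exists X, 0 <= q.1 <= T -> 0 <= q.2 -> X \in Lg /\
    forall Z, ball Z -> pairing P X Z = Usol T (psi Z) q.1 q.2.
  move=> [t y] /=; have [[tT y0]|nty] := pselect (0 <= t <= T /\ 0 <= y).
    by have [X XL XP] := exists_space_derivative tT y0; exists X.
  by exists (cst 0) => tT y0; case: nty.
have /choice[w wP] : forall q : R * R, exists X, 0 <= q.1 <= T -> 0 <= q.2 -> X \in Lg /\
    forall Z, ball Z -> pairing P X Z = Wsol T (psi Z) q.1 q.2.
  move=> [t y] /=; have [[tT y0]|nty] := pselect (0 <= t <= T /\ 0 <= y).
    by have [X XL XP] := exists_time_derivative tT y0; exists X.
  by exists (cst 0) => tT y0; case: nty.
exists (fun t y => u (t, y)), (fun t y => w (t, y)); split=> t y tT y0.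
- by have := uP (t, y); apply.
- by have := wP (t, y); apply.
Qed.

Section bounds.
Variables (u w : R -> R -> Omega -> R).
Hypothesis uP : forall t y, 0 <= t <= T -> 0 <= y -> u t y \in Lg /\
  forall Z, ball Z -> pairing P (u t y) Z = Usol T (psi Z) t y.
Hypothesis wP : forall t y, 0 <= t <= T -> 0 <= y -> w t y \in Lg /\
  forall Z, ball Z -> pairing P (w t y) Z = Wsol T (psi Z) t y.

Lemma solution_is_dt : is_dt P gamma T v w.
Proof.
move=> y y0; apply: (@weak_is_derivative_on _ _ _ P gamma gamma2 _ (v ^~ y) (w ^~ y) N b) => //.
- by move=> s /DT sT; have [] := solution_pairing sT y0.
- by move=> s /DT sT; have [] := wP sT y0.
- move=> s t Z /DT sT /DT tT ZB; rewrite (wP tT y0).2//; exact: time_taylor.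
Qed.

Lemma solution_is_dy : is_dy P gamma T v u.
Proof.
move=> t tT; have h2 : 0 < 2^-1 :> R by [].
apply: (@weak_is_derivative_on _ _ _ P gamma gamma2 _ (v t) (u t) C2 2^-1) => //.
- by move=> y /DY y0; have [] := solution_pairing tT y0.
- by move=> y /DY y0; have [] := uP tT y0.
- move=> z y Z /DY z0 /DY y0 ZB; rewrite (uP tT y0).2//; exact: space_taylor.
Qed.

Lemma gradient_is_dy : is_dy P gamma T u w.
Proof.
move=> t tT; have b2 : 0 < 2 * b by rewrite mulr_gt0.
have KN0 : 0 <= (K + 1) * N by rewrite mulr_ge0// addr_ge0.
apply: (@weak_is_derivative_on _ _ _ P gamma gamma2 _ (u t) (w t) ((K + 1) * N) (2 * b)) => //.
- by move=> y /DY y0; have [] := uP tT y0.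
- by move=> y /DY y0; have [] := wP tT y0.
- move=> z y Z /DY z0 /DY y0 ZB; rewrite (wP tT y0).2// (uP tT y0).2// (uP tT z0).2//.
  have [_ tT1] := andP tT.
  exact: (Usol_space T0 b0 b12 N0 (psi_le0 Z) (psi_holder ZB) tT1 y0 z0).
Qed.

Lemma w_bound t y : 0 <= t <= T -> 0 <= y -> (Nm (w t y) <= (T `^ b * N)%:E)%E.
Proof.
move=> tT y0; have [wL wE] := wP tT y0; have [_ tT1] := andP tT.
apply: (Lgnorm_le_dual gamma2) => // Z ZB; rewrite wE// mulrC.
apply: (Wsol_le T0 b0 N0 (psi_holder ZB) tT1 y0) => r rT.
exact: (psi_bound T0 b0 N0 (psi_le0 Z) (psi_holder ZB) rT).
Qed.

(** The increment is split at (t, z), into a step in space and a step in time. *)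
Lemma w_holder t y s z : 0 <= t <= T -> 0 <= y -> 0 <= s <= T -> 0 <= z ->
  (Nm (w t y \- w s z)%R <= ((K + 1) * N * (`|y - z| `^ (2 * b) + `|t - s| `^ b))%:E)%E.
Proof.
move=> tT y0 sT z0; have [wL wE] := wP tT y0; have [wL' wE'] := wP sT z0.
have [_ tT1] := andP tT; have [_ sT1] := andP sT.
apply: (Lgnorm_le_dual gamma2); first exact: LfunB.
move=> Z ZB; rewrite (pairingB gamma2)// wE// wE'//.
set W := Wsol T (psi Z).
have -> : W t y - W s z = (W t y - W t z) + (W t z - W s z) by ring.
apply: le_trans (ler_normD _ _) _; rewrite mulrDr lerD//.
  exact: (Wsol_space T0 b0 b12 N0 (psi_le0 Z) (psi_holder ZB) tT1 z0 y0).
apply: le_trans (Wsol_time T0 b0 N0 (psi_le0 Z) (psi_holder ZB) tT1 sT1 z0) _.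
by rewrite mulrDl mul1r mulrDl lerDr !mulr_ge0// powR_ge0.
Qed.

Lemma w_parabolic_norm :
  (parabolic_holder_norm P gamma (2 * b) T w <= ((T `^ b + (K + 1)) * N)%:E)%E.
Proof.
have stripP (p : R * R) : strip T p -> 0 <= p.1 <= T /\ 0 <= p.2.
  by move=> [/DT p1 /DY p2].
have -> : ((T `^ b + (K + 1)) * N)%:E = ((T `^ b * N)%:E + ((K + 1) * N)%:E)%E.
  by rewrite -EFinD mulrDl.
apply: leeD.
  apply: ge_ereal_sup => _ [p /stripP[pT p0] <-]; exact: w_bound.
apply: ge_ereal_sup => _ [[[t y] [s z]] /= [/stripP/=[tT y0] /stripP/=[sT z0] neq] <-].
have -> : 2 * b / 2 = b by field.
set D := `|y - z| `^ (2 * b) + `|t - s| `^ b.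
have D0 : 0 < D.
  rewrite /D lt_def addr_ge0 ?powR_ge0// andbT paddr_eq0 ?powR_ge0//.
  rewrite !powR_eq0 !normr_eq0 !subr_eq0; apply: contra neq.
  by move=> /andP[/andP[/eqP-> _] /andP[/eqP-> _]] /=; exact: eqxx.
rewrite muleC; apply: le_trans (lee_wpmul2l _ (w_holder tT y0 sT z0)) _.
  by rewrite lee_fin invr_ge0 ltW.
by rewrite -EFinM lee_fin -/D mulrC mulfK// gt_eqF.
Qed.

End bounds.

End regular_representation.

(** * The estimates for the half-line problem *)

(** [Wsol] is linear in psi, and bounded by its supremum. *)
Lemma Wsol_difference {R : realType} (T b N1 N2 M : R) (psi1 psi2 : R -> R) t y :
  0 < T -> 0 < b -> 0 <= N1 -> 0 <= N2 ->
  (forall r, r <= 0 -> psi1 r = 0) -> (forall r, r <= 0 -> psi2 r = 0) ->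
  (forall r r', r <= T -> r' <= T -> `|psi1 r - psi1 r'| <= N1 * `|r - r'| `^ b) ->
  (forall r r', r <= T -> r' <= T -> `|psi2 r - psi2 r'| <= N2 * `|r - r'| `^ b) ->
  t <= T -> 0 <= y -> (forall r, r <= T -> `|psi1 r - psi2 r| <= M) ->
  `|Wsol T psi1 t y - Wsol T psi2 t y| <= M.
Proof.
move=> T0 b0 N10 N20 psi10 psi20 psi1H psi2H tT y0 psiM.
have -> : Wsol T psi1 t y - Wsol T psi2 t y = Wsol T (fun r => psi1 r - psi2 r) t y.
  rewrite /Wsol; have [//|yN0] := eqVneq y 0.
  have ygt0 : 0 < y by rewrite lt_def yN0.
  have i1 := integrable_kerP_psi T0 b0 N10 psi10 psi1H tT ygt0.
  have i2 := integrable_kerP_psi T0 b0 N20 psi20 psi2H tT ygt0.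
  by rewrite -RintegralB//; apply: eq_Rintegral => s _; rewrite mulrBr.
apply: (Wsol_le T0 b0 (addr_ge0 N10 N20) _ tT y0 psiM) => r r' rT r'T.
have -> : psi1 r - psi2 r - (psi1 r' - psi2 r') = (psi1 r - psi1 r') - (psi2 r - psi2 r') by ring.
by apply: le_trans (ler_normB _ _) _; rewrite mulrDl lerD// ?psi1H ?psi2H.
Qed.

Section half_line.
Context {d : measure_display} {Omega : measurableType d} {R : realType}.
Variables (P : probability Omega R) (gamma : R).
Hypothesis gamma2 : 2 <= gamma.
Local Notation Nm := (Lgnorm P gamma).
Local Notation Lg := (Lfun P gamma%:E).
Local Notation ball := (dual_ball P gamma).

Lemma holder_seminorm_le (b T N : R) (g : R -> Omega -> R) :
  (holder_seminorm P gamma b T g <= N%:E)%E ->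
  forall s r, 0 <= s <= T -> 0 <= r <= T -> s != r ->
  (Nm (g s \- g r)%R <= (N * `|s - r| `^ b)%:E)%E.
Proof.
move=> gN s r sT rT sr.
have p0 : 0 < `|s - r| `^ b by rewrite powR_gt0// normr_gt0 subr_eq0.
have : (Nm (g s \- g r)%R * ((`|s - r| `^ b)^-1)%:E <= N%:E)%E.
  by apply: le_trans gN; apply: ereal_sup_ubound; exists (s, r).
by rewrite EFinM lee_pdivrMr.
Qed.

(** The pairings of w are recorded in the conclusion, because the comparison of
    two solutions is made on them. *)
Lemma second_derivative_exists (b T : R) (h h' : R -> Omega -> R) :
  0 < T -> 0 < b -> b < 2^-1 -> C1_holder P gamma b T h h' ->
  h 0 = cst 0 %[ae P] -> h' 0 = cst 0 %[ae P] ->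
  exists2 N : R, 0 <= N /\ holder_seminorm P gamma b T h' = N%:E &
  exists w : R -> R -> Omega -> R,
    [/\ forall t y, 0 <= t <= T -> 0 <= y -> w t y \in Lg /\
          forall Z, ball Z -> pairing P (w t y) Z = Wsol T (ext_pairing P h' Z) t y,
        is_dt P gamma T (half_line_solution P gamma h) w,
        is_dyy P gamma T (half_line_solution P gamma h) w,
        (parabolic_holder_norm P gamma (2 * b) T w <=
          ((T `^ b + (b^-1 + (2^-1 - b)^-1 + 1)) * N)%:E)%E &
        forall Z, ball Z -> forall r r', r <= T -> r' <= T ->
          `|ext_pairing P h' Z r - ext_pairing P h' Z r'| <= N * `|r - r'| `^ b].
Proof.
move=> T0 b0 b12 [hL hd hfin] h0 h'0.
have S0 : (0 <= holder_seminorm P gamma b T h')%E.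
  pose p := (T, 0 : R).
  apply: (@le_trans _ _ (Nm (h' p.1 \- h' p.2)%R * ((`|p.1 - p.2| `^ b)^-1)%:E)%E).
    by rewrite mule_ge0// ?Lgnorm_ge0// lee_fin invr_ge0 powR_ge0.
  apply: ereal_sup_ubound; exists p => //; split => //=; last by rewrite gt_eqF.
  - by rewrite lexx ltW.
  - by rewrite lexx ltW.
have SE : holder_seminorm P gamma b T h' = (fine (holder_seminorm P gamma b T h'))%:E.
  by rewrite fineK// ge0_fin_numE.
set N := fine _ in SE; have N0 : 0 <= N by rewrite fine_ge0.
exists N => //.
have hH := @holder_seminorm_le b T N h'; rewrite {1}SE lexx in hH; have {}hH := hH isT.
have psi0 := ext_pairing_le0 P h'.
have psiH Z (ZB : ball Z) := ext_pairing_holder gamma2 T0 b0 N0 hd hH h'0 ZB.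
have phiT Z (ZB : ball Z) := ext_pairing_taylor gamma2 T0 b0 N0 hL hd hH h0 h'0 ZB.
have vP t y := @solution_pairing _ _ _ P gamma gamma2 T b N h h' T0 b0 N0 hL hd hH h0 h'0 t y.
have [u [w [uP wP]]] := exists_derivatives gamma2 T0 b0 N0 (ext_pairing_le0 P h) psi0 psiH phiT vP.
exists w; split=> //.
- exact (solution_is_dt gamma2 T0 b0 N0 (ext_pairing_le0 P h) psi0 psiH phiT vP wP).
- exists u.
  + exact (solution_is_dy gamma2 T0 b0 N0 (ext_pairing_le0 P h) psi0 psiH phiT vP uP).
  + exact (gradient_is_dy gamma2 T0 b0 b12 N0 psi0 psiH uP wP).
- exact (w_parabolic_norm gamma2 T0 b0 b12 N0 psi0 psiH wP).
Qed.

(** The pairing of w1 - w2 with Z is the scalar solution for the difference of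
    the two data, which [Wsol_difference] bounds with constant 1. *)
Lemma second_derivative_difference (T b N1 N2 M : R) (h1' h2' : R -> Omega -> R)
    (w1 w2 : R -> R -> Omega -> R) :
  0 < T -> 0 < b -> 0 <= N1 -> 0 <= N2 ->
  (forall t, 0 <= t <= T -> h1' t \in Lg) -> (forall t, 0 <= t <= T -> h2' t \in Lg) ->
  h1' 0 = cst 0 %[ae P] -> h2' 0 = cst 0 %[ae P] ->
  (forall Z, ball Z -> forall r r', r <= T -> r' <= T ->
    `|ext_pairing P h1' Z r - ext_pairing P h1' Z r'| <= N1 * `|r - r'| `^ b) ->
  (forall Z, ball Z -> forall r r', r <= T -> r' <= T ->
    `|ext_pairing P h2' Z r - ext_pairing P h2' Z r'| <= N2 * `|r - r'| `^ b) ->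
  (forall t y, 0 <= t <= T -> 0 <= y -> w1 t y \in Lg /\
    forall Z, ball Z -> pairing P (w1 t y) Z = Wsol T (ext_pairing P h1' Z) t y) ->
  (forall t y, 0 <= t <= T -> 0 <= y -> w2 t y \in Lg /\
    forall Z, ball Z -> pairing P (w2 t y) Z = Wsol T (ext_pairing P h2' Z) t y) ->
  0 <= M -> (forall t, 0 <= t <= T -> (Nm (h1' t \- h2' t)%R <= M%:E)%E) ->
  forall t y, 0 <= t <= T -> 0 <= y -> (Nm (w1 t y \- w2 t y)%R <= M%:E)%E.
Proof.
move=> T0 b0 N10 N20 h1L h2L h10 h20 H1 H2 w1P w2P M0 hM t y tT y0.
have [w1L w1E] := w1P t y tT y0; have [w2L w2E] := w2P t y tT y0.
apply: (Lgnorm_le_dual gamma2); first exact: LfunB.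
move=> Z ZB; rewrite (pairingB gamma2)// w1E// w2E//; have [_ tT1] := andP tT.
apply: (Wsol_difference T0 b0 N10 N20 (@ext_pairing_le0 _ _ _ P h1' Z) (@ext_pairing_le0 _ _ _ P h2' Z)
  (H1 Z ZB) (H2 Z ZB) tT1 y0) => r rT.
rewrite /ext_pairing /ext0; have [_|r0] := leP r 0; first by rewrite subrr normr0.
have rT' : 0 <= r <= T by rewrite (ltW r0).
rewrite -(pairingB gamma2) ?h1L ?h2L//; apply: (pairing_le gamma2) => //; last exact: hM.
by apply: LfunB => //; [exact: h1L|exact: h2L].
Qed.
End half_line.

Theorem lemma3p6 (R : realType) (alpha gamma T : R)
    (alpha01 : 0 < alpha < 1) (gamma2 : 2 <= gamma) (T0 : 0 < T) :
  exists2 C : R, 0 < C &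
  forall (d : measure_display) (Omega : measurableType d)
         (P : probability Omega R),
  (forall h h' : R -> Omega -> R,
     C1_holder P gamma (alpha / 2) T h h' ->
     h 0 = cst 0 %[ae P] -> h' 0 = cst 0 %[ae P] ->
     exists vt vyy : R -> R -> Omega -> R,
       [/\ is_dt P gamma T (half_line_solution P gamma h) vt,
           is_dyy P gamma T (half_line_solution P gamma h) vyy &
           (parabolic_holder_norm P gamma alpha T vt +
            parabolic_holder_norm P gamma alpha T vyy
            <= C%:E * holder_seminorm P gamma (alpha / 2) T h')%E])
  /\
  (forall h1 h1' h2 h2' : R -> Omega -> R,
     C1_holder P gamma (alpha / 2) T h1 h1' ->
     C1_holder P gamma (alpha / 2) T h2 h2' ->
     h1 0 = cst 0 %[ae P] -> h2 0 = cst 0 %[ae P] ->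
     h1' 0 = cst 0 %[ae P] -> h2' 0 = cst 0 %[ae P] ->
     exists v1yy v2yy : R -> R -> Omega -> R,
       [/\ is_dyy P gamma T (half_line_solution P gamma h1) v1yy,
           is_dyy P gamma T (half_line_solution P gamma h2) v2yy &
           (ereal_sup [set 'E_P[fun w => (`|v1yy p.1 p.2 w - v2yy p.1 p.2 w|
                                          `^ gamma)%R] | p in strip T]
            <= C%:E * ereal_sup [set 'E_P[fun w => (`|h1' t w - h2' t w|
                                          `^ gamma)%R] | t in `[0%R, T]])%E]).
Proof.
have [alpha0 alpha1] := andP alpha01; pose b := alpha / 2.
have b0 : 0 < b by rewrite divr_gt0.
have b12 : b < 2^-1 by rewrite /b ltr_pdivrMr// mulVf.
have bE : 2 * b = alpha by rewrite /b; field.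
have gamma0 : 0 < gamma by exact: lt_le_trans gamma2.
pose K := b^-1 + (2^-1 - b)^-1.
have K0 : 0 <= K by rewrite addr_ge0// invr_ge0 ?subr_ge0 ltW.
(* T^b bounds the supremum of W, and K + 1 its Hölder seminorm, in units of
   the seminorm of h'.  The factor 2 in C counts the two derivatives. *)
pose A := T `^ b + (K + 1).
have A1 : 1 <= A by rewrite /A addrA lerDr addr_ge0// powR_ge0.
exists (2 * A); first by rewrite mulr_gt0// (lt_le_trans ltr01 A1).
move=> d Omega P; split.
  move=> h h' hC h0 h'0.
  have [N [N0 NE] [w [_ wt wyy wN _]]] := second_derivative_exists gamma2 T0 b0 b12 hC h0 h'0.
  rewrite bE in wN.
  (* The heat equation: the same process is both derivatives. *)
  exists w, w; split => //; rewrite NE; apply: le_trans (leeD wN wN) _.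
  by rewrite -EFinD -EFinM lee_fin le_eqVlt; apply/orP; left; apply/eqP; rewrite /A /K; ring.
move=> h1 h1' h2 h2' h1C h2C h10 h20 h1'0 h2'0.
have [N1 [N10 _] [w1 [w1P _ w1yy _ H1]]] := second_derivative_exists gamma2 T0 b0 b12 h1C h10 h1'0.
have [N2 [N20 _] [w2 [w2P _ w2yy _ H2]]] := second_derivative_exists gamma2 T0 b0 b12 h2C h20 h2'0.
exists w1, w2; split => //.
set S := ereal_sup [set _ | t in `[0, T]].
have EE (f g : Omega -> R) : ('E_P[fun w => (`|f w - g w| `^ gamma)%R] =
    \int[P]_w (`|(f \- g)%R w| `^ gamma)%:E)%E by rewrite unlock.
have leS t : 0 <= t <= T -> (\int[P]_w (`|(h1' t \- h2' t) w| `^ gamma)%:E <= S)%E.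
  move=> tT; rewrite -EE; apply: ereal_sup_ubound; exists t => //=.
have S0 : (0 <= S)%E.
  apply: le_trans (leS 0 _); last by rewrite lexx ltW.
  by apply: integral_ge0 => w _; rewrite lee_fin powR_ge0.
have [Soo|Sfin] := eqVneq S +oo%E.
  by rewrite Soo gt0_muley ?leey// lte_fin mulr_gt0// (lt_le_trans ltr01 A1).
have SE : S = (fine S)%:E by rewrite fineK// ge0_fin_numE// ltey.
have s0 : 0 <= fine S by exact: fine_ge0.
pose M := fine S `^ gamma^-1.
have ME : M `^ gamma = fine S by rewrite -powRrM mulVf ?gt_eqF// powRr1.
have M0 : 0 <= M by exact: powR_ge0.
have hM t : 0 <= t <= T -> (Lgnorm P gamma (h1' t \- h2' t)%R <= M%:E)%E.
  by move=> tT; apply/(Lgnorm_leP P gamma2 _ M0); rewrite ME -SE; exact: leS.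
have h1L t : 0 <= t <= T -> h1' t \in Lfun P gamma%:E by case: h1C => _ hd _; exact: (h'L hd).
have h2L t : 0 <= t <= T -> h2' t \in Lfun P gamma%:E by case: h2C => _ hd _; exact: (h'L hd).
apply: (@le_trans _ _ S); last first.
  apply: lee_pemull => //; rewrite lee_fin; apply: (le_trans A1).
  by rewrite ler_peMl ?ler1n// (le_trans ler01).
apply: ge_ereal_sup => _ [[t y] [/= tT y0] <-].
have {}tT : 0 <= t <= T by move: tT; rewrite /= in_itv.
have {}y0 : 0 <= y by move: y0; rewrite /= in_itv/= andbT.
rewrite EE SE -ME; apply/(Lgnorm_leP P gamma2 _ M0).
exact: (second_derivative_difference gamma2 T0 b0 N10 N20 h1L h2L h1'0 h2'0 H1 H2 w1P w2P M0 hM).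
Qed.
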